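(* For any constant $a\in\mathbb{N}^+$, any constant $c\in\mathbb{N}$, any $k=\Theta(n/\log^c n)$, any $\epsilon=1/2^{\Theta(\log^a n)}$ and any constant $\gamma\in(0,1)$, there exists an explicit strong $(k,\epsilon)$-extractor $\mathsf{Ext}:\{0,1\}^n\times\{0,1\}^d\to\{0,1\}^m$ computable in $\mathsf{AC}^0$ of depth $\Theta(a+c)$, where $d=(\log n)^{\Theta(a)}$, $m=n^{1/10800}(\log n)^{\Theta(a)}=k^{\Omega(1)}$, and the locality is $(\log n)^{\Theta(a+c)}$.
   Context: An $(n,k)$-source is a distribution on $\{0,1\}^n$ with min-entropy at least $k$. $\mathsf{Ext}$ is a strong $(k,\epsilon)$-extractor if for every $(n,k)$-source $X$ and independent uniform seed $U\in\{0,1\}^d$, $U\circ\mathsf{Ext}(X,U)$ is $\epsilon$-close in statistical distance to uniform on $\{0,1\}^{d+m}$. The locality is $\ell$ if for every fixed seed $r$, each output bit of $x\mapsto\mathsf{Ext}(x,r)$ depends on at most $\ell$ bits of $x$. $\mathsf{AC}^0$: polynomial-size, constant-depth circuits with NOT and unbounded fan-in AND/OR gates. Explicit means polynomial-time computable. Asymptotics are as $n\to\infty$. *)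

(* Defs.v *)
From HB Require Import structures.
From mathcomp Require Import all_boot all_order all_algebra.
From mathcomp Require Import all_classical all_reals all_analysis.

Set Implicit Arguments.
Unset Strict Implicit.
Unset Printing Implicit Defensive.

Import Order.TTheory GRing.Theory Num.Theory.
Local Open Scope classical_set_scope.
Local Open Scope ring_scope.

Section Asymptotics.
Variable R : realType.

Definition log2 (x : R) : R := ln x / ln 2.

(* Landau's Theta for eventually positive functions. The library's [=Theta_]
   compares norms, so it would also allow f to be negative. *)
Definition is_Theta (f g : nat -> R) : Prop :=
  exists c1 c2 : R, [/\ 0 < c1, 0 < c2 &
    \forall n \near \oo, c1 * g n <= f n <= c2 * g n].

(* Theta of a parameter that does not vary with n (such as Theta(a), for a
   constant a): the pair C holds the two absolute constants hidden by Theta,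
   so that v = Theta(t) reads C.1 * t <= v <= C.2 * t. *)
Definition Theta_consts (C : R * R) : Prop := 0 < C.1 /\ 0 < C.2.

Definition Theta_with (C : R * R) (v t : R) : Prop := C.1 * t <= v <= C.2 * t.

(* f n = g n * (log n)^Theta(t) as n tends to infinity, the exponent lying
   between C.1 * t and C.2 * t. *)
Definition polylog_Theta_with (C : R * R) (t : R) (g f : nat -> R) : Prop :=
  \forall n \near \oo,
    g n * log2 n%:R `^ (C.1 * t) <= f n <= g n * log2 n%:R `^ (C.2 * t).

End Asymptotics.

Section Extractors.
Variable R : realType.

Definition is_dist (T : finType) (P : {ffun T -> R}) : Prop :=
  (forall x, 0 <= P x) /\ \sum_x P x = 1.

Definition uniform (T : finType) : {ffun T -> R} := [ffun=> #|T|%:R^-1].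

Definition prod_dist (T U : finType) (P : {ffun T -> R}) (Q : {ffun U -> R}) :
  {ffun T * U -> R} := [ffun z => P z.1 * Q z.2].

Definition image_dist (T U : finType) (f : T -> U) (P : {ffun T -> R}) :
  {ffun U -> R} := [ffun y => \sum_(x | f x == y) P x].

(* For a distribution P the infimum is over a finite nonempty set, hence is the
   minimum over the support of P. *)
Definition min_entropy (T : finType) (P : {ffun T -> R}) : R :=
  inf [set log2 (P x)^-1 | x in [set x | 0 < P x]].

Definition stat_dist (T : finType) (P Q : {ffun T -> R}) : R :=
  2^-1 * \sum_x `|P x - Q x|.

Definition is_source (n : nat) (k : R) (X : {ffun n.-tuple bool -> R}) : Prop :=
  is_dist X /\ k <= min_entropy X.

Definition strong_extractor (n d m : nat) (k eps : R)
    (Ext : n.-tuple bool -> d.-tuple bool -> m.-tuple bool) : Prop :=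
  forall X : {ffun n.-tuple bool -> R}, is_source k X ->
    stat_dist
      (image_dist (fun z : n.-tuple bool * d.-tuple bool =>
                     [tuple of z.2 ++ Ext z.1 z.2])
                  (prod_dist X (uniform (d.-tuple bool))))
      (uniform ((d + m).-tuple bool)) <= eps.

End Extractors.

Definition depends_only_on (n : nat) (f : n.-tuple bool -> bool)
    (S : {set 'I_n}) : Prop :=
  forall x y : n.-tuple bool,
    (forall i, i \in S -> tnth x i = tnth y i) -> f x = f y.

Definition has_locality (n d m l : nat)
    (Ext : n.-tuple bool -> d.-tuple bool -> m.-tuple bool) : Prop :=
  forall (r : d.-tuple bool) (j : 'I_m), exists S : {set 'I_n},
    (#|S| <= l)%N /\ depends_only_on (fun x => tnth (Ext x r) j) S.

Definition ext_family (d m : nat -> nat) : Type :=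
  forall n, n.-tuple bool -> (d n).-tuple bool -> (m n).-tuple bool.

Definition poly_bound (C e N : nat) : nat := (C * N ^ e + C)%N.

(* A circuit on N input bits: wires 0 .. N-1 carry the inputs and the i-th gate
   drives wire N + i, so a circuit is a directed acyclic graph listed in
   topological order. The empty AND and OR give the constants. *)
Inductive gate : Type :=
| NotGate of nat
| AndGate of seq nat
| OrGate of seq nat.

Definition gate_inputs (g : gate) : seq nat :=
  match g with NotGate w => [:: w] | AndGate ws => ws | OrGate ws => ws end.

Record circuit : Type := Circuit {
  circ_gates : seq gate;
  circ_outputs : seq nat }.

Definition circ_wf (N : nat) (c : circuit) : Prop :=
  (forall i, (i < size (circ_gates c))%N ->
     all (fun w => w < N + i)%N
         (gate_inputs (nth (NotGate 0) (circ_gates c) i))) /\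
  all (fun w => w < N + size (circ_gates c))%N (circ_outputs c).

Definition eval_gate (vals : seq bool) (g : gate) : bool :=
  match g with
  | NotGate w => ~~ nth false vals w
  | AndGate ws => all (nth false vals) ws
  | OrGate ws => has (nth false vals) ws
  end.

Definition circ_eval (c : circuit) (inp : seq bool) : seq bool :=
  let vals :=
    foldl (fun vs g => rcons vs (eval_gate vs g)) inp (circ_gates c) in
  [seq nth false vals w | w <- circ_outputs c].

(* Every gate, including NOT, adds one to the depth. *)
Definition circ_depth (N : nat) (c : circuit) : nat :=
  let depths :=
    foldl (fun ds g => rcons ds (\max_(w <- gate_inputs g) nth 0%N ds w).+1)
          (nseq N 0%N) (circ_gates c) in
  \max_(w <- circ_outputs c) nth 0%N depths w.

Definition computable_in_AC0 (D : nat) (d m : nat -> nat)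
    (Ext : ext_family d m) : Prop :=
  exists C e : nat, forall n, exists c : circuit,
    [/\ circ_wf (n + d n) c,
        (size (circ_gates c) <= poly_bound C e (n + d n))%N,
        (circ_depth (n + d n) c <= D)%N &
        forall (x : n.-tuple bool) (r : (d n).-tuple bool),
          circ_eval c (x ++ r) = Ext n x r].

(* Deterministic multitape Turing machines with two-way infinite tapes. Tape 0
   holds the input at the start and the output when the machine halts. *)
Inductive symbol : Type := Blank | Sep | Bit of bool.

Inductive move : Type := MoveL | MoveS | MoveR.

Record TM : Type := MkTM {
  tm_state : finType;
  tm_tapes : nat;
  tm_start : tm_state;
  tm_halted : pred tm_state;
  tm_delta : tm_state -> {ffun 'I_tm_tapes.+1 -> symbol} ->
             tm_state * {ffun 'I_tm_tapes.+1 -> symbol * move} }.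

Record tape : Type := MkTape { tape_cells : int -> symbol; tape_head : int }.

Definition move_offset (mv : move) : int :=
  match mv with MoveL => -1 | MoveS => 0 | MoveR => 1 end.

Definition tape_read (t : tape) : symbol := tape_cells t (tape_head t).

Definition tape_act (t : tape) (a : symbol * move) : tape :=
  MkTape (fun z => if z == tape_head t then a.1 else tape_cells t z)
         (tape_head t + move_offset a.2).

Definition tape_of (s : seq symbol) : tape :=
  MkTape (fun z => if z is Posz j then nth Blank s j else Blank) 0.

Definition tm_config (M : TM) : Type :=
  (tm_state M * ('I_(tm_tapes M).+1 -> tape))%type.

Definition tm_step (M : TM) (c : tm_config M) : tm_config M :=
  if tm_halted c.1 then c else
  let qa := tm_delta c.1 [ffun i => tape_read (c.2 i)] in
  (qa.1, fun i => tape_act (c.2 i) (qa.2 i)).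

Definition tm_init (M : TM) (inp : seq symbol) : tm_config M :=
  (tm_start M, fun i => tape_of (if i == ord0 then inp else [::])).

(* M halts within t steps, with tape 0 holding exactly the bits of out from
   cell 0 on, followed by a blank. *)
Definition tm_computes (M : TM) (inp : seq symbol) (out : seq bool)
    (t : nat) : Prop :=
  let c := iter t (@tm_step M) (tm_init M inp) in
  tm_halted c.1 /\
  forall j : nat, (j <= size out)%N ->
    tape_cells (c.2 ord0) (Posz j) = nth Blank (map Bit out) j.

Definition explicit (d m : nat -> nat) (Ext : ext_family d m) : Prop :=
  exists (M : TM) (C e : nat),
    forall n (x : n.-tuple bool) (r : (d n).-tuple bool),
      tm_computes M (map Bit x ++ Sep :: map Bit r) (Ext n x r)
                  (poly_bound C e (n + d n)).

(* Main.v *)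
(** One output bit is a parity of sampled source bits, linear in the source x.
    A round of sampling reads a random affine map i |-> u + A i over F_2^lambda
    (lambda the bit length of n) and adds up, with independent random coefficients,
    the parities of x over the images of {0,1}^h for h = 0, ..., H. If z has weight
    at least 2^lambda / 2^(H+2), the expected number of hits of its support is
    between 1/4 and 1/2 at some level h, so pairwise independence makes that level
    odd with probability at least 3/16, and the round has bias at most 13/16 on z.
    XORing independent rounds multiplies the biases; the seed length does not depend
    on H, while 2^H = polylog(n) bounds the locality. Two independent samples of a
    source of min-entropy n / log^c n differ in few places with tiny probability, so
    the second moment of the bias of the output bit is small.

    Many bits are obtained as in the Nisan-Wigderson generator. Coordinate u of the
    seed of bit j is stored in cell (u, j mod p_u), p_u the u-th prime: bits i and j
    share coordinate u iff p_u divides i - j, so they share at most log m coordinates.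
    Once the other seed bits are fixed, the bits before bit i are determined by truth
    tables of total size m^2, and conditioning on those tables costs m^2 bits of
    entropy, far below the min-entropy.

    Explicitness: all the arithmetic is expressible by sums with variable bounds,
    truncated subtraction and input lookups; such expressions are evaluated in
    polynomial time by a machine using its heads as counters. In AC0, a lookup is a
    disjunction over positions and a parity of (C log n)^q bits is a tree of q levels
    of parities of C log n bits, each in disjunctive normal form. *)

Require Import Defs.
From mathcomp Require Import all_boot all_order all_algebra.
From mathcomp Require Import all_classical all_reals all_analysis.
From mathcomp Require Import zify ring lra.

Set Implicit Arguments.
Unset Strict Implicit.
Unset Printing Implicit Defensive.

Import Order.TTheory GRing.Theory Num.Theory.

(** * Powers, bits and primes *)

Lemma leq_expn2r e m n : m <= n -> m ^ e <= n ^ e.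
Proof. by case: e => // e mn; rewrite leq_exp2r. Qed.

Lemma leq_poly_bound C e N : (C * N.+1) ^ e <= poly_bound ((2 * C) ^ e) e N.
Proof.
rewrite /poly_bound; have [->|N_gt0] := posnP N.
  by apply: leq_trans (leq_addl _ _); apply: leq_expn2r; lia.
by rewrite -expnMn; apply: leq_trans (leq_addr _ _); apply: leq_expn2r; nia.
Qed.

Definition poly_bounded (f : nat -> nat) : Prop := exists q, forall M, f M <= M.+2 ^ q.

Lemma poly_bounded_le f g : poly_bounded g -> (forall M, f M <= g M) -> poly_bounded f.
Proof. by move=> [q g_le] fg; exists q => M; exact: leq_trans (fg M) (g_le M). Qed.

Lemma poly_bounded_const k : poly_bounded (fun=> k).
Proof.
exists k => M; apply: leq_trans (ltnW (ltn_expl k (isT : 1 < 2))) _.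
exact: leq_expn2r.
Qed.

Lemma poly_bounded_id : poly_bounded id.
Proof. by exists 1 => M; rewrite expn1; lia. Qed.

Lemma poly_bounded_mul f g :
  poly_bounded f -> poly_bounded g -> poly_bounded (fun M => f M * g M).
Proof. by move=> [p fp] [q gq]; exists (p + q) => M; rewrite expnD leq_mul. Qed.

Lemma poly_bounded_add f g :
  poly_bounded f -> poly_bounded g -> poly_bounded (fun M => f M + g M).
Proof.
move=> [p fp] [q gq]; exists (p + q).+1 => M; rewrite expnS expnD.
have [Mp Mq] : 0 < M.+2 ^ p /\ 0 < M.+2 ^ q by rewrite !expn_gt0.
apply: leq_trans (leq_add (fp M) (gq M)) _.
apply: leq_trans (_ : 2 * (M.+2 ^ p * M.+2 ^ q) <= _); last by rewrite leq_mul2r orbT.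
by move: (M.+2 ^ p) (M.+2 ^ q) Mp Mq => P Q; nia.
Qed.

Lemma poly_bounded_succ f : poly_bounded f -> poly_bounded (fun M => (f M).+1).
Proof.
move=> /poly_bounded_add /(_ (poly_bounded_const 1)) [q fq].
by exists q => M; rewrite -addn1; exact: fq.
Qed.

Lemma poly_bounded_comp f g :
  poly_bounded f -> poly_bounded g -> poly_bounded (fun M => f (g M)).
Proof.
move=> [p fp] /poly_bounded_add /(_ (poly_bounded_const 2)) [q gq].
exists (q * p) => M; apply: leq_trans (fp _) _; rewrite expnM; apply: leq_expn2r.
by rewrite -addn2; exact: gq.
Qed.

Lemma poly_bounded_exp k f : poly_bounded f -> poly_bounded (fun M => f M ^ k).
Proof. by move=> [q f_le]; exists (q * k) => M; rewrite expnM; exact: leq_expn2r. Qed.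

Lemma radix_inj d q r q' r' : r < d -> r' < d ->
  q * d + r = q' * d + r' -> q = q' /\ r = r'.
Proof. by move=> rd r'd eq_qr; have := edivn_eq q rd; rewrite eq_qr edivn_eq // => -[]. Qed.

Lemma odd_sum (I : Type) (s : seq I) (P : pred I) (F : I -> nat) :
  odd (\sum_(i <- s | P i) F i) = \big[addb/false]_(i <- s | P i) odd (F i).
Proof. exact: (big_morph odd oddD). Qed.

Lemma sum_le1_has (I : eqType) (s : seq I) (P : pred I) : uniq s ->
  {in s &, forall i j, P i -> P j -> i = j} -> \sum_(i <- s) P i = has P s.
Proof.
move=> s_uniq P_inj; case: hasP => [[i i_s Pi]|P_none].
  rewrite (bigD1_seq i) //= Pi big1_seq // => j /andP [ji j_s].
  by apply/eqP; rewrite eqb0; apply: contra ji => Pj; apply/eqP/P_inj.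
rewrite big1_seq // => i /andP [_ i_s]; apply/eqP; rewrite eqb0.
by apply/negP => Pi; apply: P_none; exists i.
Qed.

Definition bitlen (v : nat) : nat := up_log 2 v.+1.

Lemma bitlen_gt v : v < 2 ^ bitlen v.
Proof. exact: up_logP. Qed.

Lemma bitlen_le v : 2 ^ bitlen v <= 2 * v + 1.
Proof.
case: v => [|v]; first by rewrite /bitlen up_log1.
have /andP [lt _] := up_log_bounds (isT : 1 < 2) (isT : 1 < v.+2).
have : 0 < bitlen v.+1 by rewrite up_log_gt0.
by move: lt; rewrite -/(bitlen v.+1); case: (bitlen v.+1) => // b /=; rewrite expnS; lia.
Qed.

Lemma bitlen_le4 n : 0 < n -> 2 ^ bitlen n <= 4 * n.
Proof. by move=> n_gt0; apply: leq_trans (bitlen_le n) _; lia. Qed.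

Lemma bitlen_exp2 h : bitlen (2 ^ h) = h.+1.
Proof.
apply: up_log_eq => //; rewrite ltnS leqnn /=.
by rewrite expnS mul2n -addnn -[X in X < _]addn0 ltn_add2l expn_gt0.
Qed.

Lemma exp2_bitlen_poly : poly_bounded (fun n => 2 ^ bitlen n).
Proof.
apply: poly_bounded_le bitlen_le; apply: poly_bounded_add (poly_bounded_const 1).
exact: poly_bounded_mul (poly_bounded_const 2) poly_bounded_id.
Qed.

Lemma bitlen_poly : poly_bounded bitlen.
Proof. by apply: poly_bounded_le exp2_bitlen_poly _ => n; exact/ltnW/ltn_expl. Qed.

Definition nat_bit (v b : nat) : bool := odd (v %/ 2 ^ b).

Lemma nat_bit_inj l v v' : v < 2 ^ l -> v' < 2 ^ l ->
  (forall b, b < l -> nat_bit v b = nat_bit v' b) -> v = v'.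
Proof.
elim: l v v' => [|l IH] v v'; first by case: v v' => [|?] [|?].
rewrite expnS => vl vl' eq_bit.
have eq_odd : odd v = odd v' by have := eq_bit 0 isT; rewrite /nat_bit expn0 !divn1.
have eq_half : v./2 = v'./2.
  apply: IH => [||b bl]; [by lia|by lia|].
  by have := eq_bit b.+1 bl; rewrite /nat_bit expnS !divnMA !divn2.
by rewrite -(odd_double_half v) -(odd_double_half v') eq_odd eq_half.
Qed.

Lemma sqr_le_exp2 y : 4 <= y -> y ^ 2 <= 2 ^ y.
Proof.
elim: y => // y IH; rewrite ltnS leq_eqVlt => /orP [/eqP <- //|y_ge4].
by have := IH y_ge4; rewrite -!mulnn [2 ^ y.+1]expnS; nia.
Qed.

(* Halving the exponent leaves a factor 2 ^ (x / 2) >= (x / 2) ^ 2, which absorbs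
   the constants and one more power of x. *)
Lemma poly_le_exp2 D : exists N0, forall x, N0 <= x -> x ^ D <= 2 ^ x.
Proof.
elim: D => [|D [N0 IH]]; first by exists 0 => x _; rewrite expn0 expn_gt0.
exists (2 * (N0 + 4 + 4 ^ D.+1) + 2) => x xN.
pose y := x./2; have [yN0 y_ge4 yD] : [/\ N0 <= y, 4 <= y & 4 ^ D.+1 <= y].
  by rewrite /y; move: (4 ^ _) xN => q; split; lia.
apply: leq_trans (_ : (4 * y) ^ D.+1 <= _); first by apply: leq_expn2r; rewrite /y; lia.
apply: leq_trans (_ : 2 ^ y * 2 ^ y <= _); last by rewrite -expnD leq_exp2l // /y; lia.
rewrite expnMn [y ^ _]expnS mulnA; apply: leq_mul; last exact: IH.
by apply: leq_trans (sqr_le_exp2 y_ge4); rewrite -mulnn leq_mul2r yD orbT.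
Qed.

Lemma poly_le_exp2_half D E : exists N0, forall x, N0 <= x ->
  E * x ^ D <= 2 ^ (x %/ 2).
Proof.
have [N0 pow_le] := poly_le_exp2 D.+1.
exists (2 * (N0 + 4 ^ D.+1 * E.+1) + 2) => x xN.
pose y := x %/ 2; have [x_le_4y yN0] : x <= 4 * y /\ N0 <= y by rewrite /y; lia.
have yE : 4 ^ D * E <= y.
  apply: leq_trans (_ : 4 ^ D.+1 * E.+1 <= _); first by rewrite leq_mul // leq_exp2l.
  by rewrite /y; move: xN; move: (4 ^ D.+1 * E.+1) => q; lia.
apply: leq_trans (pow_le _ yN0); apply: leq_trans (_ : E * (4 * y) ^ D <= _).
  by apply: leq_mul => //; exact: leq_expn2r.
by rewrite expnMn mulnA [E * _]mulnC expnS leq_mul2r yE orbT.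
Qed.

Definition prime_count (v : nat) : nat := \sum_(0 <= i < v) prime i.

Lemma prime_countE v : prime_count v = count prime (iota 0 v).
Proof.
rewrite -sum1_count big_mkcond /prime_count /index_iota subn0.
by apply: eq_bigr => i _; case: prime.
Qed.

Lemma prime_countS v : prime_count v.+1 = prime_count v + prime v.
Proof. by rewrite /prime_count big_nat_recr. Qed.

Lemma leq_prime_count u v : u <= v -> prime_count u <= prime_count v.
Proof. by move=> uv; rewrite /prime_count [X in _ <= X](@big_cat_nat _ _ _ u) // leq_addr. Qed.

Lemma logn_fact_trunc p n t : prime p -> n < p ^ t.+1 ->
  logn p n`! = \sum_(1 <= k < t.+1) n %/ p ^ k.
Proof.
move=> p_prime n_lt; have p_gt1 := prime_gt1 p_prime.
have truncate s u : n < p ^ s.+1 -> s <= u ->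
    \sum_(1 <= k < u.+1) n %/ p ^ k = \sum_(1 <= k < s.+1) n %/ p ^ k.
  move=> n_lt_s su; rewrite (@big_cat_nat _ _ _ s.+1) //= [X in _ + X]big_nat_cond.
  rewrite [X in _ + X]big1 ?addn0 // => k; rewrite andbT => /andP [sk _].
  by rewrite divn_small // (leq_trans n_lt_s) // leq_exp2l.
rewrite logn_fact // -(truncate n (maxn n t)) ?leq_maxl //.
  by rewrite (truncate t) // leq_maxr.
by apply: leq_trans (ltn_expl n p_gt1) _; rewrite leq_exp2l.
Qed.

(* Legendre's formula: each power of p up to 2 * N contributes at most 1. *)
Lemma leq_pow_logn_central N p : 0 < N -> prime p ->
  p ^ logn p 'C(2 * N, N) <= 2 * N.
Proof.
move=> N_gt0 p_prime; have p_gt1 := prime_gt1 p_prime; set t := trunc_log p (2 * N).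
apply: leq_trans (trunc_logP p_gt1 _); last by lia.
have lt_2N : 2 * N < p ^ t.+1 by exact: trunc_log_ltn.
have fact_eq : 'C(2 * N, N) * (N`! * N`!) = (2 * N)`!.
  by have := @bin_fact (2 * N) N; rewrite (_ : 2 * N - N = N); [apply|]; lia.
have := congr1 (logn p) fact_eq.
rewrite !lognM ?muln_gt0 ?fact_gt0 ?bin_gt0 //; last by lia.
rewrite !(@logn_fact_trunc p _ t) //; last by lia.
rewrite -big_split /= -/t => logn_eq; rewrite leq_exp2l // -/t.
rewrite -(leq_add2r (\sum_(1 <= k < t.+1) (N %/ p ^ k + N %/ p ^ k))) logn_eq.
apply: leq_trans (_ : \sum_(1 <= k < t.+1) (1 + (N %/ p ^ k + N %/ p ^ k)) <= _).
  apply: leq_sum => k _; have pk : 0 < p ^ k by rewrite expn_gt0 ltnW.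
  have := divn_eq N (p ^ k); have := ltn_pmod N pk; move: (N %/ _) (N %% _) => q r r_lt N_eq.
  by rewrite -ltnS ltn_divLR //; lia.
by rewrite big_split /= sum_nat_const_nat subn1 muln1.
Qed.

Lemma leq_exp2_central N : 2 ^ N <= 'C(2 * N, N).
Proof.
elim: N => // N IH; rewrite expnS (_ : 2 * N.+1 = (2 * N).+2); last by lia.
by rewrite binS binS; have := @leq_bin2l (2 * N) (2 * N).+1 N (leqnSn _); lia.
Qed.

Lemma prod_nat_const_seq (I : Type) (s : seq I) b : \prod_(i <- s) b = b ^ size s.
Proof. by rewrite big_const_seq count_predT iter_muln_1. Qed.

Lemma prod_primes n : 0 < n -> \prod_(p <- primes n) p ^ logn p n = n.
Proof. by move=> n_gt0; rewrite [RHS]prod_prime_decomp // prime_decompE big_map. Qed.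

Lemma leq_prod_primes n b : 0 < n -> {in primes n, forall p, p ^ logn p n <= b} ->
  n <= b ^ size (primes n).
Proof.
move=> n_gt0 pow_le; rewrite -{1}(prod_primes n_gt0) -prod_nat_const_seq.
by rewrite big_seq [X in _ <= X]big_seq; exact: leq_prod.
Qed.

Lemma central_leq_prime_count N : 0 < N ->
  'C(2 * N, N) <= (2 * N) ^ prime_count (2 * N).+1.
Proof.
move=> N_gt0; have bin_pos : 0 < 'C(2 * N, N) by rewrite bin_gt0; lia.
apply: leq_trans (leq_prod_primes bin_pos _) _ => [p|].
  by rewrite mem_primes => /and3P [p_prime _ _]; exact: leq_pow_logn_central.
apply: leq_pexp2l; first by lia.
rewrite prime_countE -size_filter; apply: uniq_leq_size; first exact: primes_uniq.
move=> p; rewrite mem_primes mem_filter mem_iota add0n /= => /and3P [p_prime _ p_dvd].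
rewrite p_prime ltnS; have : p %| (2 * N)`!.
  by rewrite -(@bin_fact (2 * N) N); [exact: dvdn_mulr|lia].
by rewrite fact_prod Euclid_dvd_prod // big_has => /hasP [i];
  rewrite mem_index_iota => /andP [i_gt0 i_le] /dvdn_leq p_le;
  apply: leq_trans (p_le i_gt0) _.
Qed.

Lemma exp2_size_primes n : 0 < n -> 2 ^ size (primes n) <= n.
Proof.
move=> n_gt0; rewrite -[X in _ <= X](prod_primes n_gt0) -prod_nat_const_seq.
rewrite big_seq [X in _ <= X]big_seq; apply: leq_prod => p.
rewrite mem_primes => /and3P [p_prime _ p_dvd]; apply: leq_trans (prime_gt1 p_prime) _.
by rewrite -{1}[p]expn1 leq_exp2l ?prime_gt1 // logn_gt0 mem_primes p_prime n_gt0.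
Qed.

(* With N = 2^(w-1) and w = 2 * bitlen l + 4, the bounds 2^N <= C(2N, N) and
   C(2N, N) <= (2N)^prime_count(2N + 1) give 2^(w-1) <= w * prime_count(2^w + 1). *)
Definition prime_range (l : nat) : nat := (16 * (2 ^ bitlen l) ^ 2).+1.

Lemma prime_range_count l : l <= prime_count (prime_range l).
Proof.
set s := bitlen l; have -> : prime_range l = (2 * 2 ^ (2 * s + 3)).+1.
  by rewrite /prime_range -/s -expnM -[16]/(2 ^ 4) -expnD -expnS; congr (_ ^ _).+1; lia.
set P := prime_count _.
have := leq_trans (leq_exp2_central _) (@central_leq_prime_count (2 ^ (2 * s + 3)) _).
rewrite expn_gt0 /= -/P => /(_ isT); rewrite -expnS -expnM leq_exp2l // => pow_le.
have [l_lt s_lt] : l < 2 ^ s /\ s < 2 ^ s by split; [exact: bitlen_gt|exact: ltn_expl].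
rewrite leqNgt; apply/negP => Pl; move: pow_le.
by rewrite expnD mul2n -addnn expnD -[2 ^ 3]/8; move: (2 ^ s) l_lt s_lt => S; nia.
Qed.

Definition nth_prime (Q u : nat) : nat :=
  \sum_(0 <= v < Q) v * (prime v && (prime_count v == u)).

Lemma nth_primeP Q u : u < prime_count Q ->
  [/\ prime (nth_prime Q u), nth_prime Q u < Q & prime_count (nth_prime Q u) = u].
Proof.
elim: Q => [|Q IH]; first by rewrite /prime_count big_geq.
rewrite prime_countS /nth_prime big_nat_recr //= -/(nth_prime Q u) => u_lt.
have [u_lt_Q|u_ge] := ltnP u (prime_count Q).
  have [p_prime p_lt count_eq] := IH u_lt_Q.
  by rewrite [_ == u]gtn_eqF // andbF muln0 addn0; split=> //; exact: leqW.
have Q_prime : prime Q by case: (prime Q) u_lt => //; rewrite addn0 ltnNge u_ge.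
have count_eq : prime_count Q = u.
  by apply/eqP; rewrite eqn_leq u_ge; move: u_lt; rewrite Q_prime addn1 ltnS.
rewrite Q_prime count_eq eqxx muln1 [nth_prime _ _](_ : _ = 0) ?add0n //.
rewrite /nth_prime big_nat_cond big1 // => v; rewrite andbT => /andP [_ vQ].
have [v_prime|] := boolP (prime v); last by rewrite muln0.
rewrite ltn_eqF ?muln0 //; have := leq_prime_count vQ.
by rewrite prime_countS v_prime count_eq addn1.
Qed.

(** * Structured programs on Turing machines *)

Section StructuredPrograms.
Variable K : nat.
Local Notation T := 'I_K.+2.
Local Notation reads := {ffun T -> symbol}.
Local Notation acts := {ffun T -> symbol * move}.
Local Notation tapes := (T -> tape).

Inductive cmd : Type :=
| Atom of (reads -> acts)
| Seq of cmd & cmd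
| While of (reads -> bool) & cmd.

Definition reads_of (tp : tapes) : reads := [ffun i => tape_read (tp i)].
Definition act_on (tp : tapes) (w : acts) : tapes :=
  fun i => tape_act (tp i) (w i).
Definition stay (r : reads) : acts := [ffun i => (r i, MoveS)].
Definition init_tapes (inp : seq symbol) : tapes :=
  fun i => tape_of (if i == ord0 then inp else [::]).

Inductive exec : cmd -> tapes -> nat -> tapes -> Prop :=
| ExecAtom f tp : exec (Atom f) tp 1 (act_on tp (f (reads_of tp)))
| ExecSeq c1 c2 tp t1 tp1 t2 tp2 : exec c1 tp t1 tp1 -> exec c2 tp1 t2 tp2 ->
    exec (Seq c1 c2) tp (t1 + t2) tp2
| ExecDone (b : reads -> bool) c tp : ~~ b (reads_of tp) -> exec (While b c) tp 1 tp
| ExecStep (b : reads -> bool) c tp t1 tp1 t2 tp2 : b (reads_of tp) ->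
    exec c tp t1 tp1 -> exec (While b c) tp1 t2 tp2 ->
    exec (While b c) tp (t1 + t2).+1 tp2.

Lemma exec_atom f tp tp' : tp' = act_on tp (f (reads_of tp)) -> exec (Atom f) tp 1 tp'.
Proof. by move=> ->; exact: ExecAtom. Qed.

Lemma tape_act_read t mv : tape_act t (tape_read t, mv) =
  MkTape (tape_cells t) (tape_head t + move_offset mv)%R.
Proof.
rewrite /tape_act /tape_read /=; congr MkTape.
by apply/funext => z; case: eqP => [->|].
Qed.

Lemma act_on_stay tp : act_on tp (stay (reads_of tp)) = tp.
Proof.
apply/funext => i; rewrite /act_on !ffunE tape_act_read /= addr0.
by case: (tp i).
Qed.

Fixpoint cmd_state (c : cmd) : finType :=
  match c with
  | Atom _ => unit
  | Seq c1 c2 => (cmd_state c1 + cmd_state c2)%type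
  | While _ c => option (cmd_state c)
  end.

Fixpoint cmd_start (c : cmd) : cmd_state c :=
  match c return cmd_state c with
  | Atom _ => tt
  | Seq c1 c2 => inl (cmd_start c1)
  | While _ c => None
  end.

Fixpoint cmd_delta (c : cmd) : cmd_state c -> reads -> option (cmd_state c) * acts :=
  match c return cmd_state c -> reads -> option (cmd_state c) * acts with
  | Atom f => fun _ r => (None, f r)
  | Seq c1 c2 => fun s r =>
      match s with
      | inl s1 => let: (o, w) := @cmd_delta c1 s1 r in
          (Some (if o is Some s1' then inl s1' else inr (cmd_start c2)), w)
      | inr s2 => let: (o, w) := @cmd_delta c2 s2 r in (omap inr o, w)
      end
  | While b c => fun s r =>
      match s with
      | None => (if b r then Some (Some (cmd_start c)) else None, stay r)
      | Some s1 => let: (o, w) := @cmd_delta c s1 r in (Some o, w)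
      end
  end.

Fixpoint run (c : cmd) (t : nat) (s : cmd_state c) (tp tp' : tapes) : Prop :=
  if t is t'.+1 then
    let: (o, w) := cmd_delta s (reads_of tp) in
    let tp1 := act_on tp w in
    if o is Some s1 then run t' s1 tp1 tp' else t' = 0 /\ tp' = tp1
  else False.

Lemma run_inr c1 c2 t (s : cmd_state c2) tp tp1 :
  run t s tp tp1 -> run (c := Seq c1 c2) t (inr s) tp tp1.
Proof.
elim: t s tp => [//|t IH] s tp /=.
by case: (cmd_delta s _) => -[s1|] w /=; first exact: IH.
Qed.

Lemma run_inl c1 c2 t1 (s : cmd_state c1) tp tp1 t2 tp2 :
  run t1 s tp tp1 -> run t2 (cmd_start c2) tp1 tp2 ->
  run (c := Seq c1 c2) (t1 + t2) (inl s) tp tp2.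
Proof.
elim: t1 s tp => [//|t1 IH] s tp /=.
case: (cmd_delta s _) => -[s1|] w /=; first exact: IH.
by case=> -> -> run2; exact: run_inr.
Qed.

Lemma run_body b c t1 (s : cmd_state c) tp tp1 t2 tp2 :
  run t1 s tp tp1 -> run (c := While b c) t2 None tp1 tp2 ->
  run (c := While b c) (t1 + t2) (Some s) tp tp2.
Proof.
elim: t1 s tp => [//|t1 IH] s tp.
rewrite addSn [X in X -> _]/= [X in _ -> _ -> X]/=.
case: (cmd_delta s _) => -[s1|] w; first exact: IH.
by case=> -> ->.
Qed.

Lemma exec_run c tp t tp' : exec c tp t tp' -> run t (cmd_start c) tp tp'.
Proof.
elim=> {c tp t tp'} //=.
- by move=> c1 c2 tp t1 tp1 t2 tp2 _ run1 _ run2; exact: run_inl run1 run2.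
- by move=> b c tp /negbTE ->; rewrite act_on_stay.
- move=> b c tp t1 tp1 t2 tp2 -> _ run1 _ run2; rewrite act_on_stay.
  exact: run_body run1 run2.
Qed.

Definition cmd_TM (c : cmd) : TM :=
  @MkTM (option (cmd_state c)) K.+1 (Some (cmd_start c)) (fun s => ~~ isSome s)
    (fun s r => if s is Some s1 then cmd_delta s1 r else (None, stay r)).

Lemma cmd_TM_exec c inp t tp' : exec c (init_tapes inp) t tp' ->
  forall t', t <= t' ->
  iter t' (@tm_step (cmd_TM c)) (tm_init (cmd_TM c) inp) = (None, tp').
Proof.
move/exec_run; rewrite -[tm_init _ _]/((Some (cmd_start c), init_tapes inp) : tm_config (cmd_TM c)).
have halted n tp : iter n (@tm_step (cmd_TM c)) (None, tp) = (None, tp).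
  by elim: n => //= n ->.
move: (cmd_start c) (init_tapes inp) => s tp.
elim: t s tp => [//|t IH] s tp /= run_s [//|t' le_tt'].
rewrite iterSr [tm_step _](_ : _ =
    ((cmd_delta s (reads_of tp)).1, act_on tp (cmd_delta s (reads_of tp)).2)) //.
case: (cmd_delta s _) run_s => -[s1|] w /= run_s; first exact: IH.
by case: run_s => _ ->; exact: halted.
Qed.

End StructuredPrograms.
Arguments act_on : simpl never.

(** * Counters held by tape heads *)

Definition is_sep (s : symbol) : bool := if s is Sep then true else false.
Definition is_blank (s : symbol) : bool := if s is Blank then true else false.

Definition upd (f : nat -> nat) (i v : nat) : nat -> nat :=
  fun j => if j == i then v else f j.

Lemma upd_id f i v : upd f i v i = v.
Proof. by rewrite /upd eqxx. Qed.

Lemma upd_comp f i v (g : nat -> nat) : (forall x, g x <> i) -> upd f i v \o g = f \o g.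
Proof. by move=> g_i; apply/funext => x; rewrite /upd /=; case: eqP => // /g_i. Qed.

Ltac decide_upd := rewrite /upd /=; repeat (case: eqP => ?; subst => //); try lia; try congruence.

Record cstate : Type := CState { cnt : nat -> nat; ipos : nat; cout : seq bool }.

Ltac state_eq := congr CState; try (apply/funext => ?); decide_upd.

Section Counters.
Variables (K : nat) (inp : seq symbol).
Local Notation T := 'I_K.+2.
Local Notation reads := {ffun T -> symbol}.
Local Notation acts := {ffun T -> symbol * move}.
Local Notation tapes := (T -> tape).

(* Tape 0 is the output and tape 1 a copy of the input. Counter i is tape i + 2:
   its value is the head position, and a Sep in cell 0 allows the zero test. *)
Definition counter_idx (i : nat) : T := inord i.+2.
Definition input_idx : T := inord 1.

Lemma input_idx_neq0 : input_idx != ord0.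
Proof. by rewrite -val_eqE /= inordK. Qed.

Lemma counter_idx_neq0 i : i < K -> counter_idx i != ord0.
Proof. by move=> iK; rewrite -val_eqE /= inordK ?ltnS. Qed.

Lemma counter_idx_neq_input i : i < K -> counter_idx i != input_idx.
Proof. by move=> iK; rewrite -val_eqE /= !inordK ?ltnS. Qed.

Lemma counter_idx_eq i j : i < K -> j < K -> (counter_idx i == counter_idx j) = (i == j).
Proof. by move=> iK jK; rewrite -val_eqE /= !inordK ?ltnS. Qed.

Definition only (j : T) (v : symbol * move) (r : reads) : acts :=
  [ffun i => if i == j then v else (r i, MoveS)].

Lemma act_on_only tp j v i :
  act_on tp (only j v (reads_of tp)) i =
  if i == j then tape_act (tp i) v else tp i.
Proof.
rewrite /act_on !ffunE; case: (i == j) => //.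
by rewrite tape_act_read /= addr0; case: (tp i).
Qed.

Definition Inc i : cmd K :=
  Atom (fun r => only (counter_idx i) (r (counter_idx i), MoveR) r).
Definition Dec i : cmd K := Atom (fun r => only (counter_idx i)
  (r (counter_idx i), if is_sep (r (counter_idx i)) then MoveS else MoveL) r).
Definition IncIf (p : symbol -> bool) i : cmd K := Atom (fun r => only (counter_idx i)
  (r (counter_idx i), if p (r input_idx) then MoveR else MoveS) r).
Definition InR : cmd K := Atom (fun r => only input_idx (r input_idx, MoveR) r).
Definition InL : cmd K := Atom (fun r => only input_idx (r input_idx, MoveL) r).
Definition OutBit i : cmd K := Atom (fun r =>
  only ord0 (Bit (~~ is_sep (r (counter_idx i))), MoveR) r).
Definition EndOutput : cmd K := Atom (fun r => only ord0 (Blank, MoveS) r).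
Definition nonzero i (r : reads) : bool := ~~ is_sep (r (counter_idx i)).

Definition counter_tape (v : nat) : tape :=
  MkTape (fun z => if z == 0%R then Sep else Blank) (Posz v).

Definition represents (s : cstate) (tp : tapes) : Prop :=
  [/\ tp input_idx = MkTape (tape_cells (tape_of inp)) (Posz (ipos s)),
      (forall i, i < K -> tp (counter_idx i) = counter_tape (cnt s i)),
      tape_head (tp ord0) = Posz (size (cout s)) &
      forall j, j < size (cout s) ->
        tape_cells (tp ord0) (Posz j) = Bit (nth false (cout s) j)].

Definition runs (c : cmd K) (s : cstate) (t : nat) (s' : cstate) : Prop :=
  forall tp, represents s tp ->
  exists t' tp', [/\ t' <= t, exec c tp t' tp' & represents s' tp'].

Lemma represents_counter s tp i : represents s tp -> i < K ->
  is_sep (reads_of tp (counter_idx i)) = (cnt s i == 0).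
Proof.
by move=> [_ counters _ _] iK; rewrite ffunE counters //= /tape_read /=; case: (cnt s i).
Qed.

Lemma represents_input s tp : represents s tp ->
  reads_of tp input_idx = nth Blank inp (ipos s).
Proof. by move=> [input _ _ _]; rewrite ffunE input. Qed.

Lemma represents_move_counter s tp i mv v : represents s tp -> i < K ->
  (Posz (cnt s i) + move_offset mv)%R = Posz v ->
  represents (CState (upd (cnt s) i v) (ipos s) (cout s))
    (act_on tp (only (counter_idx i) (reads_of tp (counter_idx i), mv) (reads_of tp))).
Proof.
move=> [input counters out_head out_cells] iK v_eq; split.
- by rewrite act_on_only eq_sym (negbTE (counter_idx_neq_input iK)).
- move=> j jK; rewrite act_on_only counter_idx_eq // [cnt (CState _ _ _)]/= /upd.
  case: eqP => [->|_]; last exact: counters.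
  by rewrite ffunE tape_act_read counters //= v_eq.
- by rewrite act_on_only eq_sym (negbTE (counter_idx_neq0 iK)).
- by move=> j; rewrite act_on_only eq_sym (negbTE (counter_idx_neq0 iK)); exact: out_cells.
Qed.

Lemma represents_move_input s tp mv v : represents s tp ->
  (Posz (ipos s) + move_offset mv)%R = Posz v ->
  represents (CState (cnt s) v (cout s))
    (act_on tp (only input_idx (reads_of tp input_idx, mv) (reads_of tp))).
Proof.
move=> [input counters out_head out_cells] v_eq; split.
- by rewrite act_on_only eqxx ffunE tape_act_read input /= v_eq.
- by move=> j jK; rewrite act_on_only (negbTE (counter_idx_neq_input jK)); exact: counters.
- by rewrite act_on_only eq_sym (negbTE input_idx_neq0).
- by move=> j; rewrite act_on_only eq_sym (negbTE input_idx_neq0); exact: out_cells.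
Qed.

Lemma runs_atom f s s' :
  (forall tp, represents s tp -> represents s' (act_on tp (f (reads_of tp)))) ->
  runs (Atom f) s 1 s'.
Proof.
move=> act_rep tp tp_s; exists 1, (act_on tp (f (reads_of tp))).
by split=> //; [exact: ExecAtom | exact: act_rep].
Qed.

Lemma runs_Inc i c p o : i < K ->
  runs (Inc i) (CState c p o) 1 (CState (upd c i (c i).+1) p o).
Proof.
move=> iK; apply: runs_atom => tp tp_s.
by apply: (represents_move_counter tp_s iK) => /=; rewrite -PoszD addn1.
Qed.

Lemma runs_Dec i c p o : i < K ->
  runs (Dec i) (CState c p o) 1 (CState (upd c i (c i).-1) p o).
Proof.
move=> iK; apply: runs_atom => tp tp_s.
apply: (represents_move_counter tp_s iK); rewrite (represents_counter tp_s iK) /=.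
by case: (c i) => [|v] //=; rewrite -addn1 PoszD addrK.
Qed.

Lemma runs_IncIf q i c p o : i < K ->
  runs (IncIf q i) (CState c p o) 1
    (CState (upd c i (c i + q (nth Blank inp p))) p o).
Proof.
move=> iK; apply: runs_atom => tp tp_s.
apply: (represents_move_counter tp_s iK); rewrite (represents_input tp_s) /= PoszD.
by case: (q _).
Qed.

Lemma runs_InR c p o : runs InR (CState c p o) 1 (CState c p.+1 o).
Proof.
apply: runs_atom => tp tp_s; apply: (represents_move_input tp_s) => /=.
by rewrite -PoszD addn1.
Qed.

Lemma runs_InL c p o : runs InL (CState c p.+1 o) 1 (CState c p o).
Proof.
apply: runs_atom => tp tp_s; apply: (represents_move_input tp_s) => /=.
by rewrite -addn1 PoszD addrK.
Qed.

Lemma runs_OutBit i c p o : i < K ->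
  runs (OutBit i) (CState c p o) 1 (CState c p (rcons o (c i != 0))).
Proof.
move=> iK; apply: runs_atom => tp tp_s; rewrite (represents_counter tp_s iK) /=.
case: tp_s => input counters out_head out_cells; split.
- by rewrite act_on_only (negbTE input_idx_neq0).
- by move=> j jK; rewrite act_on_only (negbTE (counter_idx_neq0 jK)); exact: counters.
- by rewrite act_on_only eqxx /= out_head size_rcons -PoszD addn1.
- move=> j; rewrite act_on_only eqxx /= size_rcons ltnS nth_rcons out_head eqz_nat.
  by case: ltngtP => //= jo _; exact: out_cells.
Qed.

Lemma runs_Seq c1 c2 s t1 s1 t2 s2 :
  runs c1 s t1 s1 -> runs c2 s1 t2 s2 -> runs (Seq c1 c2) s (t1 + t2) s2.
Proof.
move=> runs1 runs2 tp /runs1 [u1 [tp1 [u1_le exec1 /runs2 [u2 [tp2 [u2_le exec2 rep2]]]]]].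
exists (u1 + u2), tp2; split=> //; first exact: leq_add.
exact: ExecSeq exec1 exec2.
Qed.

Lemma runs_weaken c s t s1 t' s2 : runs c s t s1 -> s1 = s2 -> t <= t' -> runs c s t' s2.
Proof.
move=> runs1 <- le_t tp /runs1 [u [tp' [le_u e rep]]]; exists u, tp'; split=> //.
exact: leq_trans le_u le_t.
Qed.

Lemma runs_countdown i body (S : nat -> cstate) n t s s' : i < K ->
  (forall j, j <= n -> cnt (S j) i = n - j) ->
  (forall j, j < n -> runs body (S j) t (S j.+1)) -> S 0 = s -> S n = s' ->
  runs (While (nonzero i) body) s (n * t.+1).+1 s'.
Proof.
move=> iK + + <- <-; elim: n S => [|n IH] S cnt_S runs_body tp tp_S.
  exists 1, tp; split=> //; apply: ExecDone.
  by rewrite /nonzero (represents_counter tp_S iK) cnt_S.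
have [u [tp1 [le_u exec1 /(IH (S \o succn))]]] := runs_body 0 isT _ tp_S.
case=> [j jn|j jn|v [tp2 [le_v exec2 rep2]]]; [exact: cnt_S|exact: runs_body|].
exists (u + v).+1, tp2; split=> //; last first.
  by apply: (ExecStep _ exec1 exec2); rewrite /nonzero (represents_counter tp_S iK) cnt_S.
by rewrite mulSn; move: (n * _) le_v => w; lia.
Qed.

Definition Move i j : cmd K := While (nonzero i) (Seq (Dec i) (Inc j)).
Definition MoveBoth i j k : cmd K :=
  While (nonzero i) (Seq (Dec i) (Seq (Inc j) (Inc k))).
Definition Cancel i j : cmd K := While (nonzero i) (Seq (Dec i) (Dec j)).
Definition Clear i : cmd K := While (nonzero i) (Dec i).
Definition SeekR i j : cmd K := While (nonzero i) (Seq (Dec i) (Seq (Inc j) InR)).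
Definition SeekL i : cmd K := While (nonzero i) (Seq (Dec i) InL).

Lemma runs_Move i j c p o : i < K -> j < K -> i <> j ->
  runs (Move i j) (CState c p o) (c i * 3).+1
    (CState (upd (upd c i 0) j (c j + c i)) p o).
Proof.
move=> iK jK ij; apply: (@runs_countdown _ _
  (fun m => CState (upd (upd c i (c i - m)) j (c j + m)) p o)) => //; try by state_eq.
  by move=> m mi; decide_upd.
move=> m mi; apply: runs_weaken (runs_Seq (runs_Dec iK) (runs_Inc jK)) _ (leqnn _).
by state_eq.
Qed.

Lemma runs_MoveBoth i j k c p o : i < K -> j < K -> k < K -> i <> j -> i <> k -> j <> k ->
  runs (MoveBoth i j k) (CState c p o) (c i * 4).+1
    (CState (upd (upd (upd c i 0) j (c j + c i)) k (c k + c i)) p o).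
Proof.
move=> iK jK kK ij ik jk; apply: (@runs_countdown _ _ (fun m =>
  CState (upd (upd (upd c i (c i - m)) j (c j + m)) k (c k + m)) p o)) => //; try by state_eq.
  by move=> m mi; decide_upd.
move=> m mi.
apply: runs_weaken (runs_Seq (runs_Dec iK) (runs_Seq (runs_Inc jK) (runs_Inc kK))) _ (leqnn _).
by state_eq.
Qed.

Lemma runs_Cancel i j c p o : i < K -> j < K -> i <> j ->
  runs (Cancel i j) (CState c p o) (c i * 3).+1
    (CState (upd (upd c i 0) j (c j - c i)) p o).
Proof.
move=> iK jK ij; apply: (@runs_countdown _ _
  (fun m => CState (upd (upd c i (c i - m)) j (c j - m)) p o)) => //; try by state_eq.
  by move=> m mi; decide_upd.
move=> m mi; apply: runs_weaken (runs_Seq (runs_Dec iK) (runs_Dec jK)) _ (leqnn _).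
by state_eq.
Qed.

Lemma runs_Clear i c p o : i < K ->
  runs (Clear i) (CState c p o) (c i * 2).+1 (CState (upd c i 0) p o).
Proof.
move=> iK; apply: (@runs_countdown _ _ (fun m => CState (upd c i (c i - m)) p o)) => //;
  try by state_eq.
  by move=> m mi; decide_upd.
by move=> m mi; apply: runs_weaken (runs_Dec iK) _ (leqnn _); state_eq.
Qed.

Lemma runs_SeekR i j c p o : i < K -> j < K -> i <> j ->
  runs (SeekR i j) (CState c p o) (c i * 4).+1
    (CState (upd (upd c i 0) j (c j + c i)) (p + c i) o).
Proof.
move=> iK jK ij; apply: (@runs_countdown _ _
  (fun m => CState (upd (upd c i (c i - m)) j (c j + m)) (p + m) o)) => //.
- by move=> m mi; decide_upd.
- move=> m mi.
  apply: runs_weaken _ (leqnn _);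
    first exact: runs_Seq (runs_Dec iK) (runs_Seq (runs_Inc jK) (@runs_InR _ _ _)).
  by state_eq.
- by rewrite addn0; state_eq.
- by state_eq.
Qed.

Lemma runs_SeekL i c p o : i < K ->
  runs (SeekL i) (CState c (p + c i) o) (c i * 3).+1 (CState (upd c i 0) p o).
Proof.
move=> iK; apply: (@runs_countdown _ _
  (fun m => CState (upd c i (c i - m)) (p + (c i - m)) o)) => //.
- by move=> m mi; decide_upd.
- move=> m mi; rewrite (_ : p + (c i - m) = (p + (c i - m.+1)).+1); last by lia.
  apply: runs_weaken (runs_Seq (runs_Dec iK) (@runs_InL _ _ _)) _ (leqnn _).
  by state_eq.
- by rewrite subn0; state_eq.
- by rewrite subnn addn0; state_eq.
Qed.

End Counters.

(** * Compiling arithmetic expressions with bounded sums *)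

Inductive expr : Type :=
| EVar of nat
| EOne
| EAdd of expr & expr
| ESub of expr & expr
| EInp of (symbol -> bool) & expr
| ESum of expr & expr.

Definition scons (i : nat) (env : nat -> nat) : nat -> nat :=
  fun v => if v is v'.+1 then env v' else i.

Lemma comp_scons (f : nat -> nat) i env : f \o scons i env = scons (f i) (f \o env).
Proof. by apply/funext => -[]. Qed.

Fixpoint eeval (inp : seq symbol) (e : expr) (env : nat -> nat) : nat :=
  match e with
  | EVar v => env v
  | EOne => 1
  | EAdd e1 e2 => eeval inp e1 env + eeval inp e2 env
  | ESub e1 e2 => eeval inp e1 env - eeval inp e2 env
  | EInp p e1 => p (nth Blank inp (eeval inp e1 env))
  | ESum e1 e2 => \sum_(i < eeval inp e1 env) eeval inp e2 (scons i env)
  end.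

Fixpoint width (e : expr) : nat :=
  match e with
  | EVar _ => 1
  | EOne => 0
  | EAdd e1 e2 => maxn (width e1) (width e2)
  | ESub e1 e2 => (maxn (width e1) (width e2)).+2
  | EInp _ e1 => (width e1).+2
  | ESum e1 e2 => (maxn (width e1) (width e2)).+2
  end.

(* M bounds the values of the variables. *)
Fixpoint value_bound (e : expr) (M : nat) : nat :=
  match e with
  | EVar _ => M
  | EOne => 1
  | EAdd e1 e2 => value_bound e1 M + value_bound e2 M
  | ESub e1 _ => value_bound e1 M
  | EInp _ _ => 1
  | ESum e1 e2 => value_bound e1 M * value_bound e2 (M + value_bound e1 M)
  end.

Fixpoint run_time (e : expr) (M : nat) : nat :=
  match e with
  | EVar _ => (M * 3).+1 + (M * 4).+1
  | EOne => 1
  | EAdd e1 e2 => run_time e1 M + run_time e2 M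
  | ESub e1 e2 => run_time e1 M +
      (run_time e2 M + ((value_bound e2 M * 3).+1 + (value_bound e1 M * 3).+1))
  | EInp _ e1 => run_time e1 M +
      ((value_bound e1 M * 4).+1 + (1 + (value_bound e1 M * 3).+1))
  | ESum e1 e2 => run_time e1 M +
      ((value_bound e1 M * (1 + (run_time e2 (M + value_bound e1 M) + 1)).+1).+1 +
       (value_bound e1 M * 2).+1)
  end.

Lemma eeval_le inp e M env : (forall v, env v <= M) -> eeval inp e env <= value_bound e M.
Proof.
elim: e M env => [v||e1 IH1 e2 IH2|e1 IH1 e2 IH2|p e1 _|e1 IH1 e2 IH2] M env env_le //=.
- by apply: leq_add; [exact: IH1|exact: IH2].
- exact: leq_trans (leq_subr _ _) (IH1 _ _ env_le).
- by case: (p _).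
- apply: leq_trans (leq_mul (IH1 _ _ env_le) (leqnn _)).
  rewrite -[eeval inp e1 env in X in _ <= X]card_ord -sum_nat_const; apply: leq_sum => i _.
  apply: IH2 => -[|v] /=; last exact: leq_trans (env_le v) (leq_addr _ _).
  by apply: leq_trans (leq_addl _ _); apply: leq_trans (ltnW (ltn_ord i)) (IH1 _ _ env_le).
Qed.

Lemma value_bound_poly e : poly_bounded (value_bound e).
Proof.
elim: e => [v||e1 IH1 e2 IH2|e1 IH1 e2 _|p e1 _|e1 IH1 e2 IH2] //=.
- exact: poly_bounded_id.
- exact: poly_bounded_const.
- exact: poly_bounded_add.
- exact: poly_bounded_const.
- apply: (poly_bounded_mul IH1 (poly_bounded_comp IH2 _)).
  exact: poly_bounded_add poly_bounded_id IH1.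
Qed.

Lemma run_time_poly e : poly_bounded (run_time e).
Proof.
have linear f k : poly_bounded f -> poly_bounded (fun M => (f M * k).+1).
  by move=> f_poly; apply/poly_bounded_succ/poly_bounded_mul => //; exact: poly_bounded_const.
elim: e => [v||e1 IH1 e2 IH2|e1 IH1 e2 IH2|p e1 IH1|e1 IH1 e2 IH2] //=.
- by apply: poly_bounded_add; exact: linear poly_bounded_id.
- exact: poly_bounded_const.
- exact: poly_bounded_add.
- apply: poly_bounded_add IH1 (poly_bounded_add IH2 (poly_bounded_add _ _));
    exact/linear/value_bound_poly.
- apply: poly_bounded_add IH1 (poly_bounded_add _ (poly_bounded_succ _));
    exact/linear/value_bound_poly.
- have value1_poly := value_bound_poly e1.
  apply: (poly_bounded_add IH1 (poly_bounded_add _ (linear _ _ value1_poly))).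
  apply/poly_bounded_succ/(poly_bounded_mul value1_poly).
  apply/poly_bounded_succ/poly_bounded_succ/poly_bounded_add; last exact: poly_bounded_const.
  exact: poly_bounded_comp IH2 (poly_bounded_add poly_bounded_id value1_poly).
Qed.

Section Compile.
Variables (K : nat) (inp : seq symbol).
Local Notation Inc := (@Inc K).
Local Notation Dec := (@Dec K).

(* The program adds the value of e to counter dest. Variable v lives in counter vt v;
   the counters from k on are scratch, zero before and after. *)
Fixpoint compile (e : expr) (vt : nat -> nat) (k dest : nat) : cmd K :=
  match e with
  | EVar v => Seq (Move K (vt v) k) (MoveBoth K k (vt v) dest)
  | EOne => Inc dest
  | EAdd e1 e2 => Seq (compile e1 vt k dest) (compile e2 vt k dest)
  | ESub e1 e2 => Seq (compile e1 vt k.+2 k) (Seq (compile e2 vt k.+2 k.+1)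
      (Seq (Cancel K k.+1 k) (Move K k dest)))
  | EInp p e1 => Seq (compile e1 vt k.+2 k)
      (Seq (SeekR K k k.+1) (Seq (IncIf K p dest) (SeekL K k.+1)))
  | ESum e1 e2 => Seq (compile e1 vt k.+2 k)
      (Seq (While (nonzero k) (Seq (Dec k)
              (Seq (compile e2 (scons k.+1 vt) k.+2 dest) (Inc k.+1))))
           (Clear K k.+1))
  end.

Definition layout e (vt : nat -> nat) k dest (c : nat -> nat) M : Prop :=
  [/\ forall v, vt v < k /\ vt v <> dest, dest < k, k + width e <= K,
      forall j, k <= j -> c j = 0 & forall v, c (vt v) <= M].

Definition compile_correct e : Prop := forall vt k dest c o M, layout e vt k dest c M ->
  runs inp (compile e vt k dest) (CState c 0 o) (run_time e M)
    (CState (upd c dest (c dest + eeval inp e (c \o vt))) 0 o).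

Lemma layout_upd e vt k dest c M i v :
  layout e vt k dest c M -> i < k -> (forall u, vt u <> i) ->
  layout e vt k dest (upd c i v) M.
Proof.
move=> [vt_lt dest_lt width_le scratch0 c_le] ik vt_i; split=> // [j kj|u].
  by have := scratch0 j kj; decide_upd.
rewrite -[upd _ _ _ _]/((upd c i v \o vt) u) upd_comp //; exact: c_le.
Qed.

Lemma layout_scratch e e' vt k dest dest' c M : layout e vt k dest c M ->
  (width e').+2 <= width e -> k <= dest' < k.+2 -> layout e' vt k.+2 dest' c M.
Proof.
move=> [vt_lt dest_lt width_le scratch0 c_le] le_width dest'_k; split=> //; try lia.
  by move=> v; have [] := vt_lt v; lia.
by move=> j kj; apply: scratch0; lia.
Qed.

Lemma runs_compile_scratch e e' vt k dest dest' c o M :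
  compile_correct e' -> layout e vt k dest c M -> (width e').+2 <= width e ->
  k <= dest' < k.+2 ->
  runs inp (compile e' vt k.+2 dest') (CState c 0 o) (run_time e' M)
    (CState (upd c dest' (eeval inp e' (c \o vt))) 0 o).
Proof.
move=> run_e' lay le_width dest'_k; have [_ _ _ scratch0 _] := lay.
apply: runs_weaken (run_e' _ _ _ _ _ _ (layout_scratch lay le_width dest'_k)) _ (leqnn _).
by rewrite scratch0 //; lia.
Qed.

Lemma compile_correct_var v : compile_correct (EVar v).
Proof.
move=> vt k dest c o M [vt_lt dest_lt /= width_le scratch0 /(_ v) c_le].
have [v_lt v_dest] := vt_lt v; have ck : c k = 0 by exact: scratch0.
apply: runs_weaken (runs_Seq (@runs_Move _ _ (vt v) k _ _ _ _ _ _)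
  (@runs_MoveBoth _ _ k (vt v) dest _ _ _ _ _ _ _ _ _)) _ _; try lia.
- by state_eq.
- by decide_upd.
Qed.

Lemma compile_correct_one : compile_correct EOne.
Proof.
move=> vt k dest c o M [_ dest_lt width_le _ _].
by apply: runs_weaken (runs_Inc _) _ _ => //; [lia|state_eq].
Qed.

Lemma compile_correct_add e1 e2 :
  compile_correct e1 -> compile_correct e2 -> compile_correct (EAdd e1 e2).
Proof.
move=> run1 run2 vt k dest c o M [vt_lt dest_lt /= width_le scratch0 c_le].
have vt_dest v : vt v <> dest by have [] := vt_lt v.
apply: runs_weaken (runs_Seq (run1 vt k dest c o M _) (run2 vt k dest _ o M _)) _ (leqnn _).
- by split=> //; lia.
- by apply: layout_upd => //; split=> //; lia.
- by rewrite upd_comp //; state_eq.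
Qed.

Lemma compile_correct_sub e1 e2 :
  compile_correct e1 -> compile_correct e2 -> compile_correct (ESub e1 e2).
Proof.
move=> run1 run2 vt k dest c o M lay; have [vt_lt dest_lt /= width_le scratch0 c_le] := lay.
have [ck ckS] : c k = 0 /\ c k.+1 = 0 by rewrite !scratch0.
have vt_k v : vt v <> k by have [] := vt_lt v; lia.
have value1_le : eeval inp e1 (c \o vt) <= _ := eeval_le inp e1 c_le.
have value2_le : eeval inp e2 (c \o vt) <= _ := eeval_le inp e2 c_le.
have eval1 := runs_compile_scratch (dest' := k) (o := o) run1 lay.
have lay_e2 : layout e2 vt k.+2 k.+1 (upd c k (eeval inp e1 (c \o vt))) M.
  by apply: layout_upd => //; apply: layout_scratch lay _ _ => /=; lia.
apply: runs_weaken (runs_Seq (eval1 _ _) (runs_Seq (run2 _ _ _ _ _ _ lay_e2)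
    (runs_Seq (@runs_Cancel _ _ k.+1 k _ _ _ _ _ _) (@runs_Move _ _ k dest _ _ _ _ _ _)))) _ _;
  rewrite /=; try lia.
- by rewrite upd_comp //; state_eq.
- by rewrite upd_comp //; decide_upd.
Qed.

Lemma compile_correct_inp p e1 : compile_correct e1 -> compile_correct (EInp p e1).
Proof.
move=> run1 vt k dest c o M lay; have [vt_lt dest_lt /= width_le scratch0 c_le] := lay.
have [ck ckS] : c k = 0 /\ c k.+1 = 0 by rewrite !scratch0.
have value1_le : eeval inp e1 (c \o vt) <= _ := eeval_le inp e1 c_le.
set x := eeval inp e1 (c \o vt) in value1_le *.
have [k_lt kS_lt k_kS] : [/\ k < K, k.+1 < K & k <> k.+1] by split; lia.
have seek : runs inp (SeekR K k k.+1) (CState (upd c k x) 0 o) (x * 4).+1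
    (CState (upd c k.+1 x) x o).
  by apply: runs_weaken (runs_SeekR k_lt kS_lt k_kS) _ _; [state_eq|rewrite upd_id].
pose bit_read := upd (upd c k.+1 x) dest (c dest + p (nth Blank inp x)).
have read : runs inp (IncIf K p dest) (CState (upd c k.+1 x) x o) 1 (CState bit_read x o).
  by apply: runs_weaken (runs_IncIf p _) _ _; [lia|rewrite /bit_read; state_eq|].
have rewind : runs inp (SeekL K k.+1) (CState bit_read x o) (x * 3).+1
    (CState (upd c dest (c dest + p (nth Blank inp x))) 0 o).
  have bit_read_kS : bit_read k.+1 = x by rewrite /bit_read; decide_upd.
  rewrite -[x in CState _ x _](add0n x) -[x in 0 + x]bit_read_kS.
  apply: runs_weaken (runs_SeekL kS_lt) _ _; last by rewrite bit_read_kS.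
  by rewrite /bit_read; state_eq.
have eval1 := runs_compile_scratch (dest' := k) (o := o) run1 lay.
by apply: runs_weaken (runs_Seq (eval1 _ _) (runs_Seq seek (runs_Seq read rewind))) _ _ => //=;
  lia.
Qed.

Lemma compile_correct_sum e1 e2 :
  compile_correct e1 -> compile_correct e2 -> compile_correct (ESum e1 e2).
Proof.
move=> run1 run2 vt k dest c o M lay; have [vt_lt dest_lt /= width_le scratch0 c_le] := lay.
have [ck ckS] : c k = 0 /\ c k.+1 = 0 by rewrite !scratch0.
have value1_le : eeval inp e1 (c \o vt) <= _ := eeval_le inp e1 c_le.
set x := eeval inp e1 (c \o vt) in value1_le *; set M_body := M + value_bound e1 M.
pose acc j := c dest + \sum_(i < j) eeval inp e2 (scons i (c \o vt)).
pose S j := upd (upd (upd c k (x - j)) k.+1 j) dest (acc j).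
pose body := Seq (Dec k) (Seq (compile e2 (scons k.+1 vt) k.+2 dest) (Inc k.+1)).
have runs_body j : j < x ->
    runs inp body (CState (S j) 0 o) (1 + (run_time e2 M_body + 1)) (CState (S j.+1) 0 o).
  move=> jx; pose S' := upd (S j) k (S j k).-1.
  have vars_eq : S' \o scons k.+1 vt = scons j (c \o vt).
    rewrite comp_scons; congr scons; first by rewrite /S' /S; decide_upd.
    by apply/funext => v; have := vt_lt v; rewrite /S' /S /=; decide_upd.
  apply: runs_weaken (runs_Seq (runs_Dec _)
    (runs_Seq (run2 (scons k.+1 vt) k.+2 dest S' o M_body _) (runs_Inc _))) _ _ => //; try lia.
    split; try lia.
    - by case=> [|v] /=; [lia|have := vt_lt v; lia].
    - by move=> i ki; have := scratch0 i; rewrite /S' /S; decide_upd.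
    - move=> v; rewrite -[S' _]/((S' \o scons k.+1 vt) v) vars_eq /M_body.
      by case: v => [|v] /=; [lia|have := c_le v; lia].
  rewrite vars_eq /S' /S /acc big_ord_recr /=; state_eq.
have loop : runs inp (While (nonzero k) body) (CState (S 0) 0 o)
    (x * (1 + (run_time e2 M_body + 1)).+1).+1 (CState (S x) 0 o).
  apply: (@runs_countdown _ _ _ _ (fun j => CState (S j) 0 o)) => //; first by lia.
  by move=> j jx; rewrite /= /S; decide_upd.
have eval1 := runs_compile_scratch (dest' := k) (o := o) run1 lay.
have S0 : S 0 = upd c k x.
  by apply/funext => i; rewrite /S /acc big_ord0; decide_upd.
rewrite S0 in loop.
apply: runs_weaken (runs_Seq (eval1 _ _) (runs_Seq loop (runs_Clear _))) _ _ => //=; try lia.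
- by rewrite /S /acc; state_eq.
- rewrite [S x k.+1](_ : _ = x) /S; last by decide_upd.
  rewrite leq_add2l leq_add ?ltnS ?leq_mul //; lia.
Qed.

Lemma compile_is_correct e : compile_correct e.
Proof.
elim: e => [v||e1 run1 e2 run2|e1 run1 e2 run2|p e1 run1|e1 run1 e2 run2].
- exact: compile_correct_var.
- exact: compile_correct_one.
- exact: compile_correct_add.
- exact: compile_correct_sub.
- exact: compile_correct_inp.
- exact: compile_correct_sum.
Qed.

End Compile.

Section Setup.
Variable K : nat.
Local Notation T := 'I_K.+2.
Local Notation reads := {ffun T -> symbol}.
Local Notation tapes := (T -> tape).
Local Notation input_idx := (input_idx K).
Local Notation counter_idx := (counter_idx K).

Definition Mark : cmd K := Atom (fun r => [ffun i =>
  if (i == ord0) || (i == input_idx) then (r i, MoveS) else (Sep, MoveS)]).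
Definition Copy : cmd K := Atom (fun r => [ffun i =>
  if i == ord0 then (r i, MoveR) else if i == input_idx then (r ord0, MoveR)
  else (r i, if i == counter_idx 0 then MoveR else MoveS)]).
Definition Shift (mv : move) : cmd K := Atom (fun r => [ffun i =>
  (r i, if (i == ord0) || (i == input_idx) then mv else MoveS)]).
Definition more (r : reads) : bool := ~~ is_blank (r ord0).

Definition Setup : cmd K :=
  Seq Mark (Seq (While more Copy)
    (Seq (Shift MoveL) (Seq (While more (Shift MoveL)) (Shift MoveR)))).

Section Run.
Variable inp : seq symbol.
Hypothesis inp_no_blank : all (fun s => ~~ is_blank s) inp.

(* After j symbols are copied, with the heads of tapes 0 and 1 in position h. *)
Definition copied (j : nat) (h : int) : tapes := fun i =>
  if i == ord0 then MkTape (tape_cells (tape_of inp)) h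
  else if i == input_idx then MkTape (fun z => if z is Posz a then
    (if a < j then nth Blank inp a else Blank) else Blank) h
  else if i == counter_idx 0 then counter_tape j else counter_tape 0.

Lemma is_blank_nth j : is_blank (nth Blank inp j) = (size inp <= j).
Proof.
case: leqP => [le|lt]; first by rewrite nth_default.
by apply/negbTE; exact: (all_nthP Blank inp_no_blank).
Qed.

Lemma more_copied j h : more (reads_of (copied j h)) =
  if h is Posz a then a < size inp else false.
Proof.
rewrite /more ffunE /copied eqxx /tape_read /=; case: h => // a.
by rewrite is_blank_nth -ltnNge.
Qed.

Lemma exec_Mark : exec Mark (init_tapes inp) 1 (copied 0 0%R).
Proof.
apply: exec_atom; apply/funext => i; rewrite /act_on !ffunE /copied /init_tapes.
case: eqP => [_|_] /=; first by rewrite tape_act_read.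
case: eqP => [_|_] /=.
  rewrite tape_act_read /tape_of /=; congr MkTape.
  by apply/funext => -[a|a] //; rewrite nth_nil.
rewrite if_same /tape_act /counter_tape /=; congr MkTape.
by apply/funext => -[[|a]|a] //=; rewrite nth_nil.
Qed.

Lemma exec_Copy j : exec Copy (copied j (Posz j)) 1 (copied j.+1 (Posz j.+1)).
Proof.
apply: exec_atom; have PoszS : (Posz j + 1)%R = Posz j.+1 by rewrite -PoszD addn1.
apply/funext => i; rewrite /act_on !ffunE.
case: eqP => [->|/eqP i_out]; first by rewrite tape_act_read /copied eqxx /= PoszS.
case: eqP => [->|/eqP i_inp].
  rewrite /copied eqxx (negbTE (input_idx_neq0 K)) /tape_act /= /tape_read /= PoszS.
  congr MkTape; apply/funext => -[a|a] //=; rewrite eqz_nat ltnS leq_eqVlt.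
  by case: eqP => [->|].
rewrite tape_act_read /copied (negbTE i_out) (negbTE i_inp); case: eqP => _ //=.
by rewrite /counter_tape PoszS.
Qed.

Lemma exec_Shift mv j h : exec (Shift mv) (copied j h) 1 (copied j (h + move_offset mv)%R).
Proof.
apply: exec_atom; apply/funext => i; rewrite /act_on !ffunE tape_act_read /copied.
case: eqP => [//|_]; case: eqP => [//|_] /=.
by case: eqP => _; rewrite addr0.
Qed.

Lemma exec_copy_loop : exec (While more Copy) (copied 0 0%R) (size inp * 2).+1
  (copied (size inp) (Posz (size inp))).
Proof.
suff copy_from k j : j + k = size inp -> exec (While more Copy) (copied j (Posz j)) (k * 2).+1
    (copied (size inp) (Posz (size inp))) by exact: (copy_from (size inp) 0).
elim: k j => [|k IH] j size_eq.
  by rewrite -size_eq addn0; apply: ExecDone; rewrite more_copied -size_eq addn0 ltnn.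
apply: ExecStep (exec_Copy _) (IH j.+1 _); last by rewrite addSnnS.
by rewrite more_copied -size_eq addnS ltnS leq_addr.
Qed.

Lemma exec_rewind_loop : exec (While more (Shift MoveL))
  (copied (size inp) (Posz (size inp) - 1)%R) (size inp * 2).+1 (copied (size inp) (- 1)%R).
Proof.
suff rewind_from k : k <= size inp -> exec (While more (Shift MoveL))
    (copied (size inp) (Posz k - 1)%R) (k * 2).+1 (copied (size inp) (- 1)%R).
  exact: rewind_from.
elim: k => [|k IH] k_le; first by rewrite sub0r; apply: ExecDone; rewrite more_copied.
rewrite -addn1 PoszD addrK addn1.
apply: ExecStep (exec_Shift MoveL _ _) (IH (ltnW k_le)).
by rewrite more_copied.
Qed.

Lemma exec_Setup : exists tp, exec Setup (init_tapes inp) (size inp * 4 + 5) tp /\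
  represents inp (CState (upd (fun=> 0) 0 (size inp)) 0 [::]) tp.
Proof.
have shift_right := exec_Shift MoveR (size inp) (- 1)%R; rewrite addNr in shift_right.
exists (copied (size inp) 0%R); split.
  rewrite (_ : size inp * 4 + 5 = 1 + ((size inp * 2).+1 + (1 + ((size inp * 2).+1 + 1)))).
    exact: ExecSeq exec_Mark (ExecSeq exec_copy_loop
      (ExecSeq (exec_Shift MoveL _ _) (ExecSeq exec_rewind_loop shift_right))).
  by lia.
split=> //; rewrite /copied ?eqxx //.
- rewrite (negbTE (input_idx_neq0 K)); congr MkTape.
  by apply/funext => -[a|a] //=; case: ltnP => // le; rewrite nth_default.
- move=> i iK; rewrite (negbTE (counter_idx_neq0 iK)) (negbTE (counter_idx_neq_input iK)).
  by rewrite counter_idx_eq ?(leq_ltn_trans _ iK) // /upd /=; case: eqP.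
Qed.

End Run.
End Setup.

Section Evaluator.
Variables (e_len e_bit : expr).
Let K := 4 + maxn (width e_len) (width e_bit).
Local Notation Inc := (@Inc K).
Local Notation Dec := (@Dec K).

(* Counter 0 holds the input length, counter 1 the index j of the next output bit,
   counter 2 the number of bits left and counter 3 the value of the expression at j. *)
Definition emit_bit : cmd K :=
  Seq (Dec 2) (Seq (compile K e_bit (scons 1 (fun=> 0)) 4 3)
    (Seq (OutBit K 3) (Seq (Clear K 3) (Inc 1)))).

Definition emit_all : cmd K :=
  Seq (compile K e_len (fun=> 0) 4 2) (While (nonzero 2) emit_bit).

Definition evaluator : cmd K := Seq (Setup K) (Seq emit_all (EndOutput K)).

Definition eval_bit inp j := eeval inp e_bit (scons j (fun=> size inp)) != 0.

Definition eval_bits inp := mkseq (eval_bit inp) (eeval inp e_len (fun=> size inp)).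

Definition emit_bit_time M :=
  let N := M + value_bound e_len M in
  1 + (run_time e_bit N + (1 + ((value_bound e_bit N * 2).+1 + 1))).

Definition emit_all_time M :=
  run_time e_len M + (value_bound e_len M * (emit_bit_time M).+1).+1.

Definition emit_counters inp j := upd (upd (upd (fun=> 0) 0 (size inp)) 1 j) 2
  (eeval inp e_len (fun=> size inp) - j).

Lemma runs_emit_bit inp j : j < eeval inp e_len (fun=> size inp) ->
  runs inp emit_bit (CState (emit_counters inp j) 0 (mkseq (eval_bit inp) j))
    (emit_bit_time (size inp))
    (CState (emit_counters inp j.+1) 0 (mkseq (eval_bit inp) j.+1)).
Proof.
set M := size inp => j_lt; set c := upd (emit_counters inp j) 2 (emit_counters inp j 2).-1.
set N := M + value_bound e_len M.
have vars_eq : c \o scons 1 (fun=> 0) = scons j (fun=> M) by apply/funext => -[|v].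
have vars_le v : scons j (fun=> M) v <= N.
  have := @eeval_le inp e_len M (fun=> M) (fun=> leqnn _).
  by rewrite /N; case: v => [|v] /=; lia.
have lay : layout K e_bit (scons 1 (fun=> 0)) 4 3 c N.
  split=> // [[|v] //||[|[|[|[|i]]]] //|v]; first by rewrite /K; lia.
  by rewrite -[c _]/((c \o scons 1 (fun=> 0)) v) vars_eq.
have value_le := eeval_le inp e_bit vars_le.
apply: runs_weaken (runs_Seq (runs_Dec _) (runs_Seq (compile_is_correct lay)
  (runs_Seq (runs_OutBit _) (runs_Seq (runs_Clear _) (runs_Inc _))))) _ _ => //.
- rewrite vars_eq /c /emit_counters; congr CState; last first.
    by rewrite /mkseq -[in RHS]addn1 iotaD map_cat cats1.
  by apply/funext => i; decide_upd.
- by rewrite vars_eq /emit_bit_time -/N upd_id [c 3](_ : _ = 0) // add0n; lia.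
Qed.

Lemma runs_emit_all inp : runs inp emit_all
  (CState (upd (fun=> 0) 0 (size inp)) 0 [::]) (emit_all_time (size inp))
  (CState (emit_counters inp (eeval inp e_len (fun=> size inp))) 0 (eval_bits inp)).
Proof.
set M := size inp; set c := upd (fun=> 0) 0 M.
have lay : layout K e_len (fun=> 0) 4 2 c M.
  by split=> // [|[|[|[|[|i]]]] //]; rewrite /K; lia.
have len_le := @eeval_le inp e_len M (fun=> M) (fun=> leqnn _).
apply: runs_weaken (runs_Seq (compile_is_correct lay)
  (@runs_countdown _ _ 2 _ (fun j => CState (emit_counters inp j) 0 (mkseq (eval_bit inp) j))
     _ (emit_bit_time M) _ _ _ _ (@runs_emit_bit inp) _ (erefl _))) _ _ => //.
- by rewrite -[c \o _]/(fun=> M) /emit_counters -/M /c; state_eq.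
- by rewrite /emit_all_time leq_add2l ltnS leq_mul2r len_le orbT.
Qed.

Lemma emit_all_time_poly : poly_bounded emit_all_time.
Proof.
have len_poly := value_bound_poly e_len.
have N_poly := poly_bounded_add poly_bounded_id len_poly.
have bit_time_poly : poly_bounded emit_bit_time.
  apply/poly_bounded_succ/poly_bounded_add.
    exact: poly_bounded_comp (run_time_poly e_bit) N_poly.
  apply/poly_bounded_succ/poly_bounded_add; last exact: poly_bounded_const.
  apply/poly_bounded_succ/poly_bounded_mul; last exact: poly_bounded_const.
  exact: poly_bounded_comp (value_bound_poly e_bit) N_poly.
apply: poly_bounded_add (run_time_poly e_len) _; apply: poly_bounded_succ.
exact: poly_bounded_mul len_poly (poly_bounded_succ bit_time_poly).
Qed.

Lemma evaluator_computes inp t : all (fun s => ~~ is_blank s) inp ->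
  size inp * 4 + 5 + (emit_all_time (size inp) + 1) <= t ->
  tm_computes (cmd_TM evaluator) inp (eval_bits inp) t.
Proof.
move=> inp_no_blank t_ge.
have [tp [exec_setup rep_setup]] := exec_Setup K inp_no_blank.
have [t1 [tp1 [t1_le exec_emit rep1]]] := runs_emit_all rep_setup.
have exec_end := ExecAtom (fun r => only ord0 (Blank, MoveS) r) tp1.
have := cmd_TM_exec (ExecSeq exec_setup (ExecSeq exec_emit exec_end)).
rewrite /tm_computes => -> //; last by lia.
split=> // j j_le; rewrite [_.2]/= act_on_only eqxx /tape_act [tape_cells _]/=.
case: rep1 => _ _ /= -> out_cells; rewrite eqz_nat.
case: eqP => [->|j_neq]; first by rewrite nth_default // size_map.
have j_lt : j < size (eval_bits inp) by lia.
by rewrite out_cells // (nth_map false).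
Qed.

End Evaluator.

Theorem explicit_of_expr (d m : nat -> nat) (Ext : ext_family d m) (e_len e_bit : expr) :
  (forall n (x : n.-tuple bool) (r : (d n).-tuple bool),
    let inp := map Bit x ++ Sep :: map Bit r in
    eeval inp e_len (fun=> size inp) = m n /\
    forall j : 'I_(m n), (eeval inp e_bit (scons j (fun=> size inp)) != 0)
       = tnth (Ext n x r) j) ->
  explicit Ext.
Proof.
move=> eval_Ext; have [q time_le] : poly_bounded (fun M => M * 4 + 5 +
    (emit_all_time e_len e_bit M + 1)).
  apply: poly_bounded_add; last first.
    exact: poly_bounded_add (emit_all_time_poly _ _) (poly_bounded_const _).
  apply: poly_bounded_add (poly_bounded_const _).
  exact: poly_bounded_mul poly_bounded_id (poly_bounded_const _).
exists (cmd_TM (evaluator e_len e_bit)), ((2 * 3) ^ q), q => n x r.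
have [len_eq bit_eq] := eval_Ext n x r; set inp := map _ _ ++ _ in len_eq bit_eq *.
have -> : tval (Ext n x r) = eval_bits e_len e_bit inp.
  rewrite /eval_bits len_eq; apply: (@eq_from_nth _ false); rewrite size_tuple ?size_mkseq //.
  by move=> i im; rewrite nth_mkseq // /eval_bit (bit_eq (Ordinal im)) (tnth_nth false).
apply: evaluator_computes.
  by rewrite all_cat /= !all_map; apply/andP; split; apply/allP.
apply: leq_trans (time_le _) _; apply: leq_trans (leq_poly_bound _ _ _).
by apply: leq_expn2r; rewrite /inp size_cat /= !size_map !size_tuple; lia.
Qed.

(** * Functions definable by bounded sums *)

Lemma sum_ltn_nat q m : q <= m -> \sum_(0 <= i < m) (i < q) = q.
Proof.
move=> qm; rewrite -[RHS]muln1 -[q in RHS]subn0 -sum_nat_const_nat.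
rewrite [RHS](big_nat_widen _ _ m) // [RHS]big_mkcond /=.
by apply: eq_bigr => i _; case: (i < q).
Qed.

Lemma divn_sum m d : m %/ d = (0 < d) * \sum_(0 <= i < m) (i.+1 * d <= m).
Proof.
have [->|d_gt0] := posnP d; first by rewrite divn0.
rewrite mul1n -[LHS](sum_ltn_nat (leq_div m d)).
by apply: eq_bigr => i _; rewrite -leq_divRL.
Qed.

Lemma prime_all v : prime v = (1 < v) && all (fun k => ~~ ((1 < k) && (k %| v))) (iota 0 v).
Proof.
apply/idP/andP => [v_prime|[v_gt1 /allP no_divisor]].
  split; first exact: prime_gt1.
  apply/allP => k; rewrite mem_iota => /andP [_ kv].
  apply/negP => /andP [k_gt1 /(prime_nt_dvdP v_prime) k_eq].
  by have := k_eq (negbT (gtn_eqF k_gt1)); lia.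
apply/primeP; split=> // k kv; have := dvdn_leq (ltnW v_gt1) kv.
rewrite leq_eqVlt => /orP [->|k_lt]; first by rewrite orbT.
have := no_divisor k; rewrite mem_iota k_lt kv => /(_ isT).
by case: k kv {k_lt} => [|[]] //; rewrite dvd0n => /eqP v0; rewrite v0 in v_gt1.
Qed.

Definition is_pow2 (v : nat) : bool :=
  (0 < v) && all (fun k => ~~ (2 * k + 3 %| v)) (iota 0 v).

(* An odd divisor greater than 1 is of the form 2 * k + 3. *)
Lemma is_pow2P v : reflect (exists h, v = 2 ^ h) (is_pow2 v).
Proof.
apply: (iffP andP) => [[v_gt0 /allP no_odd]|[h ->]].
  have v_eq : v = 2 ^ logn 2 v * v`_(2^') by rewrite -p_part partnC.
  exists (logn 2 v); rewrite {1}v_eq (_ : v`_(2^') = 1) ?muln1 //; apply/eqP.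
  rewrite eqn_leq part_gt0 andbT leqNgt; apply/negP => odd_part_gt1.
  have odd_part : odd v`_(2^') by rewrite odd_2'nat part_pnat.
  have dvd := dvdn_part (2^') v; have le_v := dvdn_leq v_gt0 dvd.
  have := no_odd ((v`_(2^') - 3)./2); rewrite mem_iota.
  have -> : 2 * ((v`_(2^') - 3)./2) + 3 = v`_(2^').
    by move: odd_part odd_part_gt1; move: (v`_(2^')) => w; lia.
  rewrite dvd => /(_ _) /negP [] //; move: odd_part_gt1 le_v.
  by move: (v`_(2^')) => w; lia.
split; first by rewrite expn_gt0.
apply/allP => k _; apply/negP => /dvdn_pfactor [] // j _ k_eq.
have : odd (2 * k + 3) by lia.
by rewrite k_eq oddX orbF => /eqP j0; move: k_eq; rewrite j0; lia.
Qed.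

Lemma bitlen_sum v : bitlen v = \sum_(0 <= i < v) is_pow2 i.+1.
Proof.
elim: v => [|v IH]; first by rewrite big_geq // /bitlen up_log1.
rewrite big_nat_recr //= -IH; case: is_pow2P => [[h v_eq]|not_pow2].
  by rewrite v_eq bitlen_exp2 /bitlen v_eq up_expnK // addn1.
rewrite addn0; apply/eqP; rewrite eqn_leq (leq_up_log 2 (leqnSn v.+1)) andbT.
apply: up_log_min => //; rewrite ltn_neqAle bitlen_gt andbT.
by apply/eqP => v_eq; apply: not_pow2; exists (bitlen v).
Qed.

Lemma truncated_exp2_sum h B :
  \sum_(0 <= v < B) v * (is_pow2 v && (bitlen v == h.+1)) =
  if 2 ^ h < B then 2 ^ h else 0.
Proof.
have vanish v : v != 2 ^ h -> v * (is_pow2 v && (bitlen v == h.+1)) = 0.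
  case: is_pow2P => [[h' ->]|]; last by rewrite muln0.
  by rewrite bitlen_exp2 eqSS; case: (h' =P h) => [->|]; rewrite ?eqxx ?muln0.
have pow2 : is_pow2 (2 ^ h) by apply/is_pow2P; exists h.
case: ltnP => le_B.
  rewrite (bigD1_seq (2 ^ h)) ?iota_uniq ?mem_index_iota //= big1 => [|v vh]; last exact: vanish.
  by rewrite pow2 bitlen_exp2 eqxx muln1 addn0.
rewrite big1_seq // => v; rewrite mem_index_iota => /andP [_ /andP [_ vB]].
by apply: vanish; rewrite neq_ltn (leq_trans vB).
Qed.

Section Definability.
Implicit Types F G : seq symbol -> (nat -> nat) -> nat.

Definition definable F : Prop :=
  exists e, forall inp env, eeval inp e env = F inp env.

Lemma definable_ext F G : definable F -> (forall inp env, F inp env = G inp env) ->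
  definable G.
Proof. by move=> [e F_e] FG; exists e => inp env; rewrite F_e. Qed.

Lemma definable_var v : definable (fun _ env => env v).
Proof. by exists (EVar v). Qed.

Lemma definable_add F G : definable F -> definable G ->
  definable (fun inp env => F inp env + G inp env).
Proof. by move=> [e F_e] [e' G_e']; exists (EAdd e e') => inp env /=; rewrite F_e G_e'. Qed.

Lemma definable_sub F G : definable F -> definable G ->
  definable (fun inp env => F inp env - G inp env).
Proof. by move=> [e F_e] [e' G_e']; exists (ESub e e') => inp env /=; rewrite F_e G_e'. Qed.

Lemma definable_succ F : definable F -> definable (fun inp env => (F inp env).+1).
Proof. by move=> [e F_e]; exists (EAdd e EOne) => inp env /=; rewrite F_e addn1. Qed.

Lemma definable_const k : definable (fun _ _ => k).
Proof. by elim: k => [|k /definable_succ //]; exists (ESub EOne EOne). Qed.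

Lemma definable_inp (p : symbol -> bool) F : definable F ->
  definable (fun inp env => p (nth Blank inp (F inp env))).
Proof. by move=> [e F_e]; exists (EInp p e) => inp env /=; rewrite F_e. Qed.

Lemma definable_sum F (G : seq symbol -> (nat -> nat) -> nat -> nat) :
  definable F -> definable (fun inp env => G inp (env \o succn) (env 0)) ->
  definable (fun inp env => \sum_(0 <= i < F inp env) G inp env i).
Proof.
move=> [e F_e] [e' G_e']; exists (ESum e e') => inp env /=.
by rewrite F_e big_mkord; apply: eq_bigr => i _; rewrite G_e'.
Qed.

Definition lift_renaming (rho : nat -> nat) : nat -> nat :=
  fun v => if v is v'.+1 then (rho v').+1 else 0.

Fixpoint rename (rho : nat -> nat) (e : expr) : expr :=
  match e with
  | EVar v => EVar (rho v)
  | EOne => EOne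
  | EAdd e1 e2 => EAdd (rename rho e1) (rename rho e2)
  | ESub e1 e2 => ESub (rename rho e1) (rename rho e2)
  | EInp p e1 => EInp p (rename rho e1)
  | ESum e1 e2 => ESum (rename rho e1) (rename (lift_renaming rho) e2)
  end.

Lemma eeval_rename inp e rho env :
  eeval inp (rename rho e) env = eeval inp e (env \o rho).
Proof.
elim: e rho env => //= [e1 IH1 e2 IH2|e1 IH1 e2 IH2|p e1 IH1|e1 IH1 e2 IH2] rho env;
  rewrite ?IH1 ?IH2 //.
apply: eq_bigr => i _; rewrite IH2; congr eeval.
by apply/funext => -[|v].
Qed.

Lemma definable_weaken F : definable F ->
  definable (fun inp env => F inp (env \o succn)).
Proof. by move=> [e F_e]; exists (rename succn e) => inp env; rewrite eeval_rename F_e. Qed.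

Lemma definable_mul F G : definable F -> definable G ->
  definable (fun inp env => F inp env * G inp env).
Proof.
move=> F_def /definable_weaken G_def.
apply: definable_ext (definable_sum (G := fun inp env _ => G inp env) F_def G_def) _ => inp env.
by rewrite sum_nat_const_nat subn0.
Qed.

Lemma definable_exp F k : definable F -> definable (fun inp env => F inp env ^ k).
Proof.
move=> F_def; elim: k => [|k IH]; first exact: definable_const.
by apply: definable_ext (definable_mul F_def IH) _ => inp env; rewrite expnS.
Qed.

Lemma definable_leq F G : definable F -> definable G ->
  definable (fun inp env => F inp env <= G inp env).
Proof.
move=> F_def G_def.
apply: definable_ext (definable_sub (definable_const 1) (definable_sub F_def G_def)) _.
by move=> inp env; case: leqP; lia.
Qed.

Lemma definable_andb (P Q : seq symbol -> (nat -> nat) -> bool) :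
  definable P -> definable Q -> definable (fun inp env => P inp env && Q inp env).
Proof.
move=> P_def Q_def; apply: definable_ext (definable_mul P_def Q_def) _ => inp env.
by rewrite mulnb.
Qed.

Lemma definable_eq F G : definable F -> definable G ->
  definable (fun inp env => F inp env == G inp env).
Proof.
move=> F_def G_def.
apply: definable_ext (definable_andb (definable_leq F_def G_def) (definable_leq G_def F_def)) _.
by move=> inp env; rewrite eqn_leq.
Qed.

Lemma definable_negb (P : seq symbol -> (nat -> nat) -> bool) :
  definable P -> definable (fun inp env => ~~ P inp env).
Proof.
move=> P_def; apply: definable_ext (definable_sub (definable_const 1) P_def) _ => inp env.
by case: (P inp env).
Qed.

Lemma definable_all F (P : seq symbol -> (nat -> nat) -> nat -> bool) :
  definable F -> definable (fun inp env => P inp (env \o succn) (env 0)) ->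
  definable (fun inp env => all (P inp env) (iota 0 (F inp env))).
Proof.
move=> F_def /definable_negb P_def; apply: definable_ext
  (definable_eq (definable_sum (G := fun inp env i => ~~ P inp env i) F_def P_def)
    (definable_const 0)) _ => inp env.
rewrite sum_nat_seq_eq0 /index_iota subn0; congr nat_of_bool.
by apply: eq_all => i; rewrite /= eqb0 negbK.
Qed.

Lemma definable_min F G : definable F -> definable G ->
  definable (fun inp env => minn (F inp env) (G inp env)).
Proof.
move=> F_def G_def; apply: definable_ext (definable_sub F_def (definable_sub F_def G_def)) _.
by move=> inp env; lia.
Qed.

Lemma definable_div F G : definable F -> definable G ->
  definable (fun inp env => F inp env %/ G inp env).
Proof.
move=> F_def G_def.
apply: definable_ext (definable_mul (definable_leq (definable_const 1) G_def)
  (definable_sum (G := fun inp env i => i.+1 * G inp env <= F inp env) F_def _)) _.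
  apply: definable_leq (definable_weaken F_def).
  exact: definable_mul (definable_succ (definable_var 0)) (definable_weaken G_def).
by move=> inp env; rewrite divn_sum.
Qed.

Lemma definable_mod F G : definable F -> definable G ->
  definable (fun inp env => F inp env %% G inp env).
Proof.
move=> F_def G_def.
apply: definable_ext (definable_sub F_def (definable_mul (definable_div F_def G_def) G_def)) _.
by move=> inp env; rewrite {1}(divn_eq (F inp env) (G inp env)) addKn.
Qed.

Lemma definable_odd F : definable F -> definable (fun inp env => odd (F inp env)).
Proof.
move=> F_def; apply: definable_ext (definable_mod F_def (definable_const 2)) _ => inp env.
by rewrite modn2.
Qed.

Lemma definable_dvd F G : definable F -> definable G ->
  definable (fun inp env => F inp env %| G inp env).
Proof.
by move=> F_def G_def; exact: definable_eq (definable_mod G_def F_def) (definable_const 0).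
Qed.

Lemma definable_prime F : definable F -> definable (fun inp env => prime (F inp env)).
Proof.
move=> F_def; apply: definable_ext (definable_andb (definable_leq (definable_const 2) F_def)
  (definable_all (P := fun inp env k => ~~ ((1 < k) && (k %| F inp env))) F_def _)) _;
  last by move=> inp env; rewrite prime_all.
apply: definable_negb; apply: definable_andb.
  exact: definable_leq (definable_const 2) (definable_var 0).
exact: definable_dvd (definable_var 0) (definable_weaken F_def).
Qed.

Lemma definable_prime_count F : definable F ->
  definable (fun inp env => prime_count (F inp env)).
Proof.
move=> F_def; apply: (definable_sum (G := fun _ _ i => prime i)) => //.
exact: definable_prime (definable_var 0).
Qed.

Lemma definable_nth_prime F G : definable F -> definable G ->
  definable (fun inp env => nth_prime (F inp env) (G inp env)).
Proof.
move=> F_def G_def; apply: (definable_sum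
  (G := fun inp env v => v * (prime v && (prime_count v == G inp env)))) => //.
apply: definable_mul (definable_var 0) (definable_andb (definable_prime (definable_var 0)) _).
exact: definable_eq (definable_prime_count (definable_var 0)) (definable_weaken G_def).
Qed.

Lemma definable_is_pow2 F : definable F -> definable (fun inp env => is_pow2 (F inp env)).
Proof.
move=> F_def; apply: definable_andb (definable_leq (definable_const 1) F_def) _.
apply: (definable_all (P := fun inp env k => ~~ (2 * k + 3 %| F inp env))) => //.
apply: definable_negb; apply: definable_dvd (definable_weaken F_def).
exact: definable_add (definable_mul (definable_const 2) (definable_var 0)) (definable_const 3).
Qed.

Lemma definable_bitlen F : definable F -> definable (fun inp env => bitlen (F inp env)).
Proof.
move=> F_def; apply: definable_ext (definable_sum (G := fun _ _ i => is_pow2 i.+1) F_def _) _.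
  exact: definable_is_pow2 (definable_succ (definable_var 0)).
by move=> inp env; rewrite bitlen_sum.
Qed.

Lemma definable_truncated_exp2 F G : definable F -> definable G ->
  definable (fun inp env => if 2 ^ G inp env < F inp env then 2 ^ G inp env else 0).
Proof.
move=> F_def G_def; apply: definable_ext (definable_sum
  (G := fun inp env v => v * (is_pow2 v && (bitlen v == (G inp env).+1))) F_def _) _.
  apply: definable_mul (definable_var 0) (definable_andb (definable_is_pow2 (definable_var 0)) _).
  apply: definable_eq (definable_bitlen (definable_var 0)) _.
  exact: definable_succ (definable_weaken G_def).
by move=> inp env; rewrite truncated_exp2_sum.
Qed.

Lemma definable_exp2_bitlen F G : definable F -> definable G ->
  definable (fun inp env => 2 ^ minn (F inp env) (bitlen (G inp env))).
Proof.
move=> F_def G_def; apply: definable_ext (definable_truncated_exp2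
  (definable_add (definable_mul (definable_const 2) G_def) (definable_const 2))
  (definable_min F_def (definable_bitlen G_def))) _ => inp env.
rewrite ifT //; apply: leq_ltn_trans (_ : 2 ^ bitlen (G inp env) < _).
  by rewrite leq_exp2l // geq_minr.
by apply: leq_ltn_trans (bitlen_le _) _; lia.
Qed.

Lemma definable_div_exp2 F G : definable F -> definable G ->
  definable (fun inp env => F inp env %/ 2 ^ G inp env).
Proof.
move=> F_def G_def; apply: definable_ext
  (definable_div F_def (definable_truncated_exp2 (definable_succ F_def) G_def)) _ => inp env.
by rewrite ltnS; case: leqP => // lt; rewrite divn0 divn_small.
Qed.

Lemma definable_nat_bit F G : definable F -> definable G ->
  definable (fun inp env => nat_bit (F inp env) (G inp env)).
Proof. by move=> F_def G_def; apply: definable_odd; exact: definable_div_exp2. Qed.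

Lemma definable_prime_range F : definable F ->
  definable (fun inp env => prime_range (F inp env)).
Proof.
move=> F_def; apply: definable_ext (definable_succ (definable_mul (definable_const 16)
  (definable_exp 2 (definable_exp2_bitlen (definable_bitlen F_def) F_def)))) _ => inp env.
by rewrite minnn.
Qed.

End Definability.

(** * Formulas, circuits and parity *)

Section Circuits.
Variable N : nat.
Implicit Types (gs : seq gate) (f : seq bool -> bool).

(* [formula_for D S f]: a formula of depth at most D with at most S gates computes f;
   every subformula of an AND or OR is charged the same S. *)
Inductive formula_for : nat -> nat -> (seq bool -> bool) -> Prop :=
| formula_var D S w : w < N -> formula_for D S (fun inp => nth false inp w)
| formula_not D S f : formula_for D S f -> formula_for D.+1 S.+1 (fun inp => ~~ f inp)
| formula_and (I : Type) (s : seq I) (F : I -> seq bool -> bool) D S S' :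
    size s * S < S' -> (forall i, formula_for D S (F i)) ->
    formula_for D.+1 S' (fun inp => all (F^~ inp) s)
| formula_or (I : Type) (s : seq I) (F : I -> seq bool -> bool) D S S' :
    size s * S < S' -> (forall i, formula_for D S (F i)) ->
    formula_for D.+1 S' (fun inp => has (F^~ inp) s).

Definition wire_vals gs (inp : seq bool) : seq bool :=
  foldl (fun vs g => rcons vs (eval_gate vs g)) inp gs.

Definition wire_depths gs : seq nat :=
  foldl (fun ds g => rcons ds (\max_(w <- gate_inputs g) nth 0 ds w).+1)
        (nseq N 0) gs.

Definition gates_wf gs : Prop := forall i, i < size gs ->
  all (fun w => w < N + i) (gate_inputs (nth (NotGate 0) gs i)).

Definition computes_at gs w f D : Prop :=
  [/\ w < N + size gs, nth 0 (wire_depths gs) w <= D &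
      forall inp, size inp = N -> nth false (wire_vals gs inp) w = f inp].

Lemma size_wire_vals gs inp : size (wire_vals gs inp) = size inp + size gs.
Proof.
elim/last_ind: gs => [|gs g IH]; first by rewrite addn0.
by rewrite /wire_vals foldl_rcons size_rcons -/(wire_vals gs inp) IH size_rcons addnS.
Qed.

Lemma size_wire_depths gs : size (wire_depths gs) = N + size gs.
Proof.
elim/last_ind: gs => [|gs g IH]; first by rewrite addn0 size_nseq.
by rewrite /wire_depths foldl_rcons size_rcons -/(wire_depths gs) IH size_rcons addnS.
Qed.

Lemma computes_at_rcons gs g w f D :
  computes_at gs w f D -> computes_at (rcons gs g) w f D.
Proof.
move=> [w_lt depth_w val_w]; split; first by rewrite size_rcons; lia.
  by rewrite /wire_depths foldl_rcons nth_rcons -/(wire_depths gs) size_wire_depths w_lt.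
move=> inp size_inp; rewrite /wire_vals foldl_rcons nth_rcons -/(wire_vals gs inp).
by rewrite size_wire_vals size_inp w_lt val_w.
Qed.

Lemma computes_at_cat gs gs' w f D :
  computes_at gs w f D -> computes_at (gs ++ gs') w f D.
Proof.
move=> gs_w; elim/last_ind: gs' => [|gs' g IH]; first by rewrite cats0.
by rewrite -rcons_cat; exact: computes_at_rcons.
Qed.

Lemma computes_at_last gs g f D :
  (forall w, w \in gate_inputs g -> nth 0 (wire_depths gs) w <= D) ->
  (forall inp, size inp = N -> eval_gate (wire_vals gs inp) g = f inp) ->
  computes_at (rcons gs g) (N + size gs) f D.+1.
Proof.
move=> depth_inputs val_g; split; first by rewrite size_rcons; lia.
  rewrite /wire_depths foldl_rcons nth_rcons -/(wire_depths gs) size_wire_depths.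
  by rewrite ltnn eqxx ltnS; apply/bigmax_leqP_seq => w wi _; exact: depth_inputs.
move=> inp size_inp; rewrite /wire_vals foldl_rcons nth_rcons -/(wire_vals gs inp).
by rewrite size_wire_vals size_inp ltnn eqxx val_g.
Qed.

Lemma gates_wf_rcons gs g : gates_wf gs ->
  all (fun w => w < N + size gs) (gate_inputs g) -> gates_wf (rcons gs g).
Proof.
move=> gs_wf g_wf i; rewrite size_rcons ltnS leq_eqVlt nth_rcons => /orP [/eqP ->|lt].
  by rewrite ltnn eqxx.
by rewrite lt; exact: gs_wf.
Qed.

Definition realizable S f D : Prop := forall gs, gates_wf gs ->
  exists gs' w, [/\ gates_wf (gs ++ gs'), size gs' <= S & computes_at (gs ++ gs') w f D].

Lemma realizable_seq (I : Type) (s : seq I) (F : I -> seq bool -> bool) D S :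
  (forall i, realizable S (F i) D) -> forall gs, gates_wf gs ->
  exists gs' ws, [/\ gates_wf (gs ++ gs'), size gs' <= size s * S,
    (forall w, w \in ws -> w < N + size (gs ++ gs') /\
      nth 0 (wire_depths (gs ++ gs')) w <= D) &
    forall inp, size inp = N ->
      [seq nth false (wire_vals (gs ++ gs') inp) w | w <- ws] = [seq F i inp | i <- s]].
Proof.
move=> F_real; elim: s => [|i s IH] gs gs_wf.
  by exists [::], [::]; rewrite cats0; split.
have [gs1 [w [wf1 size1 comp1]]] := F_real i gs gs_wf.
have [gs2 [ws [wf2 size2 wires2 vals2]]] := IH _ wf1.
exists (gs1 ++ gs2), (w :: ws); rewrite catA; split=> //.
- by rewrite size_cat mulSn leq_add.
- move=> w'; rewrite inE => /orP [/eqP ->|/wires2 //].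
  by have [] := computes_at_cat gs2 comp1.
- move=> inp size_inp /=; rewrite vals2 //; congr cons.
  by have [_ _ ->] := computes_at_cat gs2 comp1.
Qed.

Lemma realizable_gate (mk : seq nat -> gate) (op : seq bool -> bool) (I : Type) (s : seq I)
    (F : I -> seq bool -> bool) D S S' :
  (forall ws, gate_inputs (mk ws) = ws) ->
  (forall vals ws, eval_gate vals (mk ws) = op [seq nth false vals w | w <- ws]) ->
  size s * S < S' -> (forall i, realizable S (F i) D) ->
  realizable S' (fun inp => op [seq F i inp | i <- s]) D.+1.
Proof.
move=> mk_inputs mk_eval size_lt F_real gs gs_wf.
have [gs' [ws [gs'_wf size_gs' wires vals]]] := realizable_seq s F_real gs_wf.
exists (rcons gs' (mk ws)), (N + size (gs ++ gs')); rewrite -rcons_cat; split.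
- by apply: gates_wf_rcons; rewrite // mk_inputs; apply/allP => w /wires [].
- by rewrite size_rcons (leq_ltn_trans size_gs').
- apply: computes_at_last => [w|inp size_inp]; last by rewrite mk_eval vals.
  by rewrite mk_inputs => /wires [].
Qed.

Lemma formula_realizable D S f : formula_for D S f -> realizable S f D.
Proof.
elim=> {D S f}.
- move=> D S w wN gs gs_wf; exists [::], w; rewrite cats0; split=> //.
  apply: (@computes_at_cat [::]).
  by split; [rewrite addn0 | rewrite nth_nseq; case: ifP | ].
- move=> D S f _ IH gs gs_wf; have [gs' [w [gs'_wf size_gs' [w_lt depth_w val_w]]]] := IH gs gs_wf.
  exists (rcons gs' (NotGate w)), (N + size (gs ++ gs')); rewrite -rcons_cat.
  split; [by apply: gates_wf_rcons => //=; rewrite w_lt | by rewrite size_rcons | ].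
  apply: computes_at_last => [w'|inp size_inp /=]; first by rewrite inE => /eqP ->.
  by rewrite val_w.
- move=> I s F D S S' size_lt _ F_real.
  rewrite (_ : (fun inp => _) = fun inp => all id [seq F i inp | i <- s]).
    by apply: (realizable_gate (mk := AndGate)) size_lt F_real => // vals ws /=; rewrite all_map.
  by apply/funext => inp; rewrite all_map.
- move=> I s F D S S' size_lt _ F_real.
  rewrite (_ : (fun inp => _) = fun inp => has id [seq F i inp | i <- s]).
    by apply: (realizable_gate (mk := OrGate)) size_lt F_real => // vals ws /=; rewrite has_map.
  by apply/funext => inp; rewrite has_map.
Qed.

Lemma formula_circuit m (F : 'I_m -> seq bool -> bool) D S : (forall j, formula_for D S (F j)) ->
  exists c : circuit, [/\ circ_wf N c, size (circ_gates c) <= m * S,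
    circ_depth N c <= D &
    forall inp, size inp = N -> circ_eval c inp = [seq F j inp | j <- enum 'I_m]].
Proof.
move=> F_formula.
have [|gs [ws [gs_wf size_gs wires vals]]] :=
  realizable_seq (enum 'I_m) (fun j => formula_realizable (F_formula j)) (gs := [::]).
  by move=> i; rewrite ltn0.
rewrite size_enum_ord in size_gs; exists (Circuit gs ws); split=> //.
- by split=> //=; apply/allP => w /wires [].
- by rewrite /circ_depth; apply/bigmax_leqP_seq => w /wires [].
Qed.

Lemma formula_weaken D S f D' S' :
  formula_for D S f -> D <= D' -> S <= S' -> formula_for D' S' f.
Proof.
move=> f_formula; elim: f_formula D' S' => {D S f}.
- by move=> D S w wN D' S' _ _; exact: formula_var.
- by move=> D S f _ IH [|D'] [|S'] // DD SS; apply: formula_not; exact: IH.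
- move=> I s F D S S1 size_lt _ IH [|D'] // S' DD SS.
  by apply: (@formula_and _ _ _ _ S); [exact: leq_trans size_lt SS|move=> i; exact: IH].
- move=> I s F D S S1 size_lt _ IH [|D'] // S' DD SS.
  by apply: (@formula_or _ _ _ _ S); [exact: leq_trans size_lt SS|move=> i; exact: IH].
Qed.

Lemma formula_ext D S f g : formula_for D S f -> f =1 g -> formula_for D S g.
Proof. by move=> f_formula /funext <-. Qed.

Lemma formula_false D S : 0 < S -> formula_for D.+1 S (fun=> false).
Proof. by move=> S_gt0; apply: (@formula_or void [::] (fun v => match v with end) D 0). Qed.

Lemma formula_eqb (b : bool) D S f :
  formula_for D S f -> formula_for D.+1 S.+1 (fun inp => b == f inp).
Proof.
move=> f_formula; case: b.
  by apply: formula_ext (formula_weaken f_formula (leqnSn _) (leqnSn _)) _ => inp; case: (f inp).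
by apply: formula_ext (formula_not f_formula) _ => inp; case: (f inp).
Qed.

Lemma all_zip_eq (I : Type) (f : I -> bool) (t : seq bool) (s : seq I) :
  size t = size s -> all (fun p => p.1 == f p.2) (zip t s) = (t == map f s).
Proof. by elim: s t => [|i s IH] [|b t] //= [size_eq]; rewrite IH // eqseq_cons. Qed.

Definition parity_size g S := (2 ^ g * (g * S.+1).+1).+1.

Lemma formula_parity_dnf (I : Type) (s : seq I) (F : I -> seq bool -> bool) D S g :
  size s <= g -> (forall i, formula_for D S (F i)) ->
  formula_for D.+3 (parity_size g S) (fun inp => odd (count (F^~ inp) s)).
Proof.
move=> size_s F_formula; pose literal (p : bool * I) inp := p.1 == F p.2 inp.
pose odd_rows :=
  [seq t : (size s).-tuple bool <- enum {: (size s).-tuple bool} | odd (count id t)].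
have row_formula (t : (size s).-tuple bool) :
    formula_for D.+2 (g * S.+1).+1 (fun inp => all (literal^~ inp) (zip t s)).
  apply: formula_and => [|p]; last exact: formula_eqb.
  by rewrite ltnS leq_mul2r size_zip size_tuple minnn size_s orbT.
have row_eq inp (t : (size s).-tuple bool) :
    all (literal^~ inp) (zip t s) = (tval t == map (F^~ inp) s).
  by apply: (all_zip_eq (F^~ inp)); rewrite size_tuple.
apply: formula_ext (formula_or (s := odd_rows) _ row_formula) _ => [|inp].
  rewrite /parity_size ltnS leq_mul2r /=.
  apply: leq_trans (_ : #|{: (size s).-tuple bool}| <= _).
    by rewrite cardE size_filter count_size.
  by rewrite card_tuple card_bool leq_exp2l.
apply/hasP/idP => [[t]|odd_F].
  by rewrite mem_filter row_eq => /andP [odd_t _] /eqP t_eq; rewrite t_eq count_map in odd_t.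
exists (map_tuple (F^~ inp) (in_tuple s)); last by rewrite row_eq.
by rewrite mem_filter mem_enum /= count_map andbT.
Qed.

Lemma odd_count_flatten (I : Type) (p : pred I) (ss : seq (seq I)) :
  odd (count p (flatten ss)) = odd (count (fun t => odd (count p t)) ss).
Proof. by elim: ss => //= t ss IH; rewrite count_cat !oddD IH oddb. Qed.

Lemma all_size_reshape (I : Type) k g (s : seq I) :
  all (fun t => size t <= k) (reshape (nseq g k) s).
Proof. by elim: g s => //= g IH s; rewrite IH andbT size_take; case: ltnP. Qed.

Lemma formula_parity (I : Type) (s : seq I) (F : I -> seq bool -> bool) D S g q :
  size s <= g ^ q -> (forall i, formula_for D S (F i)) ->
  formula_for (D.+1 + 3 * q) (iter q (parity_size g) S.+1)
    (fun inp => odd (count (F^~ inp) s)).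
Proof.
move=> + F_formula; elim: q s => [|q IH] s size_s.
  rewrite muln0 addn0 /=; case: s size_s => [|i [|//]] _ /=; first exact: formula_false.
  apply: formula_ext (formula_weaken (F_formula i) (leqnSn _) (leqnSn _)) _ => inp.
  by rewrite addn0 oddb.
pose block t inp := odd (count (F^~ inp) (take (g ^ q) t)).
have block_formula t : formula_for (D.+1 + 3 * q) (iter q (parity_size g) S.+1) (block t).
  by apply: IH; rewrite size_take; case: ltnP.
pose ss := reshape (nseq g (g ^ q)) s.
have size_ss : size ss <= g by rewrite size_reshape size_nseq.
rewrite mulnS [3 + _]addnC addnA addn3 iterS.
apply: formula_ext (formula_parity_dnf size_ss block_formula) _ => inp.
rewrite -[in RHS](@reshapeKr _ (nseq g (g ^ q)) s); last by rewrite sumn_nseq mulnC -expnS.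
rewrite odd_count_flatten -/ss; congr odd.
have: all (fun t => size t <= g ^ q) ss by exact: all_size_reshape.
by elim: ss {size_ss} => //= t ss IHs /andP [size_t /IHs ->]; rewrite /block take_oversize.
Qed.

Lemma parity_size_iter_le g q S :
  (iter q (parity_size g) S.+1).+1 <= 2 ^ ((2 * g + 2) * q) * S.+2.
Proof.
elim: q => [|q IH]; first by rewrite muln0 mul1n.
rewrite iterS [_ * q.+1]mulnS expnD -mulnA.
set s := iter _ _ _ in IH *; apply: leq_trans (_ : 2 ^ (2 * g + 2) * s.+1 <= _); last first.
  by rewrite leq_mul2l IH orbT.
have g_lt : g < 2 ^ g by exact: ltn_expl.
rewrite /parity_size expnD mul2n -addnn expnD -[2 ^ 2]/4; move: (2 ^ g) g_lt => G g_lt.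
have inner_le : G * (g * s.+1).+1 <= G * (G * s.+1) by rewrite leq_mul2l; nia.
have G_pos : 0 < G * (G * s.+1) by rewrite !muln_gt0; lia.
by rewrite -(mulnA _ 4) [4 * _]mulnC mulnA -(mulnA G G); lia.
Qed.

End Circuits.

(** * Hybrid argument and moments of the bias *)

Local Open Scope ring_scope.

Lemma big_rcons_tuple (V : nmodType) (T : finType) n (F : n.+1.-tuple T -> V) :
  \sum_w F w = \sum_(w : n.-tuple T) \sum_b F [tuple of rcons w b].
Proof.
have bij : bijective (fun p : n.-tuple T * T => [tuple of rcons p.1 p.2]).
  apply: inj_card_bij => [[w b] [w' b'] /(congr1 val) /= /rcons_inj [w_eq ->]|].
    by congr pair; exact: val_inj.
  by rewrite card_prod !card_tuple -expnSr.
by rewrite pair_big /= (reindex _ (onW_bij _ bij)).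
Qed.

Lemma big_cat_tuple (V : nmodType) (T : finType) m n (F : (m + n).-tuple T -> V) :
  \sum_w F w = \sum_(u : m.-tuple T) \sum_(v : n.-tuple T) F [tuple of u ++ v].
Proof.
have bij : bijective (fun p : m.-tuple T * n.-tuple T => [tuple of p.1 ++ p.2]).
  apply: inj_card_bij => [[u v] [u' v'] /(congr1 val) /= /eqP|].
    rewrite eqseq_cat ?size_tuple // => /andP [/eqP u_eq /eqP v_eq].
    by congr pair; exact: val_inj.
  by rewrite card_prod !card_tuple -expnD.
by rewrite pair_big /= (reindex _ (onW_bij _ bij)).
Qed.

Lemma sqr_sum_le (R : realFieldType) (I : finType) (F : I -> R) :
  (\sum_i F i) ^+ 2 <= #|I|%:R * \sum_i F i ^+ 2.
Proof.
have diff_sqr_ge0 : 0 <= \sum_i \sum_j (F i - F j) ^+ 2.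
  by apply: sumr_ge0 => i _; apply: sumr_ge0 => j _; exact: sqr_ge0.
suff diff_sqrE : \sum_i \sum_j (F i - F j) ^+ 2 =
    2 * (#|I|%:R * \sum_i F i ^+ 2 - (\sum_i F i) ^+ 2).
  by move: diff_sqr_ge0; rewrite diff_sqrE pmulr_rge0 // subr_ge0.
under eq_bigr => i _ do
  (under eq_bigr => j _ do rewrite sqrrB; rewrite big_split /= sumrB sumr_const -mulr_natl).
rewrite big_split /= sumrB sumr_const -mulr_natl -mulr_sumr.
have -> : \sum_i \sum_j F i * F j *+ 2 = 2 * (\sum_i F i) ^+ 2.
  rewrite expr2 mulr_suml mulr_sumr; apply: eq_bigr => i _.
  by rewrite mulr_sumr mulr_sumr; apply: eq_bigr => j _; rewrite -mulr_natl.
by rewrite -/(#|I|); ring.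
Qed.

Section Hybrid.
Variables (R : realFieldType) (T : finType) (X : T -> R).

Definition mass (A : pred T) : R := \sum_(x | A x) X x.

Lemma mass_signed (A : pred T) (g : T -> bool) b :
  mass [pred x | A x & g x == b] =
  (mass A + (-1) ^+ b * \sum_(x | A x) X x * (-1) ^+ g x) / 2.
Proof.
rewrite /mass big_mkcondr /= mulr_sumr -big_split mulr_suml; apply: eq_bigr => x _ /=.
by case: (g x); case: b; rewrite ?expr0 ?expr1 /=; lra.
Qed.

Variable E : T -> seq bool.

Definition prefix_dist i : R :=
  \sum_(w : i.-tuple bool) `|mass [pred x | take i (E x) == w] - (2 ^+ i)^-1|.

Definition prefix_bias i : R :=
  \sum_(w : i.-tuple bool)
    `|\sum_(x | take i (E x) == w) X x * (-1) ^+ nth false (E x) i|.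

Lemma prefix_distS i : (forall x, i < size (E x))%N ->
  prefix_dist i.+1 <= prefix_dist i + prefix_bias i.
Proof.
move=> size_E; rewrite /prefix_dist big_rcons_tuple -big_split /=.
apply: ler_sum => w _; set bias := \sum_(x | _) _ * _; set dev := mass _ - (2 ^+ i)^-1.
have devS b : mass [pred x | take i.+1 (E x) == rcons w b] - (2 ^+ i.+1)^-1 =
    (dev + (-1) ^+ b * bias) / 2.
  have -> : mass [pred x | take i.+1 (E x) == rcons w b] =
      mass [pred x | (take i (E x) == w) & nth false (E x) i == b].
    by apply: eq_bigl => x /=; rewrite (take_nth false) // eqseq_rcons.
  rewrite (mass_signed [pred x | take i (E x) == w] (fun x => nth false (E x) i)) -/bias.
  by rewrite /dev exprS invfM; lra.
have half_le b : `|(dev + (-1) ^+ b * bias) / 2| <= (`|dev| + `|bias|) / 2.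
  rewrite normrM (ger0_norm (_ : 0 <= 2^-1)) ?invr_ge0 // ler_pM2r ?invr_gt0 //.
  by apply: le_trans (ler_normD _ _) _; rewrite normrM normrX normrN1 expr1n mul1r.
by rewrite big_bool /= !devS; have := half_le true; have := half_le false; lra.
Qed.

Lemma prefix_dist_le m : (forall x, size (E x) = m) -> \sum_x X x = 1 ->
  prefix_dist m <= \sum_(i < m) prefix_bias i.
Proof.
move=> size_E X_sum; suff up_to i : (i <= m)%N -> prefix_dist i <= \sum_(j < i) prefix_bias j.
  exact: up_to.
elim: i => [|i IH] im; last first.
  rewrite big_ord_recr /=; apply: le_trans (prefix_distS _) _ => [x|].
    by rewrite size_E.
  by rewrite lerD2r IH // ltnW.
rewrite big_ord0 /prefix_dist big1 // => w _; rewrite expr0 invr1 /mass.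
by rewrite (eq_bigl xpredT) => [|x /=]; rewrite ?take0 ?tuple0 // X_sum subrr normr0.
Qed.

End Hybrid.

Lemma sum_norm_refine (R : realFieldType) (T A W : finType) (k : T -> A) (w : T -> W)
    (F : T -> R) : (forall x x', k x = k x' -> w x = w x') ->
  \sum_v `|\sum_(x | w x == v) F x| <= \sum_q `|\sum_(x | k x == q) F x|.
Proof.
move=> k_w.
apply: le_trans (_ : \sum_v \sum_q `|\sum_(x | (w x == v) && (k x == q)) F x| <= _).
  apply: ler_sum => v _; rewrite (partition_big k xpredT) //=.
  exact: ler_norm_sum.
rewrite exchange_big /=; apply: ler_sum => q _.
have [x0 /eqP kx0|none] := pickP (fun x => k x == q); last first.
  rewrite big1 ?normr_ge0 // => v _; rewrite big_pred0 ?normr0 // => x.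
  by rewrite none andbF.
rewrite (bigD1 (w x0)) //= [X in _ + X]big1 => [|v vw]; last first.
  rewrite big_pred0 ?normr0 // => x; apply/negP => /andP [/eqP wx /eqP kx].
  by case/eqP: vw; rewrite -wx; apply: k_w; rewrite kx.
rewrite addr0 le_eqVlt; apply/orP; left; apply/eqP; congr `|_|.
apply: eq_bigl => x; apply/andP/idP => [[] //|/eqP kx]; split; last exact/eqP.
by apply/eqP; apply: k_w; rewrite kx.
Qed.

Section Moments.
Variables (R : realFieldType) (T Y : finType) (X : T -> R) (f : T -> Y -> bool).
Variables (near : rel T) (eta gam : R).
Hypotheses (X_ge0 : forall x, 0 <= X x) (X_sum : \sum_x X x = 1).
Hypotheses (eta_ge0 : 0 <= eta) (gam_ge0 : 0 <= gam).

Definition correlation x x' : R := \sum_y (-1) ^+ f x y * (-1) ^+ f x' y.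

Hypothesis near_small : forall x, \sum_(x' | near x x') X x' <= eta ^+ 2.
Hypothesis far_bias : forall x x', ~~ near x x' -> correlation x x' <= gam ^+ 2 * #|Y|%:R.

Lemma sum_sqr_signed (K : pred T) :
  \sum_y (\sum_(x | K x) X x * (-1) ^+ f x y) ^+ 2 =
  \sum_(x | K x) \sum_(x' | K x') X x * X x' * correlation x x'.
Proof.
under eq_bigr => y _ do rewrite expr2 big_distrlr /=.
rewrite exchange_big /=; apply: eq_bigr => x _; rewrite exchange_big /=.
by apply: eq_bigr => x' _; rewrite mulr_sumr; apply: eq_bigr => y _; ring.
Qed.

Lemma correlation_le x x' : correlation x x' <= #|Y|%:R * ((near x x')%:R + gam ^+ 2).
Proof.
have [_|/far_bias] := boolP (near x x'); last by rewrite add0r mulrC.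
apply: le_trans (_ : #|Y|%:R <= _).
  rewrite -sumr_const; apply: ler_sum => y _; rewrite -signr_addb; case: (_ (+) _) => //.
  by rewrite expr1; lra.
by rewrite ler_peMr ?ler0n // lerDl sqr_ge0.
Qed.

Lemma mass_ge0 (K : pred T) : 0 <= mass X K.
Proof. by apply: sumr_ge0. Qed.

Lemma mass_le1 (K : pred T) : mass X K <= 1.
Proof. by rewrite -X_sum [X in _ <= X](bigID K) /= lerDl; exact: sumr_ge0. Qed.

Lemma near_pairs_le (K : pred T) :
  \sum_(x | K x) \sum_(x' | K x') X x * X x' * (near x x')%:R <= eta ^+ 2.
Proof.
apply: le_trans (_ : \sum_(x | K x) X x * eta ^+ 2 <= _); last first.
  by rewrite -mulr_suml -/(mass X K) ler_piMl ?sqr_ge0 // mass_le1.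
apply: ler_sum => x _; under eq_bigr => x' _ do rewrite -mulrA.
rewrite -mulr_sumr ler_wpM2l //; apply: le_trans (near_small x).
rewrite [X in _ <= X]big_mkcond [X in X <= _]big_mkcond; apply: ler_sum => x' _.
by case: (K x'); case: (near x x'); rewrite ?mulr1 ?mulr0.
Qed.

Lemma second_moment (K : pred T) :
  \sum_y (\sum_(x | K x) X x * (-1) ^+ f x y) ^+ 2 <=
  #|Y|%:R * (eta + mass X K * gam) ^+ 2.
Proof.
rewrite sum_sqr_signed.
apply: le_trans (_ : \sum_(x | K x) \sum_(x' | K x')
    X x * X x' * (#|Y|%:R * ((near x x')%:R + gam ^+ 2)) <= _).
  apply: ler_sum => x _; apply: ler_sum => x' _; apply: ler_wpM2l (correlation_le x x').
  exact: mulr_ge0.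
have -> : \sum_(x | K x) \sum_(x' | K x')
      X x * X x' * (#|Y|%:R * ((near x x')%:R + gam ^+ 2)) =
    #|Y|%:R * (\sum_(x | K x) \sum_(x' | K x') X x * X x' * (near x x')%:R
      + mass X K ^+ 2 * gam ^+ 2).
  rewrite /mass [(\sum_(x | K x) X x) ^+ 2]expr2 big_distrlr /= mulr_suml -big_split mulr_sumr.
  apply: eq_bigr => x _ /=.
  by rewrite mulr_suml -big_split mulr_sumr; apply: eq_bigr => x' _ /=; ring.
apply: ler_wpM2l; first exact: ler0n.
have : 0 <= eta * (mass X K * gam) by rewrite !mulr_ge0 ?mass_ge0.
by have := near_pairs_le K; nra.
Qed.

Lemma first_moment (K : pred T) :
  \sum_y `|\sum_(x | K x) X x * (-1) ^+ f x y| <= #|Y|%:R * (eta + mass X K * gam).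
Proof.
have bound_ge0 : 0 <= #|Y|%:R * (eta + mass X K * gam).
  by rewrite mulr_ge0 ?ler0n // addr_ge0 // mulr_ge0 ?mass_ge0.
rewrite -(@ler_pXn2r _ 2) // ?nnegrE //; last by apply: sumr_ge0.
apply: le_trans (sqr_sum_le _) _.
under eq_bigr => y _ do rewrite real_normK ?num_real //.
rewrite exprMn [X in _ <= X * _]expr2 -mulrA ler_wpM2l ?ler0n //.
exact: second_moment.
Qed.

Lemma first_moment_partition (A : finType) (k : T -> A) (D : {set A}) :
  (forall x, k x \in D) ->
  \sum_y \sum_q `|\sum_(x | k x == q) X x * (-1) ^+ f x y| <=
  #|Y|%:R * (#|D|%:R * eta + gam).
Proof.
move=> k_D; rewrite exchange_big /=.
apply: le_trans (_ : \sum_(q in D) #|Y|%:R * (eta + mass X [pred x | k x == q] * gam) <= _).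
  rewrite [X in _ <= X]big_mkcond; apply: ler_sum => q _; case: ifP => qD.
    exact: first_moment.
  rewrite big1 // => y _; rewrite big_pred0 ?normr0 // => x.
  by apply: contraFF qD => /eqP <-.
rewrite -mulr_sumr big_split /= sumr_const -mulr_suml -(mulr_natl eta) ler_wpM2l ?ler0n //.
rewrite lerD2l -[X in _ <= X]mul1r ler_wpM2r // -X_sum (partition_big k (mem D)) //=.
Qed.

End Moments.

Lemma stat_dist_seeded (R : realType) n d m (X : {ffun n.-tuple bool -> R})
    (Ext : n.-tuple bool -> d.-tuple bool -> m.-tuple bool) :
  stat_dist
    (image_dist (fun z : n.-tuple bool * d.-tuple bool => [tuple of z.2 ++ Ext z.1 z.2])
       (prod_dist X (uniform R (d.-tuple bool))))
    (uniform R ((d + m).-tuple bool)) =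
  (2 ^+ d)^-1 * \sum_r prefix_dist X (fun x => Ext x r) m / 2.
Proof.
rewrite /stat_dist big_cat_tuple mulrC -mulr_suml [RHS]mulrA; congr (_ / 2).
rewrite mulr_sumr; apply: eq_bigr => r _.
rewrite /prefix_dist mulr_sumr; apply: eq_bigr => w _.
rewrite -[X in X * `|_|]ger0_norm ?invr_ge0 ?exprn_ge0 // -normrM; congr `|_|.
rewrite !ffunE card_tuple card_bool natrX exprD invfM mulrBr; congr (_ - _).
rewrite (eq_bigl (fun z => [pred x | take m (Ext x r) == w] z.1 && (z.2 == r))).
  rewrite (eq_bigr (fun z => X z.1 * (2 ^+ d)^-1)) => [|z _]; last first.
    by rewrite !ffunE card_tuple card_bool natrX.
  rewrite -(pair_big [pred x | take m (Ext x r) == w] (fun r' => r' == r)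
    (fun x _ => X x * (2 ^+ d)^-1)) /=.
  by rewrite /mass mulr_sumr; apply: eq_bigr => x _; rewrite big_pred1_eq mulrC.
move=> [x r'] /=; rewrite -val_eqE /= eqseq_cat ?size_tuple // take_oversize ?size_tuple //.
by rewrite [(r' : seq bool) == r]val_eqE; case: (r' =P r) => [->|_]; rewrite ?andbT ?andbF.
Qed.

(** * Extracting many bits from a design *)

Section NisanWigderson.
Variables (R : realType) (n d m : nat) (U : finType).
Variables (idx : 'I_m -> U -> 'I_d).
Variable (f : n.-tuple bool -> {ffun U -> bool} -> bool).
Local Notation T := (n.-tuple bool).
Local Notation Y := {ffun U -> bool}.

Definition sub_seed (r : d.-tuple bool) (j : 'I_m) : Y := [ffun u => tnth r (idx j u)].

Definition nw_ext (x : T) (r : d.-tuple bool) : m.-tuple bool :=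
  [tuple f x (sub_seed r j) | j < m].

Definition resample (i : 'I_m) (r : d.-tuple bool) (y : Y) : d.-tuple bool :=
  [tuple if [pick u | idx i u == p] is Some u then y u else tnth r p | p < d].

Definition overlap (i j : 'I_m) : {set U} := [set u | [exists u', idx j u' == idx i u]].

Hypothesis idx_inj : forall j, injective (idx j).

Lemma sub_seed_resample i r y : sub_seed (resample i r y) i = y.
Proof.
apply/ffunP => u; rewrite ffunE tnth_mktuple.
by case: pickP => [u' /eqP /idx_inj ->|/(_ u)]; rewrite ?eqxx.
Qed.

Lemma resampleK i r y : resample i (resample i r y) (sub_seed r i) = r.
Proof.
apply: eq_from_tnth => p; rewrite !tnth_mktuple.
by case: pickP => [u /eqP <-|//]; rewrite ffunE.
Qed.

Lemma sum_resample i (F : d.-tuple bool -> R) :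
  #|{: Y}|%:R * \sum_r F r = \sum_r \sum_(y : Y) F (resample i r y).
Proof.
pose swap (p : d.-tuple bool * Y) := (resample i p.1 p.2, sub_seed p.1 i).
have swapK : involutive swap.
  by case=> r y; rewrite /swap /= resampleK sub_seed_resample.
rewrite [RHS]pair_big /= (reindex_inj (inv_inj swapK)) /=.
rewrite (eq_bigr (fun p => F p.1)) => [|[r y] _ /=]; last by rewrite resampleK.
rewrite -(pair_big xpredT xpredT (fun r (_ : Y) => F r)) /= mulr_sumr.
by apply: eq_bigr => r _; rewrite sumr_const mulr_natl.
Qed.

Lemma sub_seed_overlap i j r (y y' : Y) : {in overlap i j, y =1 y'} ->
  sub_seed (resample i r y) j = sub_seed (resample i r y') j.
Proof.
move=> yy'; apply/ffunP => u; rewrite !ffunE !tnth_mktuple.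
case: pickP => [u' /eqP idx_eq|//]; apply: yy'; rewrite inE; apply/existsP; exists u.
by rewrite idx_eq.
Qed.

Definition table_dom (i : 'I_m) : {set 'I_m * {set U}} :=
  [set q : 'I_m * {set U} | (q.1 < i)%N && (q.2 \subset overlap i q.1)].

(* The truth tables of all the output bits before i, as functions of the seed
   bits they share with bit i. *)
Definition table (i : 'I_m) r (x : T) : {set 'I_m * {set U}} :=
  [set q : 'I_m * {set U} in table_dom i |
     f x (sub_seed (resample i r [ffun u => u \in q.2]) q.1)].

Lemma table_prefix i r y x x' : table i r x = table i r x' ->
  take i (nw_ext x (resample i r y)) = take i (nw_ext x' (resample i r y)).
Proof.
move=> table_eq; apply: (@eq_from_nth _ false).
  by rewrite !size_takel ?size_tuple // ltnW.
move=> j; rewrite size_takel ?size_tuple => [ji|]; last exact/ltnW.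
have jm : (j < m)%N by exact: ltn_trans ji (ltn_ord i).
pose shared := [set u in overlap i (Ordinal jm) | y u].
rewrite !nth_take // -!(tnth_nth false _ (Ordinal jm)) !tnth_mktuple.
rewrite (sub_seed_overlap (j := Ordinal jm) r (y' := [ffun u => u \in shared])); last first.
  by move=> u u_overlap; rewrite ffunE inE u_overlap.
have shared_sub : shared \subset overlap i (Ordinal jm).
  by apply/fintype.subsetP => u; rewrite inE => /andP [].
by have /setP/(_ (Ordinal jm, shared)) := table_eq; rewrite !inE /= ji shared_sub.
Qed.

Lemma card_table_dom i :
  #|table_dom i| = (\sum_(j < m | (j < i)%N) 2 ^ #|overlap i j|)%N.
Proof.
rewrite -sum1_card (eq_bigl (fun q : 'I_m * {set U} =>
  (q.1 < i)%N && (q.2 \in powerset (overlap i q.1)))) => [|q]; last by rewrite !inE.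
rewrite -(pair_big_dep (fun j : 'I_m => (j < i)%N)
  (fun j (S : {set U}) => S \in powerset (overlap i j)) (fun _ _ => 1%N)) /=.
by apply: eq_bigr => j _; rewrite sum1_card card_powerset.
Qed.

Variable X : {ffun T -> R}.
Hypothesis distX : is_dist X.
Variables (near : rel T) (eta gam : R) (Delta : nat).
Hypotheses (eta_ge0 : 0 <= eta) (gam_ge0 : 0 <= gam).
Hypothesis near_small : forall x, \sum_(x' | near x x') X x' <= eta ^+ 2.
Hypothesis far_bias : forall x x', ~~ near x x' ->
  correlation R f x x' <= gam ^+ 2 * #|{: Y}|%:R.
Hypothesis overlap_small : forall i : 'I_m,
  (\sum_(j < m | (j < i)%N) 2 ^ #|overlap i j| <= Delta)%N.

Let X_ge0 x : 0 <= X x. Proof. by case: distX. Qed.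
Let X_sum : \sum_x X x = 1. Proof. by case: distX. Qed.

Definition next_bit_bias (i : 'I_m) (r : d.-tuple bool) : R :=
  prefix_bias X (fun x => nw_ext x r) i.

Lemma next_bit_bias_table i r y :
  next_bit_bias i (resample i r y) <=
  \sum_q `|\sum_(x | table i r x == q) X x * (-1) ^+ f x y|.
Proof.
have prefix_size x : size (take i (nw_ext x (resample i r y))) == i.
  by rewrite size_takel ?size_tuple // ltnW.
have := @sum_norm_refine R T _ _ (table i r) (fun x => Tuple (prefix_size x))
  (fun x => X x * (-1) ^+ f x y).
move=> refine; apply: le_trans (refine _); last first.
  by move=> x x' table_eq; apply: val_inj => /=; exact: table_prefix.
rewrite le_eqVlt; apply/orP; left; apply/eqP; apply: eq_bigr => w _; congr `|_|.
by apply: eq_bigr => x _; rewrite -(tnth_nth false _ i) tnth_mktuple sub_seed_resample.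
Qed.

Lemma next_bit_bias_resample i r :
  \sum_(y : Y) next_bit_bias i (resample i r y) <=
  #|{: Y}|%:R * ((2 ^ Delta)%:R * eta + gam).
Proof.
apply: le_trans (ler_sum _ (fun y _ => next_bit_bias_table i r y)) _.
apply: le_trans (first_moment_partition X_ge0 X_sum eta_ge0 gam_ge0 near_small far_bias
  (D := powerset (table_dom i)) _) _.
  by move=> x; rewrite powersetE; apply/fintype.subsetP => q; rewrite inE => /andP [].
rewrite ler_wpM2l // lerD2r card_powerset ler_wpM2r // ler_nat leq_exp2l // card_table_dom.
exact: overlap_small.
Qed.

Lemma next_bit_bias_sum i :
  \sum_r next_bit_bias i r <= 2 ^+ d * ((2 ^ Delta)%:R * eta + gam).
Proof.
have card_Y : 0 < #|{: Y}|%:R :> R by rewrite card_ffun card_bool ltr0n expn_gt0.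
rewrite -(ler_pM2l card_Y) (sum_resample i).
apply: le_trans (ler_sum _ (fun r _ => next_bit_bias_resample i r)) _.
by rewrite sumr_const card_tuple card_bool -[X in X <= _]mulr_natl natrX mulrCA.
Qed.

Lemma nw_stat_dist :
  stat_dist
    (image_dist (fun z : T * d.-tuple bool => [tuple of z.2 ++ nw_ext z.1 z.2])
       (prod_dist X (uniform R (d.-tuple bool))))
    (uniform R ((d + m).-tuple bool)) <=
  m%:R * ((2 ^ Delta)%:R * eta + gam) / 2.
Proof.
rewrite stat_dist_seeded -mulr_suml mulrA ler_pM2r ?invr_gt0 // ler_pdivrMl ?exprn_gt0 //.
apply: le_trans (_ : \sum_r \sum_(i < m) next_bit_bias i r <= _).
  apply: ler_sum => r _; apply: prefix_dist_le => // x; exact: size_tuple.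
rewrite exchange_big /=; apply: le_trans (ler_sum _ (fun i _ => next_bit_bias_sum i)) _.
by rewrite sumr_const card_ord -[X in X <= _]mulr_natl mulrCA.
Qed.

End NisanWigderson.

(** * One output bit: sampling at random scales *)

Local Open Scope nat_scope.

Section Sampler.
Variables (lam H : nat).
Implicit Types y : nat -> nat -> bool.

(* Row 0 of the round seed y is the offset u, row h + 1 is column h of A; bit lam of
   row h is the coefficient of level h. The position of w is u + A w. *)
Definition position_bit y (w b : nat) : bool :=
  odd (y 0 b + \sum_(0 <= h < H) nat_bit w h * y h.+1 b).

Definition hits y (w v : nat) : bool :=
  all (fun b => nat_bit v b == position_bit y w b) (iota 0 lam).

Definition coef y (w : nat) : nat := \sum_(0 <= h < H.+1) (w < 2 ^ h) * y h lam.

Definition round_sum n (x : nat -> bool) y : nat :=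
  \sum_(0 <= w < 2 ^ H) coef y w * \sum_(0 <= v < n) x v * hits y w v.

Definition one_bit L n (x : nat -> bool) (y : nat -> nat -> nat -> bool) : bool :=
  odd (\sum_(0 <= i < L) round_sum n x (y i)).

Lemma hitsP y w v :
  reflect (forall b, b < lam -> nat_bit v b = position_bit y w b) (hits y w v).
Proof.
apply: (iffP allP) => hit b => [b_lt|]; first by apply/eqP/hit; rewrite mem_iota.
by rewrite mem_iota => /andP [_ /hit ->].
Qed.

Lemma hits_inj y w v v' : v < 2 ^ lam -> v' < 2 ^ lam ->
  hits y w v -> hits y w v' -> v = v'.
Proof.
move=> v_lt v'_lt /hitsP hit /hitsP hit'; apply: nat_bit_inj v_lt v'_lt _ => b b_lt.
by rewrite hit // hit'.
Qed.

Lemma sum_hits n (x : nat -> bool) y w : n <= 2 ^ lam ->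
  \sum_(0 <= v < n) x v * hits y w v = has (fun v => x v && hits y w v) (iota 0 n).
Proof.
move=> n_le; under eq_bigr => v _ do rewrite mulnb.
rewrite /index_iota subn0 sum_le1_has ?iota_uniq // => v v'; rewrite !mem_iota /=.
by move=> v_lt v'_lt /andP [_ hit] /andP [_ hit']; apply: hits_inj hit hit'; lia.
Qed.

Lemma eq_one_bit_source L n x x' (y : nat -> nat -> nat -> bool) :
  (forall i w v, i < L -> w < 2 ^ H -> v < n -> hits (y i) w v -> x v = x' v) ->
  one_bit L n x y = one_bit L n x' y.
Proof.
move=> eq_x; congr odd; apply: eq_big_nat => i /andP [_ iL].
apply: eq_big_nat => w /andP [_ w_lt]; congr (_ * _); apply: eq_big_nat => v /andP [_ vn].
by case: (boolP (hits _ _ _)) => [/(eq_x _ _ _ iL w_lt vn) ->|]; rewrite ?muln0.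
Qed.

Lemma eq_one_bit_seed L n x (y y' : nat -> nat -> nat -> bool) : H <= lam ->
  (forall i h b, i < L -> h <= lam -> b <= lam -> y i h b = y' i h b) ->
  one_bit L n x y = one_bit L n x y'.
Proof.
move=> H_le eq_y; congr odd; apply: eq_big_nat => i /andP [_ iL].
apply: eq_bigr => w _; congr (_ * _).
  by apply: eq_big_nat => h /andP [_ hH]; rewrite eq_y //; lia.
apply: eq_bigr => v _; congr (_ * nat_of_bool _).
apply: eq_in_all => b; rewrite mem_iota /= => b_lt; rewrite /position_bit eq_y //; last by lia.
by congr (_ == odd (_ + _)); apply: eq_big_nat => h /andP [_ hH]; rewrite eq_y //; lia.
Qed.

Lemma odd_round_sum_addb n x x' y :
  odd (round_sum n (fun v => x v (+) x' v) y) =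
  odd (round_sum n x y) (+) odd (round_sum n x' y).
Proof.
rewrite -oddD -big_split /= !odd_sum; apply: eq_bigr => w _.
rewrite -mulnDr !oddM -big_split !odd_sum; congr andb; apply: eq_bigr => v _ /=.
by rewrite -mulnDl !oddM oddD !oddb.
Qed.

End Sampler.

Definition xorf (T : finType) (f g : {ffun T -> bool}) : {ffun T -> bool} :=
  [ffun x => f x (+) g x].

Lemma xorf_inj (T : finType) (g : {ffun T -> bool}) : injective (xorf g).
Proof.
move=> f f' /ffunP eq_xor; apply/ffunP => x.
by have := eq_xor x; rewrite !ffunE => /addbI.
Qed.

(* P maps a uniform point to a uniform point, because every translation of V lifts
   to a permutation of Y. *)
Lemma sum_translation (Y V : finType) (P : Y -> V) (add : V -> V -> V)
    (F : V -> nat) :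
  (forall d, exists2 t : Y -> Y, injective t & forall y, P (t y) = add (P y) d) ->
  (forall v, injective (add v)) ->
  #|V| * \sum_y F (P y) = #|Y| * \sum_v F v.
Proof.
move=> lift_add add_inj.
transitivity (\sum_d \sum_y F (add (P y) d)).
  rewrite -sum_nat_const; apply: eq_bigr => d _.
  have [t t_inj P_t] := lift_add d; rewrite (reindex_inj t_inj) /=.
  by apply: eq_bigr => y _; rewrite P_t.
rewrite exchange_big /= -sum_nat_const; apply: eq_bigr => y _.
by rewrite [RHS](reindex_inj (@add_inj (P y))).
Qed.

Section Round.
Variables (lam H n : nat) (z : nat -> bool).
Hypotheses (H_le : H <= lam) (n_le : n <= 2 ^ lam).

Local Notation Y := {ffun 'I_lam.+1 * 'I_lam.+1 -> bool}.
Local Notation V := {ffun 'I_lam -> bool}.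

Definition round_seed (y : Y) (h b : nat) : bool := y (inord h, inord b).

Definition position (y : Y) (w : nat) : V :=
  [ffun b : 'I_lam => position_bit H (round_seed y) w b].

Definition bits (v : nat) : V := [ffun b : 'I_lam => nat_bit v b].

Definition lookup (p : V) : nat := \sum_(0 <= v < n) z v * (bits v == p).

Definition level_count h (y : Y) : nat := \sum_(w < 2 ^ h) lookup (position y w).

Definition weight : nat := \sum_(0 <= v < n) z v.

Lemma hits_position y w v : hits lam H (round_seed y) w v = (bits v == position y w).
Proof.
apply/hitsP/eqP => [hit|/ffunP eq_bits b b_lt].
  by apply/ffunP => b; rewrite !ffunE hit.
by have := eq_bits (Ordinal b_lt); rewrite !ffunE.
Qed.

Lemma round_sum_levels y : round_sum lam H n z (round_seed y) =
  \sum_(h < H.+1) round_seed y h lam * level_count h y.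
Proof.
rewrite /round_sum /coef big_mkord.
under eq_bigr => w _ do under [X in _ * X]eq_bigr => v _ do rewrite hits_position.
under eq_bigr => w _ do rewrite big_mkord big_distrl /=.
rewrite exchange_big /=; apply: eq_bigr => h _.
rewrite /level_count -(big_mkord xpredT (fun w => lookup (position y w))).
rewrite (big_nat_widen _ _ (2 ^ H)); last by rewrite leq_exp2l // -ltnS.
rewrite [in RHS]big_mkord [in RHS]big_mkcond [in RHS]big_distrr /=; apply: eq_bigr => w _.
by case: ltnP => _; rewrite ?mul0n ?muln0 ?mul1n.
Qed.

Lemma sum_lookup : \sum_p lookup p = weight.
Proof.
rewrite exchange_big /=; apply: eq_bigr => v _; rewrite -big_distrr /=.
rewrite (bigD1 (bits v)) //= eqxx big1 ?muln1 // => p.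
by rewrite eq_sym => /negbTE ->.
Qed.

Lemma lookup_sqr p : lookup p * lookup p = lookup p.
Proof.
suff -> : lookup p = has (fun v => z v && (bits v == p)) (iota 0 n) by rewrite mulnb andbb.
rewrite /lookup; under eq_bigr => v _ do rewrite mulnb.
rewrite /index_iota subn0 sum_le1_has ?iota_uniq // => v v'; rewrite !mem_iota /=.
move=> v_lt v'_lt /andP [_ /eqP <-] /andP [_ /eqP/ffunP eq_bits].
apply: (@nat_bit_inj lam) => [||b b_lt]; [by lia|by lia|].
by have := eq_bits (Ordinal b_lt); rewrite !ffunE.
Qed.

Lemma position_xor y d w : position (xorf d y) w = xorf (position y w) (position d w).
Proof.
apply/ffunP => b; rewrite !ffunE /position_bit !oddD !oddb !odd_sum /round_seed ffunE.
under eq_bigr => h _ do rewrite ffunE oddM !oddb andb_addr.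
rewrite big_split /=; under [in RHS]eq_bigr => h _ do rewrite oddM !oddb.
under [X in _ = _ (+) (_ (+) X)]eq_bigr => h _ do rewrite oddM !oddb.
by rewrite addbACA addbC.
Qed.

Definition offset_and_column (h : nat) (d0 d1 : V) : Y :=
  [ffun p : 'I_lam.+1 * 'I_lam.+1 =>
  if (insub (val p.2) : option 'I_lam) is Some b then
    if val p.1 == 0 then d0 b else if val p.1 == h.+1 then d1 b else false
  else false].

Lemma position_offset_and_column h d0 d1 w :
  position (offset_and_column h d0 d1) w =
  [ffun b => d0 b (+) [&& h < H, nat_bit w h & d1 b]].
Proof.
apply/ffunP => b; rewrite !ffunE /position_bit oddD oddb.
have rowE h' : h' <= lam -> round_seed (offset_and_column h d0 d1) h' b =
    if h' == 0 then d0 b else if h' == h.+1 then d1 b else false.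
  by move=> h'_le; rewrite /round_seed ffunE /= !inordK ?ltnS // 1?ltnW // valK.
rewrite rowE // odd_sum; congr addb.
under eq_big_nat => h' /andP [_ h'H] do rewrite rowE ?(leq_trans h'H) //= eqSS oddM !oddb.
case: ltnP => hH /=.
  rewrite (bigD1_seq h) ?iota_uniq ?mem_index_iota //= eqxx big1 ?addbF // => h' /negbTE ->.
  by rewrite andbF.
rewrite big1_seq // => h'; rewrite mem_index_iota => /andP [_ /andP [_ h'H]].
by rewrite ltn_eqF ?andbF // (leq_trans h'H).
Qed.

Lemma sum_lookup_position w :
  #|V| * \sum_y lookup (position y w) = #|{: Y}| * weight.
Proof.
rewrite -sum_lookup; apply: (@sum_translation _ _ (fun y => position y w) (@xorf _)).
  move=> d; exists (xorf (offset_and_column H d d)); first exact: xorf_inj.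
  move=> y; rewrite position_xor position_offset_and_column ltnn; congr xorf.
  by apply/ffunP => b; rewrite ffunE addbF.
by move=> v; exact: xorf_inj.
Qed.

(* Two different points w, w' disagree on some bit h; moving column h and the offset
   moves their positions independently. *)
Lemma sum_lookup_position_pair w w' : w < 2 ^ H -> w' < 2 ^ H -> w != w' ->
  #|V| ^ 2 * \sum_y lookup (position y w) * lookup (position y w') =
  #|{: Y}| * weight ^ 2.
Proof.
move=> w_lt w'_lt ww'.
have /existsP [[h hH] /= bit_neq] : [exists h : 'I_H, nat_bit w h != nat_bit w' h].
  apply: contraNT ww' => /existsPn bits_eq; apply/eqP.
  apply: (nat_bit_inj w_lt w'_lt) => h hH.
  by apply/eqP; move: (bits_eq (Ordinal hH)); rewrite negbK.
pose add (v d : V * V) := (xorf v.1 d.1, xorf v.2 d.2).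
have := @sum_translation _ _ (fun y => (position y w, position y w')) add
  (fun v => lookup v.1 * lookup v.2).
rewrite card_prod mulnn => ->.
- congr (_ * _); rewrite -sum_lookup expnS expn1 big_distrlr /= pair_big /=.
  by apply: eq_bigr => -[].
- case=> d d' /=.
  pose move_both := if nat_bit w h then offset_and_column h d' (xorf d d')
                    else offset_and_column h d (xorf d d').
  have bit_w' : nat_bit w' h = ~~ nat_bit w h.
    by case: (nat_bit w h) (nat_bit w' h) bit_neq => -[].
  exists (xorf move_both); first exact: xorf_inj.
  have [pos_w pos_w'] : position move_both w = d /\ position move_both w' = d'.
    split; apply/ffunP => b; rewrite /move_both; case: ifP => bit_w;
      rewrite position_offset_and_column !ffunE hH ?bit_w' bit_w /=;
      by case: (d b); case: (d' b).
  by move=> y; rewrite !position_xor pos_w pos_w'.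
- by move=> [v v'] [d d'] [d1 d1'] /= [/xorf_inj -> /xorf_inj ->].
Qed.

Section Bias.
Variable R : realFieldType.
Local Open Scope ring_scope.

Local Notation round_sign y := ((-1) ^+ round_sum lam H n z (round_seed y) : R).

Definition flip_coef h : Y := [ffun p => p == (inord h, inord lam)].

Lemma position_flip_coef h y w : position (xorf (flip_coef h) y) w = position y w.
Proof.
have row0 h' (b : 'I_lam) : round_seed (flip_coef h) h' b = false.
  rewrite /round_seed ffunE xpair_eqE [inord b == _](_ : _ = false) ?andbF //.
  by rewrite -val_eqE /= !inordK // ?ltn_eqF // ltnW // ltnS.
have pos0 : position (flip_coef h) w = [ffun=> false].
  apply/ffunP => b; rewrite !ffunE /position_bit row0 big1 // => h' _.
  by rewrite row0 muln0.
by rewrite position_xor pos0; apply/ffunP => b; rewrite !ffunE addbF.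
Qed.

Lemma level_count_flip_coef h h' y : level_count h' (xorf (flip_coef h) y) = level_count h' y.
Proof. by apply: eq_bigr => w _; rewrite position_flip_coef. Qed.

Lemma round_sign_flip_coef h y : (h <= H)%N ->
  round_sign (xorf (flip_coef h) y) = (-1) ^+ level_count h y * round_sign y.
Proof.
move=> hH; rewrite -signr_odd -[X in _ = X * _]signr_odd -[X in _ = _ * X]signr_odd -signr_addb.
congr (_ ^+ nat_of_bool _); rewrite !round_sum_levels -oddD.
have h_lt : (h < H.+1)%N by [].
rewrite (bigD1 (Ordinal h_lt)) //= [in RHS](bigD1 (Ordinal h_lt)) //=.
rewrite addnA !oddD !level_count_flip_coef /round_seed ffunE [flip_coef h _](_ : _ = true);
  last by rewrite ffunE eqxx.
congr addb; first by rewrite !oddM !oddb; case: (y _); case: (odd _).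
congr odd; apply: eq_bigr => h' h'h; rewrite level_count_flip_coef.
congr (nat_of_bool _ * _)%N; rewrite ffunE [flip_coef h _](_ : _ = false) // ffunE xpair_eqE.
apply/negbTE; rewrite negb_and -val_eqE /= !inordK ?ltnS ?(leq_trans hH) //.
  by rewrite -[_ == h]/(h' == Ordinal h_lt) h'h.
by apply: leq_trans H_le; rewrite -ltnS.
Qed.

Lemma sum_round_sign_odd h : (h <= H)%N ->
  \sum_(y : Y | odd (level_count h y)) round_sign y = 0.
Proof.
move=> hH; suff neg : \sum_(y : Y | odd (level_count h y)) round_sign y =
    - \sum_(y : Y | odd (level_count h y)) round_sign y by lra.
rewrite {1}(reindex_inj (@xorf_inj _ (flip_coef h))) /= -sumrN.
rewrite (eq_bigl (fun y => odd (level_count h y))) => [|y]; last by rewrite level_count_flip_coef.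
by apply: eq_bigr => y od; rewrite round_sign_flip_coef // -signr_odd od expr1 mulN1r.
Qed.

Lemma sum_round_sign_le h : (h <= H)%N ->
  `|\sum_(y : Y) round_sign y| <= (\sum_(y : Y) ~~ odd (level_count h y))%:R.
Proof.
move=> hH; rewrite (bigID (fun y => odd (level_count h y))) /= sum_round_sign_odd // add0r.
apply: le_trans (ler_norm_sum _ _ _) _; rewrite natr_sum big_mkcond /=.
apply: ler_sum => y _; case: (odd _) => //=.
by rewrite normrX normrN1 expr1n.
Qed.

Local Notation density := (weight%:R / (2 ^ lam)%:R : R).

Lemma exp2_lam_gt0 : 0 < (2 ^ lam)%:R :> R.
Proof. by rewrite ltr0n expn_gt0. Qed.

Lemma lookup_mean w : (\sum_(y : Y) lookup (position y w))%:R = #|{: Y}|%:R * density.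
Proof.
have lam0 := lt0r_neq0 exp2_lam_gt0; apply: (mulfI lam0).
have := congr1 (fun k => k%:R : R) (sum_lookup_position w).
rewrite card_ffun card_bool card_ord !natrM => ->.
by field.
Qed.

Lemma lookup_pair_mean w w' : (w < 2 ^ H)%N -> (w' < 2 ^ H)%N -> w != w' ->
  (\sum_(y : Y) lookup (position y w) * lookup (position y w'))%:R =
  #|{: Y}|%:R * density ^+ 2.
Proof.
move=> w_lt w'_lt ww'; have lam0 := lt0r_neq0 exp2_lam_gt0.
apply: (mulfI (expf_neq0 2 lam0)).
have := congr1 (fun k => k%:R : R) (sum_lookup_position_pair w_lt w'_lt ww').
rewrite card_ffun card_bool card_ord !natrM !natrX => pair_eq.
by rewrite pair_eq; field; rewrite -natrX.
Qed.

Lemma level_count_mean h : (\sum_(y : Y) level_count h y)%:R =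
  #|{: Y}|%:R * ((2 ^ h)%:R * density).
Proof.
rewrite exchange_big /= natr_sum; under eq_bigr => w _ do rewrite lookup_mean.
by rewrite sumr_const card_ord -mulr_natl; ring.
Qed.

Lemma level_count_sqr_mean h : (h <= H)%N ->
  (\sum_(y : Y) level_count h y ^ 2)%:R =
  #|{: Y}|%:R * ((2 ^ h)%:R * density + (2 ^ h)%:R * ((2 ^ h)%:R - 1) * density ^+ 2).
Proof.
move=> hH; have w_lt (w : 'I_(2 ^ h)) : (w < 2 ^ H)%N.
  by apply: leq_trans (ltn_ord w) _; rewrite leq_exp2l.
under eq_bigr => y _ do rewrite -mulnn big_distrlr /=.
rewrite exchange_big /= natr_sum; set T := (2 ^ h)%:R.
rewrite (eq_bigr (fun=> #|{: Y}|%:R * (density + (T - 1) * density ^+ 2))) => [|w _].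
  by rewrite sumr_const card_ord -mulr_natl -/T; ring.
rewrite exchange_big /= (bigD1 w) //= natrD.
under eq_bigr => y _ do rewrite lookup_sqr.
rewrite lookup_mean natr_sum.
under eq_bigr => w' w'w do rewrite (lookup_pair_mean (w_lt w) (w_lt w')) 1?eq_sym //.
have card_others : T = (#|[pred w' : 'I_(2 ^ h) | w' != w]|.+1)%:R.
  rewrite /T -[in LHS](card_ord (2 ^ h)) (cardD1 w) inE add1n; congr (_.+1%:R).
  by apply: eq_card => i; rewrite !inE andbT.
by rewrite sumr_const -mulr_natl card_others -natr1; ring.
Qed.

Lemma odd_ge_quadratic (k : nat) : 2 * k%:R - k%:R ^+ 2 <= (odd k)%:R :> R.
Proof.
case: k => [|[|[|k]]]; rewrite ?odd0 /=; try lra.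
apply: le_trans (ler0n _ _); have : (3%:R : R) <= k.+3%:R by rewrite ler_nat.
by move: (k.+3%:R : R) => r; nra.
Qed.

Lemma odd_level_ge h : (h <= H)%N ->
  #|{: Y}|%:R * ((2 ^ h)%:R * density - (2 ^ h)%:R * ((2 ^ h)%:R - 1) * density ^+ 2) <=
  (\sum_(y : Y) odd (level_count h y))%:R.
Proof.
move=> hH; rewrite [X in X <= _](_ : _ =
    2 * (\sum_(y : Y) level_count h y)%:R - (\sum_(y : Y) level_count h y ^ 2)%:R).
  rewrite !natr_sum mulr_sumr -sumrB; apply: ler_sum => y _.
  by rewrite natrX odd_ge_quadratic.
by rewrite level_count_mean level_count_sqr_mean //; ring.
Qed.

(* The first level whose expected number of hits is at least 1/4; that number is at
   most 1/2 unless the level has a single point. *)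
Lemma exists_good_level : (2 ^ lam <= 2 ^ (H + 2) * weight)%N ->
  exists2 h, (h <= H)%N &
    3 / 16 <= (2 ^ h)%:R * density - (2 ^ h)%:R * ((2 ^ h)%:R - 1) * density ^+ 2.
Proof.
move=> heavy; have exists_level : exists h, (2 ^ lam <= 2 ^ (h + 2) * weight)%N by exists H.
case: (ex_minnP exists_level) => h h_heavy h_min.
exists h; first exact: h_min.
have lam_gt0 := exp2_lam_gt0; set t := density; have t_ge0 : 0 <= t by rewrite divr_ge0.
have weightE : weight%:R = (2 ^ lam)%:R * t by rewrite mulrC divfK ?gt_eqF.
have hits_ge : 1 / 4 <= (2 ^ h)%:R * t.
  rewrite -(ler_pM2l lam_gt0); move: h_heavy; rewrite -(ler_nat R) expnD -[(2 ^ 2)%N]/4%N.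
  by rewrite !natrM weightE; move: ((2 ^ h)%:R : R) ((2 ^ lam)%:R : R) lam_gt0 => T M; nra.
case: h {h_heavy} h_min hits_ge => [|h] h_min hits_ge; first by lra.
have hits_le : (2 ^ h.+1)%:R * t <= 1 / 2.
  have : (2 ^ (h + 2) * weight < 2 ^ lam)%N.
    by rewrite ltnNge; apply/negP => /h_min; rewrite ltnn.
  rewrite -(ltr_nat R) expnD -[(2 ^ 2)%N]/4%N !natrM weightE => light.
  rewrite -(ler_pM2l lam_gt0) expnS natrM; move: light.
  by move: ((2 ^ h)%:R : R) ((2 ^ lam)%:R : R) lam_gt0 => T M; nra.
have : 0 <= (2 ^ h.+1)%:R * t ^+ 2 by rewrite mulr_ge0 ?ler0n ?sqr_ge0.
move: ((2 ^ h.+1)%:R : R) hits_ge hits_le => T hits_ge hits_le Tt2_ge0.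
rewrite (_ : T * t - T * (T - 1) * t ^+ 2 = T * t - (T * t) ^+ 2 + T * t ^+ 2); last by ring.
by move: (T * t) hits_ge hits_le => s; nra.
Qed.

Lemma round_bias : (2 ^ lam <= 2 ^ (H + 2) * weight)%N ->
  `|\sum_(y : Y) round_sign y| <= 13 / 16 * #|{: Y}|%:R.
Proof.
move=> /exists_good_level [h hH good]; apply: le_trans (sum_round_sign_le hH) _.
have odd_ge : 3 / 16 * #|{: Y}|%:R <= (\sum_(y : Y) odd (level_count h y))%:R :> R.
  by apply: le_trans (odd_level_ge hH); rewrite mulrC ler_wpM2l.
have : (\sum_(y : Y) ~~ odd (level_count h y))%:R +
       (\sum_(y : Y) odd (level_count h y))%:R = #|{: Y}|%:R :> R.
  rewrite -natrD -big_split /= -sum1_card; congr _%:R.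
  by apply: eq_bigr => y _; case: (odd _).
by lra.
Qed.

End Bias.
End Round.

Section Rounds.
Variables (R : realFieldType) (lam H L n : nat).
Hypotheses (H_le : H <= lam) (n_le : n <= 2 ^ lam).
Local Notation U := ('I_L * ('I_lam.+1 * 'I_lam.+1))%type.
Local Notation Y := {ffun 'I_lam.+1 * 'I_lam.+1 -> bool}.
Local Open Scope ring_scope.

Definition seed_fun (y : {ffun U -> bool}) (i h b : nat) : bool :=
  if (insub i : option 'I_L) is Some i' then y (i', (inord h, inord b)) else false.

Definition round_of (y : {ffun U -> bool}) (i : 'I_L) : Y := [ffun p => y (i, p)].

Lemma sign_one_bit x y : (-1) ^+ one_bit lam H L n x (seed_fun y) =
  \prod_(i < L) (-1) ^+ round_sum lam H n x (round_seed (round_of y i)) :> R.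
Proof.
rewrite /one_bit signr_odd big_mkord -expr_sum; congr (_ ^+ _).
apply: eq_bigr => i _; congr round_sum; apply/funext => h; apply/funext => b.
by rewrite /seed_fun valK /round_seed ffunE.
Qed.

Lemma sum_prod_rounds (F : Y -> R) :
  \sum_(y : {ffun U -> bool}) \prod_(i < L) F (round_of y i) = (\sum_(y : Y) F y) ^+ L.
Proof.
rewrite -[in RHS](card_ord L) -prodr_const bigA_distr_bigA /=.
pose uncurry (g : {ffun 'I_L -> Y}) : {ffun U -> bool} := [ffun u => g u.1 u.2].
have uncurry_bij : bijective uncurry.
  exists (fun y => [ffun i => round_of y i]) => [g|y].
    by apply/ffunP => i; apply/ffunP => p; rewrite !ffunE.
  by apply/ffunP => -[i p]; rewrite !ffunE.
rewrite (reindex _ (onW_bij _ uncurry_bij)) /=; apply: eq_bigr => g _; apply: eq_bigr => i _.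
by congr F; apply/ffunP => p; rewrite !ffunE.
Qed.

Lemma one_bit_correlation x x' :
  (2 ^ lam <= 2 ^ (H + 2) * \sum_(0 <= v < n) (x v (+) x' v))%N ->
  \sum_(y : {ffun U -> bool}) (-1) ^+ one_bit lam H L n x (seed_fun y) *
     (-1) ^+ one_bit lam H L n x' (seed_fun y) <=
  (13 / 16) ^+ L * #|{: {ffun U -> bool}}|%:R :> R.
Proof.
move=> far; set z := fun v => x v (+) x' v.
have -> : \sum_(y : {ffun U -> bool}) (-1) ^+ one_bit lam H L n x (seed_fun y) *
     (-1) ^+ one_bit lam H L n x' (seed_fun y) =
   (\sum_(y : Y) (-1) ^+ round_sum lam H n z (round_seed y)) ^+ L :> R.
  rewrite -sum_prod_rounds; apply: eq_bigr => y _; rewrite !sign_one_bit -big_split /=.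
  apply: eq_bigr => i _; rewrite -signr_odd -[X in _ * X = _]signr_odd -signr_addb.
  by rewrite -odd_round_sum_addb signr_odd.
apply: le_trans (ler_norm _) _; rewrite normrX.
have -> : #|{: {ffun U -> bool}}| = (#|{: Y}| ^ L)%N.
  by rewrite !card_ffun !card_prod !card_ord card_bool -expnM [(L * _)%N]mulnC.
rewrite natrX -exprMn; apply: lerXn2r; last exact: round_bias.
  by rewrite nnegrE.
by rewrite nnegrE mulr_ge0.
Qed.

End Rounds.

(** * The extractor and its explicitness *)

(* A and B bound the constants hidden in k = Theta(n / log^c n) and in the exponent
   Theta(log^a n) of the error; the output length is about n^(1/k0). *)
Section Construction.
Variables (a c A B k0 : nat).

Definition rounds n := 8 * B * bitlen n ^ a.
Definition log_window n := minn (bitlen (A * bitlen n ^ c.+1)) (bitlen n).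
Definition bit_seed_len n := rounds n * (bitlen n).+1 ^ 2.
Definition seed_width n := prime_range (bit_seed_len n).
Definition seed_len n := bit_seed_len n * seed_width n.
Definition out_len n := 2 ^ (bitlen n %/ k0) * bitlen n ^ a.

Definition bit_seed_idx n i h b := (i * (bitlen n).+1 + h) * (bitlen n).+1 + b.
(* Cell (u, j mod p_u) of an array of [bit_seed_len n] rows. *)
Definition design_idx n j u :=
  u * seed_width n + j %% nth_prime (seed_width n) u.

Definition out_bit n (x : nat -> bool) (r : nat -> bool) j : bool :=
  one_bit (bitlen n) (log_window n) (rounds n) n x
    (fun i h b => r (design_idx n j (bit_seed_idx n i h b))).

Definition local_ext : ext_family seed_len out_len := fun n x r =>
  [tuple out_bit n (nth false x) (nth false r) j | j < out_len n].

Lemma tnth_local_ext n x r j :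
  tnth (local_ext (n := n) x r) j = out_bit n (nth false x) (nth false r) j.
Proof. by rewrite tnth_mktuple. Qed.

Lemma log_window_le n : log_window n <= bitlen n.
Proof. exact: geq_minr. Qed.

Lemma bit_seed_idx_lt n i h b : i < rounds n -> h <= bitlen n -> b <= bitlen n ->
  bit_seed_idx n i h b < bit_seed_len n.
Proof.
by rewrite /bit_seed_idx /bit_seed_len -mulnn; move: (bitlen n) (rounds n) => l L; nia.
Qed.

Lemma design_prime n u : u < bit_seed_len n ->
  [/\ prime (nth_prime (seed_width n) u), nth_prime (seed_width n) u < seed_width n
    & prime_count (nth_prime (seed_width n) u) = u].
Proof. by move=> u_lt; apply: nth_primeP; exact: leq_trans u_lt (prime_range_count _). Qed.

Lemma design_idx_lt n j u : u < bit_seed_len n -> design_idx n j u < seed_len n.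
Proof.
move=> u_lt; have [p_prime p_lt _] := design_prime u_lt; rewrite /design_idx /seed_len.
have r_lt := ltn_trans (ltn_pmod j (prime_gt0 p_prime)) p_lt.
apply: leq_trans (_ : u.+1 * seed_width n <= _); last by rewrite leq_mul2r u_lt orbT.
by rewrite mulSn addnC ltn_add2r.
Qed.

Definition is_one (s : symbol) : bool := if s is Bit b then b else false.

Section Definable.
Implicit Types N J I W : seq symbol -> (nat -> nat) -> nat.

Lemma definable_bitlen_exp N e : definable N ->
  definable (fun inp env => bitlen (N inp env) ^ e).
Proof. by move=> N_def; exact/definable_exp/definable_bitlen. Qed.

Lemma definable_rounds N : definable N -> definable (fun inp env => rounds (N inp env)).
Proof.
by move=> N_def; exact: definable_mul (definable_const _) (definable_bitlen_exp _ N_def).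
Qed.

Lemma definable_log_window N : definable N ->
  definable (fun inp env => log_window (N inp env)).
Proof.
move=> N_def; apply: definable_min (definable_bitlen N_def); apply: definable_bitlen.
exact: definable_mul (definable_const _) (definable_bitlen_exp _ N_def).
Qed.

Lemma definable_seed_width N : definable N ->
  definable (fun inp env => seed_width (N inp env)).
Proof.
move=> N_def; apply/definable_prime_range/(definable_mul (definable_rounds N_def)).
exact/definable_exp/definable_succ/definable_bitlen.
Qed.

Lemma definable_out_len N : definable N -> definable (fun inp env => out_len (N inp env)).
Proof.
move=> N_def; apply: definable_mul (definable_bitlen_exp _ N_def).
apply: definable_ext (definable_exp2_bitlen
  (definable_div (definable_bitlen N_def) (definable_const k0)) N_def) _ => inp env.
by rewrite (minn_idPl (leq_div _ _)).
Qed.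

Definition seed_cell (inp : seq symbol) n j i h b : bool :=
  is_one (nth Blank inp (n.+1 + design_idx n j (bit_seed_idx n i h b))).

Lemma definable_seed_cell N J I H P :
  definable N -> definable J -> definable I -> definable H -> definable P ->
  definable (fun inp env => seed_cell inp (N inp env) (J inp env) (I inp env)
                              (H inp env) (P inp env)).
Proof.
move=> N_def J_def I_def H_def P_def; have l_def := definable_succ (definable_bitlen N_def).
have idx_def := definable_add
  (definable_mul (definable_add (definable_mul I_def l_def) H_def) l_def) P_def.
have width_def := definable_seed_width N_def.
apply/definable_inp/(definable_add (definable_succ N_def))/definable_add.
  exact: definable_mul idx_def width_def.
exact: definable_mod J_def (definable_nth_prime width_def idx_def).
Qed.

Lemma definable_position_bit N J I W P :
  definable N -> definable J -> definable I -> definable W -> definable P ->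
  definable (fun inp env => position_bit (log_window (N inp env))
    (seed_cell inp (N inp env) (J inp env) (I inp env)) (W inp env) (P inp env)).
Proof.
move=> N_def J_def I_def W_def P_def; apply/definable_odd/definable_add.
  exact: definable_seed_cell (definable_const 0) _.
apply: (definable_sum (G := fun inp env h => nat_bit (W inp env) h *
  seed_cell inp (N inp env) (J inp env) (I inp env) h.+1 (P inp env))).
  exact: definable_log_window.
apply: definable_mul; first exact: definable_nat_bit (definable_weaken W_def) (definable_var 0).
apply: definable_seed_cell; try exact: definable_weaken.
exact: definable_succ (definable_var 0).
Qed.

Lemma definable_hits N J I W V :
  definable N -> definable J -> definable I -> definable W -> definable V ->
  definable (fun inp env => hits (bitlen (N inp env)) (log_window (N inp env))
    (seed_cell inp (N inp env) (J inp env) (I inp env)) (W inp env) (V inp env)).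
Proof.
move=> N_def J_def I_def W_def V_def; apply: (definable_all (P := fun inp env b =>
  nat_bit (V inp env) b == position_bit (log_window (N inp env))
    (seed_cell inp (N inp env) (J inp env) (I inp env)) (W inp env) b)).
  exact: definable_bitlen.
apply: definable_ext (definable_eq
  (definable_nat_bit (definable_weaken V_def) (definable_var 0))
  (definable_position_bit (definable_weaken N_def) (definable_weaken J_def)
     (definable_weaken I_def) (definable_weaken W_def) (definable_var 0))) _ => inp env.
by case: (nat_bit _ _); case: position_bit.
Qed.

Lemma definable_coef N J I W :
  definable N -> definable J -> definable I -> definable W ->
  definable (fun inp env => coef (bitlen (N inp env)) (log_window (N inp env))
    (seed_cell inp (N inp env) (J inp env) (I inp env)) (W inp env)).
Proof.
move=> N_def J_def I_def W_def; apply: (definable_sum (G := fun inp env h =>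
  (W inp env < 2 ^ h) *
  seed_cell inp (N inp env) (J inp env) (I inp env) h (bitlen (N inp env)))).
  exact: definable_succ (definable_log_window N_def).
apply: definable_mul.
  apply: definable_ext (definable_eq (definable_div_exp2 (definable_weaken W_def)
    (definable_var 0)) (definable_const 0)) _ => inp env.
  by rewrite -leqn0 -ltnS ltn_divLR ?expn_gt0 // mul1n.
apply: definable_seed_cell; try exact: definable_weaken; first exact: definable_var.
exact: definable_bitlen (definable_weaken N_def).
Qed.

Lemma definable_round_sum N J I :
  definable N -> definable J -> definable I ->
  definable (fun inp env => round_sum (bitlen (N inp env)) (log_window (N inp env))
    (N inp env) (fun v => is_one (nth Blank inp v))
    (seed_cell inp (N inp env) (J inp env) (I inp env))).
Proof.
move=> N_def J_def I_def; apply: (definable_sum (G := fun inp env w =>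
  coef (bitlen (N inp env)) (log_window (N inp env))
    (seed_cell inp (N inp env) (J inp env) (I inp env)) w *
  \sum_(0 <= v < N inp env) is_one (nth Blank inp v) *
    hits (bitlen (N inp env)) (log_window (N inp env))
      (seed_cell inp (N inp env) (J inp env) (I inp env)) w v)).
  apply: definable_ext (definable_exp2_bitlen (definable_log_window N_def) N_def) _ => inp env.
  by rewrite (minn_idPl _) // geq_minr.
have [N1_def J1_def I1_def] := And3 (definable_weaken N_def) (definable_weaken J_def)
  (definable_weaken I_def).
apply: definable_mul; first exact: definable_coef (definable_var 0).
apply: (definable_sum (G := fun inp env v => is_one (nth Blank inp v) *
    hits (bitlen (N inp (env \o succn))) (log_window (N inp (env \o succn)))
      (seed_cell inp (N inp (env \o succn)) (J inp (env \o succn)) (I inp (env \o succn)))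
      (env 0) v)) => //.
apply: definable_mul; first exact: definable_inp (definable_var 0).
exact: (definable_hits (definable_weaken N1_def) (definable_weaken J1_def)
  (definable_weaken I1_def) (definable_var 1) (definable_var 0)).
Qed.

Lemma definable_out_bit N J : definable N -> definable J ->
  definable (fun inp env => out_bit (N inp env) (fun v => is_one (nth Blank inp v))
     (fun t => is_one (nth Blank inp ((N inp env).+1 + t))) (J inp env)).
Proof.
move=> N_def J_def; apply: definable_odd; apply: (definable_sum (G := fun inp env i =>
  round_sum (bitlen (N inp env)) (log_window (N inp env)) (N inp env)
    (fun v => is_one (nth Blank inp v))
    (seed_cell inp (N inp env) (J inp env) i))); first exact: definable_rounds.
exact: definable_round_sum (definable_weaken N_def) (definable_weaken J_def) (definable_var 0).
Qed.

End Definable.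

Section TMInput.
Variables x r : seq bool.
Let inp := map Bit x ++ Sep :: map Bit r.

Lemma nth_input_source v : v < size x -> nth Blank inp v = Bit (nth false x v).
Proof. by move=> v_lt; rewrite nth_cat size_map v_lt (nth_map false). Qed.

Lemma nth_input_sep : nth Blank inp (size x) = Sep.
Proof. by rewrite nth_cat size_map ltnn subnn. Qed.

Lemma nth_input_seed t : nth Blank inp ((size x).+1 + t) = nth Blank (map Bit r) t.
Proof. by rewrite addSnnS nth_cat size_map ltnNge leq_addr /= addKn. Qed.

Lemma is_one_input_seed t : is_one (nth Blank inp ((size x).+1 + t)) = nth false r t.
Proof.
rewrite nth_input_seed; have [t_lt|t_ge] := ltnP t (size r); first by rewrite (nth_map false).
by rewrite !nth_default ?size_map.
Qed.

Lemma sum_sep_input : \sum_(0 <= i < size inp) i * is_sep (nth Blank inp i) = size x.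
Proof.
have size_inp : size inp = (size x).+1 + size r by rewrite size_cat /= !size_map addnS addSn.
rewrite (bigD1_seq (size x)) ?iota_uniq ?mem_index_iota //= ?size_inp ?ltnS ?leq_addr //.
rewrite nth_input_sep muln1 big1_seq ?addn0 // => i /andP [i_neq].
rewrite mem_index_iota => i_lt; have [i_lt_x|x_le] := ltnP i (size x).
  by rewrite nth_input_source // muln0.
have -> : i = (size x).+1 + (i - (size x).+1) by lia.
by rewrite nth_input_seed (nth_map false) ?muln0 //; lia.
Qed.

End TMInput.

Theorem local_ext_explicit : explicit local_ext.
Proof.
have n_def : definable (fun inp env => \sum_(0 <= i < env 1) i * is_sep (nth Blank inp i)).
  apply: (definable_sum (G := fun inp _ i => i * is_sep (nth Blank inp i)) (definable_var 1)).
  exact: definable_mul (definable_var 0) (definable_inp _ (definable_var 0)).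
have [e_len eval_len] := definable_out_len n_def.
have [e_bit eval_bit] := definable_out_bit n_def (definable_var 0).
apply: (@explicit_of_expr _ _ _ e_len e_bit) => n x r inp.
have sum_n : \sum_(0 <= i < size inp) i * is_sep (nth Blank inp i) = n.
  by rewrite sum_sep_input size_tuple.
rewrite eval_len sum_n; split=> // j; rewrite eval_bit /scons sum_n tnth_local_ext eqb0 negbK.
rewrite /out_bit (@eq_one_bit_source _ _ _ _ _ (nth false x)) => [|i w v _ _ v_lt _].
  congr one_bit; apply/funext => i; apply/funext => h; apply/funext => b.
  by rewrite -[n in n.+1](size_tuple x) is_one_input_seed.
by rewrite nth_input_source ?size_tuple.
Qed.

End Construction.

(** * The extractor in AC0 *)

Lemma count_enum (T : finType) (P : pred T) : count P (enum T) = \sum_x P x.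
Proof. by rewrite -sum1_count big_enum_cond big_mkcond /=; apply: eq_bigr => x _; case: (P x). Qed.

Definition position_rows H w : seq 'I_H.+1 :=
  [seq h : 'I_H.+1 <- enum 'I_H.+1 | (h == ord0) || nat_bit w h.-1].

Lemma position_bit_rows H y w b :
  position_bit H y w b = odd (count (fun h : 'I_H.+1 => y h b) (position_rows H w)).
Proof.
rewrite /position_rows count_filter count_enum big_ord_recl /= andbT /position_bit big_mkord.
by congr (odd (_ + _)); apply: eq_bigr => h _; rewrite mulnb andbC.
Qed.

Definition hit_size lam := (lam.+1 * (parity_size lam.+1 0).+1).+1.
Definition lookup_size n lam := (n * hit_size lam).+1.
Definition term_size n lam := (2 * lookup_size n lam).+1.

Section AC0.
Variables (a c A B k0 : nat).
Local Notation rounds := (rounds a B).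
Local Notation log_window := (log_window c A).
Local Notation seed_len := (seed_len a B).
Local Notation out_len := (out_len a k0).
Local Notation local_ext := (@local_ext a c A B k0).

Section OutputBit.
Variables (n j : nat).
Let lam := bitlen n.
Let H := log_window n.
Let L := rounds n.
Let N := n + seed_len n.

Definition seed_of (inp : seq bool) i h b :=
  nth false inp (n + design_idx a B n j (bit_seed_idx n i h b)).

Lemma formula_seed D S i h b : i < L -> h <= lam -> b <= lam ->
  formula_for N D S (fun inp => seed_of inp i h b).
Proof.
move=> iL h_le b_le; apply: formula_var; rewrite ltn_add2l.
by apply: design_idx_lt; exact: bit_seed_idx_lt.
Qed.

Lemma formula_position_bit i w b : i < L -> b <= lam ->
  formula_for N 3 (parity_size lam.+1 0) (fun inp => position_bit H (seed_of inp i) w b).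
Proof.
move=> iL b_le; apply: formula_ext (formula_parity_dnf (D := 0) (S := 0)
  (s := position_rows H w) (F := fun h inp => seed_of inp i h b) (g := lam.+1) _ _) _ => [|h|inp].
- rewrite size_filter (leq_trans (count_size _ _)) // size_enum_ord ltnS; exact: log_window_le.
- apply: formula_seed => //; apply: leq_trans (log_window_le c A n); rewrite -ltnS; exact: ltn_ord.
- by rewrite position_bit_rows.
Qed.

Lemma formula_hit i w v : i < L -> v < n -> formula_for N 5 (hit_size lam)
  (fun inp => nth false inp v && hits lam H (seed_of inp i) w v).
Proof.
move=> iL vn; pose test (b : option 'I_lam) inp :=
  if b is Some b' then nat_bit v b' == position_bit H (seed_of inp i) w b'
  else nth false inp v.
have test_formula b : formula_for N 4 (parity_size lam.+1 0).+1 (test b).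
  case: b => [b|]; last by apply: formula_var; rewrite /N; lia.
  by apply/formula_eqb/formula_position_bit => //; exact: ltnW.
apply: formula_ext (formula_and (s := None :: map Some (enum 'I_lam)) _ test_formula) _ => [|inp].
  by rewrite /= size_map size_enum_ord.
by rewrite /= all_map /hits -val_enum_ord all_map.
Qed.

Lemma formula_lookup i w : i < L -> formula_for N 6 (lookup_size n lam)
  (fun inp => has (fun v => nth false inp v && hits lam H (seed_of inp i) w v) (iota 0 n)).
Proof.
move=> iL; apply: formula_ext (formula_or (s := enum 'I_n) _
  (fun v : 'I_n => formula_hit w iL (ltn_ord v))) _ => [|inp].
  by rewrite size_enum_ord.
by rewrite -val_enum_ord has_map.
Qed.

Definition term (p : 'I_L * 'I_(2 ^ H) * 'I_H.+1) inp : bool :=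
  [&& p.1.2 < 2 ^ p.2, seed_of inp p.1.1 p.2 lam &
      has (fun v => nth false inp v && hits lam H (seed_of inp p.1.1) p.1.2 v) (iota 0 n)].

Lemma formula_term p : formula_for N 7 (term_size n lam) (term p).
Proof.
rewrite /term; case: (_ < _); last exact: formula_false.
pose factor (b : bool) inp := if b then seed_of inp p.1.1 p.2 lam else
  has (fun v => nth false inp v && hits lam H (seed_of inp p.1.1) p.1.2 v) (iota 0 n).
have factor_formula b : formula_for N 6 (lookup_size n lam) (factor b).
  case: b; last exact: formula_lookup.
  by apply: formula_seed => //; apply: leq_trans (log_window_le c A n); rewrite -ltnS ltn_ord.
apply: formula_ext (formula_and (s := [:: true; false]) (ltnSn _) factor_formula) _ => inp.
by rewrite /= andbT.
Qed.

Lemma one_bit_terms inp : one_bit lam H L n (nth false inp) (seed_of inp) =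
  odd (count (term^~ inp) (enum {: 'I_L * 'I_(2 ^ H) * 'I_H.+1})).
Proof.
rewrite /one_bit count_enum big_mkord; congr odd.
transitivity (\sum_(i < L) \sum_(w < 2 ^ H) \sum_(h < H.+1) (term (i, w, h) inp : nat)).
  apply: eq_bigr => i _; rewrite /round_sum big_mkord; apply: eq_bigr => w _.
  rewrite sum_hits; last by apply/ltnW; exact: bitlen_gt.
  rewrite /coef big_mkord big_distrl /=; apply: eq_bigr => h _.
  by rewrite /term /= -mulnA !mulnb.
by rewrite pair_big /= pair_big /=; apply: eq_bigr => -[[i w] h].
Qed.

Lemma formula_one_bit g q : L * 2 ^ H * H.+1 <= g ^ q ->
  formula_for N (8 + 3 * q) (iter q (parity_size g) (term_size n lam).+1)
    (fun inp => one_bit lam H L n (nth false inp) (seed_of inp)).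
Proof.
move=> count_le; apply: formula_ext (formula_parity
  (s := enum {: 'I_L * 'I_(2 ^ H) * 'I_H.+1}) _ formula_term) _ => [|inp].
  by rewrite -cardE !card_prod !card_ord.
by rewrite one_bit_terms.
Qed.

End OutputBit.

Definition parity_base := (8 * B * (2 * A + 1)).+1.

Lemma term_count_le n : rounds n * 2 ^ log_window n * (log_window n).+1 <=
  (parity_base * (bitlen n).+1) ^ (a + c + 2).
Proof.
set l := bitlen n.
have rounds_le : rounds n <= 8 * B * l.+1 ^ a by rewrite leq_mul // leq_expn2r.
have window_le : 2 ^ log_window n <= (2 * A + 1) * l.+1 ^ c.+1.
  apply: leq_trans (_ : 2 ^ bitlen (A * l ^ c.+1) <= _); first by rewrite leq_exp2l // geq_minl.
  apply: leq_trans (bitlen_le _) _; have := leq_expn2r c.+1 (leqnSn l).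
  have : 0 < l.+1 ^ c.+1 by rewrite expn_gt0.
  by move: (l ^ _) (l.+1 ^ _) => P Q; nia.
apply: leq_trans (leq_mul (leq_mul rounds_le window_le) (_ : _ <= l.+1)) _.
  by rewrite ltnS log_window_le.
rewrite expnMn (_ : _ * l.+1 = 8 * B * (2 * A + 1) * l.+1 ^ (a + c + 2)).
  rewrite leq_mul2r; apply/orP; right; apply: leq_trans (leqnSn _) _.
  by rewrite -/parity_base addn2 expnS leq_pmulr // expn_gt0.
by rewrite -addnA addn2 expnD !expnSr; move: (l.+1 ^ a) (l.+1 ^ c) => P Q; nia.
Qed.

Definition circuit_size n := out_len n * iter (a + c + 2)
  (parity_size (parity_base * (bitlen n).+1)) (term_size n (bitlen n)).+1.

Lemma circuit_size_poly : poly_bounded circuit_size.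
Proof.
set q := a + c + 2; have const := poly_bounded_const; have exp2_poly := exp2_bitlen_poly.
have lenS_poly := poly_bounded_succ bitlen_poly.
have parity_poly : poly_bounded (fun n => parity_size (bitlen n).+1 0).
  apply: poly_bounded_le (poly_bounded_succ (poly_bounded_mul
    (poly_bounded_mul (const 2) exp2_poly) (poly_bounded_succ lenS_poly))) _ => n.
  by rewrite /parity_size expnS muln1.
have term_poly : poly_bounded (fun n => term_size n (bitlen n)).
  apply/poly_bounded_succ/(poly_bounded_mul (const 2))/poly_bounded_succ.
  apply/(poly_bounded_mul poly_bounded_id)/poly_bounded_succ/(poly_bounded_mul lenS_poly).
  exact: poly_bounded_succ.
apply: poly_bounded_mul.
  apply: poly_bounded_mul (poly_bounded_exp a bitlen_poly).
  by apply: poly_bounded_le exp2_poly _ => n; rewrite leq_exp2l // leq_div.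
apply: poly_bounded_le (poly_bounded_mul (poly_bounded_mul
  (poly_bounded_exp (2 * parity_base * q) exp2_poly) (const (2 ^ ((2 * parity_base + 2) * q))))
  (poly_bounded_succ (poly_bounded_succ term_poly))) _ => n.
apply: leq_trans (leqnSn _) _; apply: leq_trans (parity_size_iter_le _ _ _) _.
rewrite leq_mul2r; apply/orP; right.
rewrite -expnM -expnD leq_exp2l // mulnS mulnA mulnDr; lia.
Qed.

Theorem local_ext_AC0 : computable_in_AC0 (3 * (a + c) + 14) local_ext.
Proof.
have [e size_le] := circuit_size_poly.
exists ((2 * 2) ^ e), e => n.
have [ci [ci_wf ci_size ci_depth ci_eval]] :=
  formula_circuit (fun j : 'I_(out_len n) => formula_one_bit j (term_count_le n)).
exists ci; split=> //.
- apply: leq_trans ci_size _; apply: leq_trans (size_le n) _.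
  by apply: leq_trans (leq_poly_bound _ _ _); apply: leq_expn2r; lia.
- by apply: leq_trans ci_depth _; lia.
- move=> x r; rewrite ci_eval ?size_cat ?size_tuple //.
  rewrite -[RHS](map_tnth_enum (local_ext x r)); apply: eq_map => j.
  rewrite tnth_local_ext /out_bit (@eq_one_bit_source _ _ _ _ _ (nth false x)).
    congr one_bit; apply/funext => i; apply/funext => h; apply/funext => b.
    by rewrite /seed_of nth_cat size_tuple ltnNge leq_addr /= addKn.
  by move=> i w v _ _ v_lt _; rewrite nth_cat size_tuple v_lt.
Qed.

End AC0.

(** * The extractor property and the locality *)

Lemma card_small_sets (T : finType) W : #|[set S : {set T} | #|S| <= W]| <= #|T|.+1 ^ W.
Proof.
pose support (t : W.-tuple (option T)) : {set T} := [set x | Some x \in t].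
have -> : #|T|.+1 ^ W = #|{: W.-tuple (option T)}| by rewrite card_tuple card_option.
apply: leq_trans (leq_imset_card support _); apply: subset_leq_card.
apply/fintype.subsetP => S; rewrite inE => S_le.
have padded_size : size (map Some (enum S) ++ nseq (W - #|S|) None) == W.
  by rewrite size_cat size_map -cardE size_nseq subnKC.
apply/imsetP; exists (Tuple padded_size) => //; apply/setP => x.
rewrite inE /= mem_cat mem_nseq andbF orbF mem_map; last by move=> ? ? [].
by rewrite mem_enum.
Qed.

Section MinEntropy.
Variable R : realType.
Local Open Scope ring_scope.

Lemma ln2_gt0 : 0 < ln 2 :> R.
Proof. by rewrite ln_gt0 // ltr1n. Qed.

Lemma is_source_le n (k : R) (X : {ffun n.-tuple bool -> R}) :
  is_source k X -> forall x, X x <= 2 `^ (- k).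
Proof.
move=> [[X_ge0 X_sum] k_le] x.
have [x_gt0|x_le0] := ltP 0 (X x); last by apply: le_trans x_le0 _; exact: powR_ge0.
have X_le1 y : X y <= 1.
  by rewrite -X_sum (bigD1 y) //= lerDl; apply: sumr_ge0.
have : k <= log2 (X x)^-1.
  apply: le_trans k_le _; apply: ge_inf; last by exists x.
  exists 0 => _ [y /= y_gt0 <-]; apply: divr_ge0; last exact/ltW/ln2_gt0.
  by apply: ln_ge0; rewrite invf_ge1.
rewrite /log2 ler_pdivlMr ?ln2_gt0 // lnV // => k_ln2_le.
rewrite -(lnK (x_gt0 : X x \is Num.pos)) /powR pnatr_eq0 /= ler_expR; lra.
Qed.

End MinEntropy.

Section Strong.
Variables (R : realType) (a c A B k0 n : nat).
Local Notation lam := (bitlen n).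
Local Notation H := (log_window c A n).
Local Notation L := (rounds a B n).
Local Notation d := (seed_len a B n).
Local Notation m := (out_len a k0 n).
Local Notation Q := (seed_width a B n).
Local Notation U := ('I_L * ('I_lam.+1 * 'I_lam.+1))%type.
Local Notation T := (n.-tuple bool).

Definition coord (u : U) : nat := bit_seed_idx n u.1 u.2.1 u.2.2.

Lemma coord_lt u : coord u < bit_seed_len a B n.
Proof. by apply: bit_seed_idx_lt; [exact: ltn_ord|rewrite -ltnS; exact: ltn_ord..]. Qed.

Lemma coord_inj : injective coord.
Proof.
move=> [i [h b]] [i' [h' b']] /radix_inj[]; rewrite ?ltn_ord //=.
move=> /radix_inj[]; rewrite ?ltn_ord //= => ii hh bb.
by congr (_, (_, _)); exact: val_inj.
Qed.

Definition design (j : 'I_m) (u : U) : 'I_d := Ordinal (design_idx_lt j (coord_lt u)).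

Lemma design_eq j j' u u' : design j u = design j' u' ->
  u = u' /\ j %% nth_prime Q (coord u) = j' %% nth_prime Q (coord u).
Proof.
have residue_lt i v : i %% nth_prime Q (coord v) < Q.
  have [p_prime p_lt _] := design_prime (coord_lt v).
  exact: ltn_trans (ltn_pmod i (prime_gt0 p_prime)) p_lt.
by move=> /(congr1 val) /radix_inj[] // /coord_inj <-.
Qed.

Lemma design_inj j : injective (design j).
Proof. by move=> u u' /design_eq []. Qed.

(* A shared coordinate u gives a prime factor p_u of i - j. *)
Lemma overlap_card (i j : 'I_m) : j < i -> 2 ^ #|overlap design i j| <= m.
Proof.
move=> ji; have ij_gt0 : 0 < i - j by rewrite subn_gt0.
apply: leq_trans (_ : 2 ^ size (primes (i - j)) <= _); last first.
  by apply: leq_trans (exp2_size_primes ij_gt0) _; have := ltn_ord i; lia.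
rewrite leq_exp2l // cardE -(size_map (fun u => nth_prime Q (coord u))).
apply: uniq_leq_size.
  rewrite map_inj_in_uniq ?enum_uniq // => u u' _ _ prime_eq; apply: coord_inj.
  have [_ _ <-] := design_prime (coord_lt u); have [_ _ <-] := design_prime (coord_lt u').
  by rewrite prime_eq.
move=> p /mapP [u]; rewrite mem_enum inE => /existsP [u' /eqP /design_eq [u_eq residue_eq]] ->.
have [p_prime _ _] := design_prime (coord_lt u); rewrite mem_primes p_prime ij_gt0 /=.
by rewrite -eqn_mod_dvd ?(ltnW ji) //; apply/eqP; rewrite -u_eq residue_eq.
Qed.

Definition sampled_bit (x : T) (y : {ffun U -> bool}) : bool :=
  one_bit lam H L n (nth false x) (seed_fun y).

Lemma local_ext_nw : @local_ext a c A B k0 n = nw_ext design sampled_bit.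
Proof.
apply/funext => x; apply/funext => r; apply: eq_from_tnth => j.
rewrite tnth_local_ext tnth_mktuple; apply: eq_one_bit_seed; first exact: log_window_le.
move=> i h b iL h_le b_le; rewrite /seed_fun insubT ffunE (tnth_nth false) /=.
by rewrite /coord /= !inordK.
Qed.

Variable W : nat.
Hypothesis close_weight : forall s, 2 ^ (H + 2) * s < 2 ^ lam -> s <= W.

Definition close (x x' : T) : bool :=
  2 ^ (H + 2) * (\sum_(0 <= v < n) (nth false x v (+) nth false x' v)) < 2 ^ lam.

Lemma card_close x : #|[pred x' | close x x']| <= 2 ^ (lam * W).
Proof.
pose diff (x' : T) : {set 'I_n} := [set v | tnth x v (+) tnth x' v].
have diff_inj : injective diff.
  move=> x1 x2 diff_eq; apply: eq_from_tnth => v.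
  by move/setP: diff_eq => /(_ v); rewrite !inE => /addbI.
rewrite expnM; apply: leq_trans (_ : n.+1 ^ W <= _); last exact: leq_expn2r (bitlen_gt n).
have := card_small_sets 'I_n W; rewrite card_ord => /(leq_trans _); apply.
rewrite -(card_imset _ diff_inj).
apply: subset_leq_card; apply/fintype.subsetP => Z /imsetP [x' x'_close ->]; rewrite inE.
apply: leq_trans (close_weight x'_close); rewrite -sum1_card big_mkcond /= big_mkord.
by apply: leq_sum => v _; rewrite inE -!(tnth_nth false); case: (_ (+) _).
Qed.

Local Open Scope ring_scope.

Theorem local_ext_strong (k eta eps : R) : 0 <= eta ->
  (2 ^ (lam * W))%:R * 2 `^ (- k) <= eta ^+ 2 ->
  m%:R * ((2 ^ (m * m))%:R * eta + (13 / 16) ^+ (4 * B * lam ^ a)) / 2 <= eps ->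
  strong_extractor k eps (@local_ext a c A B k0 n).
Proof.
move=> eta_ge0 eta_sqr eps_ge X srcX; apply: le_trans eps_ge; rewrite local_ext_nw.
have X_le := is_source_le srcX; case: srcX => distX _.
apply: (nw_stat_dist design_inj distX (near := close) eta_ge0).
- by apply: exprn_ge0.
- move=> x; apply: le_trans eta_sqr.
  apply: le_trans (ler_sum _ (fun x' _ => X_le x')) _.
  rewrite sumr_const -[X in X <= _]mulr_natl ler_wpM2r ?powR_ge0 // ler_nat.
  exact: card_close.
- move=> x x'; rewrite /close -leqNgt => far.
  have -> : (13 / 16) ^+ (4 * B * lam ^ a) ^+ 2 = (13 / 16) ^+ L :> R.
    by rewrite -exprM /rounds; congr (_ ^+ _); lia.
  by apply: one_bit_correlation => //; [exact: log_window_le|apply/ltnW; exact: bitlen_gt].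
- move=> i; apply: leq_trans (_ : \sum_(j < m) m <= _)%N; last by rewrite sum_nat_const card_ord.
  by rewrite big_mkcond /=; apply: leq_sum => j _; case: ifP => // ji; exact: overlap_card.
Qed.

End Strong.

Lemma card_bigcup_le (I T : finType) (F : I -> {set T}) b :
  (forall i, #|F i| <= b) -> #|(\bigcup_i F i)%SET| <= #|I| * b.
Proof.
move=> F_le; rewrite -sum_nat_const.
apply: (big_rec2 (fun (S : {set T}) s => #|S| <= s)) => [|i S s _ S_le]; first by rewrite cards0.
apply: leq_trans (leq_card_setU _ _) _; exact: leq_add.
Qed.

Lemma local_ext_locality a c A B k0 n l :
  rounds a B n * 2 ^ log_window c A n <= l ->
  has_locality l (@local_ext a c A B k0 n).
Proof.
move=> l_ge r j; pose y i h b := nth false r (design_idx a B n j (bit_seed_idx n i h b)).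
pose hit_set (p : 'I_(rounds a B n) * 'I_(2 ^ log_window c A n)) : {set 'I_n} :=
  [set v : 'I_n | hits (bitlen n) (log_window c A n) (y p.1) p.2 v].
have v_lt (v : 'I_n) : v < 2 ^ bitlen n by exact: ltn_trans (ltn_ord v) (bitlen_gt n).
exists (\bigcup_p hit_set p)%SET; split.
  apply: leq_trans l_ge; rewrite -[X in _ <= X]muln1.
  rewrite -[X in _ <= X * _ * _]card_ord -[X in _ <= _ * X * _]card_ord -card_prod.
  apply: card_bigcup_le => p; apply/fintype.card_le1_eqP => v v'; rewrite !inE => hit hit'.
  by apply: val_inj; exact: hits_inj hit' hit.
move=> x x' agree; rewrite !tnth_local_ext; apply: eq_one_bit_source => i w v iL w_lt vn hit.
have := agree (Ordinal vn); rewrite !(tnth_nth false) /= => -> //.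
by apply/bigcupP; exists (Ordinal iL, Ordinal w_lt); rewrite ?inE.
Qed.

(** * Asymptotics *)

Local Open Scope classical_set_scope.
Local Open Scope ring_scope.

Lemma bitlen_large l0 : \forall n \near \oo, (l0 <= bitlen n)%N.
Proof.
exists (2 ^ l0)%N => // n /= n_ge; apply: ltnW; rewrite -(@ltn_exp2l 2) //.
by apply: leq_ltn_trans n_ge _; exact: bitlen_gt.
Qed.

Lemma seed_len_ge a B n : (0 < B)%N -> (bitlen n ^ a <= seed_len a B n)%N.
Proof.
move=> B_gt0; rewrite /seed_len /bit_seed_len /rounds.
by rewrite -2!mulnA mulnCA leq_pmulr // !muln_gt0 B_gt0.
Qed.

Lemma prime_range_le s E : (0 < E)%N -> (s <= E)%N -> (prime_range s <= 2 ^ 8 * (E * E))%N.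
Proof.
move=> E_gt0 sE; have := bitlen_le s; rewrite /prime_range -mulnn -[(2 ^ 8)%N]/256%N.
by move: (2 ^ bitlen s)%N => P P_le; nia.
Qed.

Lemma seed_len_le a B n : (0 < a)%N -> (8 * B <= bitlen n)%N -> (2 <= bitlen n)%N ->
  (seed_len a B n <= bitlen n ^ (26 * a))%N.
Proof.
move=> a_gt0; set l := bitlen n => B_le l_ge2.
have bit_seed_le : (bit_seed_len a B n <= l ^ (a + 5))%N.
  rewrite /bit_seed_len /rounds -/l (_ : a + 5 = 1 + a + 2 * 2)%N; last by lia.
  by rewrite !expnD expn1 expnM leq_mul ?leq_mul //; rewrite -mulnn; nia.
apply: leq_trans (leq_mul bit_seed_le (prime_range_le _ bit_seed_le)) _.
  by rewrite expn_gt0; lia.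
apply: leq_trans (_ : l ^ (a + 5) * (l ^ 8 * (l ^ (a + 5) * l ^ (a + 5))) <= _)%N.
  by rewrite leq_mul2l leq_mul2r leq_expn2r ?orbT.
by rewrite -!expnD leq_exp2l //; lia.
Qed.

Lemma locality_le a c A B n : (0 < a)%N -> (8 * B <= bitlen n)%N ->
  (2 * A + 2 <= bitlen n)%N ->
  (rounds a B n * 2 ^ log_window c A n <= bitlen n ^ (4 * (a + c)))%N.
Proof.
move=> a_gt0; set l := bitlen n => B_le A_le.
have rounds_le : (rounds a B n <= l ^ a.+1)%N by rewrite /rounds expnS leq_mul2r B_le orbT.
have window_le : (2 ^ log_window c A n <= l ^ c.+2)%N.
  apply: leq_trans (_ : 2 ^ bitlen (A * l ^ c.+1) <= _)%N.
    by rewrite leq_exp2l // geq_minl.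
  apply: leq_trans (bitlen_le _) _.
  have : (0 < l ^ c.+1)%N by rewrite expn_gt0; lia.
  rewrite (expnS l c.+1); move: (l ^ c.+1)%N => P P_gt0.
  apply: leq_trans (_ : (2 * A + 2) * P <= _)%N; first by nia.
  by rewrite leq_mul2r A_le orbT.
apply: leq_trans (leq_mul rounds_le window_le) _; rewrite -expnD leq_exp2l; lia.
Qed.

Section Powers.
Variable R : realType.

Lemma log2_exp2 (x : nat) : log2 (2 ^+ x : R) = x%:R.
Proof. by rewrite /log2 lnXn // -[ln 2 *+ x]mulr_natl mulfK // gt_eqF ?ln2_gt0. Qed.

Lemma ler_log2 (x y : R) : 0 < x -> x <= y -> log2 x <= log2 y.
Proof.
move=> x_gt0 xy; rewrite /log2 ler_pM2r ?invr_gt0 ?ln2_gt0 //.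
by rewrite ler_ln ?posrE // (lt_le_trans x_gt0).
Qed.

Lemma log2_bitlen n : (0 < n)%N ->
  log2 (n%:R : R) <= (bitlen n)%:R <= log2 (n%:R : R) + 2.
Proof.
move=> n_gt0; rewrite -[(bitlen n)%:R]log2_exp2; apply/andP; split.
  by apply: ler_log2; rewrite ?ltr0n // -natrX ler_nat; exact/ltnW/bitlen_gt.
have -> : log2 (n%:R : R) + 2 = log2 (n%:R * 2 ^+ 2 : R).
  by rewrite -[X in _ + X](log2_exp2 2) /log2 lnM ?posrE ?ltr0n ?exprn_gt0 // mulrDl.
apply: ler_log2; first by rewrite exprn_gt0.
by rewrite -!natrX -natrM ler_nat mulnC; exact: bitlen_le4.
Qed.

Lemma natr_exp2 (x : nat) : (2 ^ x)%:R = 2 `^ x%:R :> R.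
Proof. by rewrite powR_mulrn // natrX. Qed.

Lemma exp2D (x y : R) : 2 `^ (x + y) = 2 `^ x * 2 `^ y.
Proof. by rewrite powRD // pnatr_eq0 implybT. Qed.

Lemma ler_exp2 (x y : R) : x <= y -> 2 `^ x <= 2 `^ y.
Proof. by move=> xy; apply: ler_powR => //; rewrite ler1n. Qed.

Lemma powR_root (x k : nat) : (0 < k)%N -> (x ^ k)%:R `^ k%:R^-1 = x%:R :> R.
Proof.
move=> k_gt0; rewrite natrX -powR_mulrn // -powRrM mulfV ?powRr1 //.
by rewrite pnatr_eq0 -lt0n.
Qed.

Lemma powR_invn_le (x : R) k : (0 < k)%N -> 1 <= x -> x `^ k%:R^-1 <= x.
Proof.
move=> k_gt0 x_ge1; rewrite -[X in _ <= X]powRr1 ?(le_trans ler01) //.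
by apply: ler_powR => //; rewrite invf_le1 ?ler1n // ltr0n.
Qed.

Lemma root_le_exp2_bitlen k n : (0 < k)%N -> n%:R `^ k%:R^-1 <= 2 * (2 ^ (bitlen n %/ k))%:R :> R.
Proof.
move=> k_gt0; rewrite -[X in X * _]/(2%:R) -natrM -expnS -[X in _ <= X](powR_root _ k_gt0).
apply: ge0_ler_powR; rewrite ?nnegrE ?ler0n ?invr_ge0 // ler_nat -expnM.
apply: leq_trans (ltnW (bitlen_gt n)) _; rewrite leq_exp2l //.
by rewrite [X in (X <= _)%N](divn_eq _ k) mulSn addnC leq_add2r ltnW // ltn_pmod.
Qed.

Lemma exp2_bitlen_le_root k n : (0 < k)%N -> (0 < n)%N ->
  (2 ^ (bitlen n %/ k))%:R <= 4 * n%:R `^ k%:R^-1 :> R.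
Proof.
move=> k_gt0 n_gt0; rewrite -[X in X <= _](powR_root _ k_gt0).
apply: le_trans (_ : (4 * n)%:R `^ k%:R^-1 <= _).
  apply: ge0_ler_powR; rewrite ?nnegrE ?ler0n ?invr_ge0 // ler_nat -expnM.
  by apply: leq_trans (bitlen_le4 n_gt0); rewrite leq_exp2l // leq_divM.
by rewrite natrM powRM ?ler0n // ler_wpM2r ?powR_ge0 // powR_invn_le // ler1n.
Qed.

End Powers.

(* Of the k bits of entropy, half pays for the words close to a given one and a quarter
   for the m^2 bits of truth tables; the error has to be at most 2^(-e). *)
Section StrongParameters.
Variables (R : realType) (a c A B k0 n : nat) (k e : R).
Local Notation l := (bitlen n).
Local Notation m := (out_len a k0 n).
Hypotheses (a_gt0 : (0 < a)%N) (A_gt0 : (0 < A)%N) (k0_ge4 : (4 <= k0)%N) (n_gt0 : (0 < n)%N).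
Hypothesis table_small : (8 * A * (a + 2 + B) * l ^ (2 * a + c) <= 2 ^ (l %/ 2))%N.
Hypothesis window_small : (A.+1 * l ^ c.+1 <= 2 ^ (l %/ 2))%N.
Hypothesis k_ge : 2 * n%:R <= k * (A * l ^ c)%:R.
Hypothesis e_le : e + (a.+1 * l ^ a)%:R <= (B * l ^ a)%:R.

Let l_gt0 : (0 < l)%N. Proof. by rewrite up_log_gt0; lia. Qed.

Let Alc_gt0 : (0 < A * l ^ c)%N. Proof. by rewrite muln_gt0 A_gt0 expn_gt0 l_gt0. Qed.

Definition close_radius := (n %/ (A * l ^ c.+1))%N.

Lemma close_radius_ge s : (2 ^ (log_window c A n + 2) * s < 2 ^ l)%N -> (s <= close_radius)%N.
Proof.
have windowE : log_window c A n = bitlen (A * l ^ c.+1).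
  apply/minn_idPl/up_log_min => //; apply: leq_trans (_ : A.+1 * l ^ c.+1 <= _)%N.
    by rewrite mulSn -add1n leq_add2r expn_gt0 l_gt0.
  by apply: leq_trans window_small _; rewrite leq_exp2l // leq_div.
rewrite /close_radius leq_divRL ?muln_gt0 ?A_gt0 ?expn_gt0 ?l_gt0 //.
have := bitlen_gt (A * l ^ c.+1); have := bitlen_le n; rewrite -windowE expnD -[(2 ^ 2)%N]/4%N.
move: (2 ^ log_window c A n)%N (2 ^ l)%N (A * l ^ c.+1)%N => P Q V Q_le V_lt s_lt.
have : (V * s <= P * s)%N by rewrite leq_mul2r ltnW ?orbT.
by rewrite [(s * V)%N]mulnC; lia.
Qed.

Lemma close_entropy_le : (l * close_radius)%:R <= k / 2.
Proof.
have radius_le : (l * close_radius * (A * l ^ c) <= n)%N.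
  by have := leq_divM n (A * l ^ c.+1); rewrite -/close_radius expnS; lia.
have := radius_le; rewrite -(ler_nat R) natrM.
have : 0 < (A * l ^ c)%:R :> R by rewrite ltr0n.
move: ((A * l ^ c)%:R : R) ((l * close_radius)%:R : R) (n%:R : R) k_ge => P Q M k_P P_gt0 QP.
by rewrite -(ler_pM2r P_gt0); lra.
Qed.

Lemma out_len_le_exp2 : (m <= 2 ^ (l * a.+1))%N.
Proof.
rewrite /out_len mulnS expnD; apply: leq_mul; first by rewrite leq_exp2l // leq_div.
by rewrite expnM; apply: leq_expn2r; exact/ltnW/ltn_expl.
Qed.

Lemma out_len_sqr_le : (m * m <= 2 ^ (l %/ 2) * l ^ (2 * a))%N.
Proof.
rewrite /out_len mulnACA -!expnD !addnn -!mul2n leq_mul2r leq_exp2l //.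
apply/orP; right; rewrite leq_divRL // mulnAC mulnC.
apply: leq_trans (_ : (l %/ k0) * k0 <= _)%N; last exact: leq_divM.
by rewrite leq_mul2l; lia.
Qed.

Lemma len_le_exp : (l <= l ^ a)%N.
Proof. by rewrite -[X in (X <= _)%N]expn1 leq_pexp2l. Qed.

Lemma entropy_budget_le : (2 ^ (l %/ 2) * ((a + 2 + B) * l ^ (2 * a)))%:R <= k / 4.
Proof.
have Alc_pos : 0 < (A * l ^ c)%:R :> R by rewrite ltr0n.
rewrite -(ler_pM2r Alc_pos).
have : (2 ^ (l %/ 2) * ((a + 2 + B) * l ^ (2 * a)) * (A * l ^ c) * 8 <= 4 * n)%N.
  apply: leq_trans (bitlen_le4 n_gt0).
  apply: leq_trans (_ : 2 ^ (l %/ 2) * 2 ^ (l %/ 2) <= _)%N; last first.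
    by rewrite -expnD leq_exp2l //; lia.
  rewrite -!mulnA leq_mul2l; apply/orP; right.
  by apply: leq_trans table_small; rewrite expnD; lia.
by rewrite -(ler_nat R) !natrM; move: k_ge; rewrite !natrM; lra.
Qed.

Lemma table_entropy_le : (l * a.+1)%:R + (m * m)%:R + e <= k / 4.
Proof.
apply: le_trans entropy_budget_le.
apply: le_trans (_ : (l * a.+1 + m * m + B * l ^ a)%:R <= _).
  rewrite !natrD lerD2l; apply: le_trans e_le; rewrite lerDl; exact: ler0n.
have exp2_gt0 : (0 < 2 ^ (l %/ 2))%N by rewrite expn_gt0.
have len_le_exp2a : (l <= l ^ (2 * a))%N by rewrite -[X in (X <= _)%N]expn1 leq_pexp2l; lia.
rewrite ler_nat (_ : a + 2 + B = a.+1 + 1 + B)%N; last by lia.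
move: (a.+1) => b; rewrite !mulnDl mul1n !mulnDr; apply: leq_add; first apply: leq_add => //.
- by rewrite [(l * _)%N]mulnC (leq_trans _ (leq_pmull _ exp2_gt0)) // leq_mul2l len_le_exp2a orbT.
- exact: out_len_sqr_le.
- rewrite (leq_trans _ (leq_pmull _ exp2_gt0)) // leq_mul2l leq_pexp2l ?orbT //; lia.
Qed.

Lemma sampling_error_le : m%:R * (13 / 16) ^+ (4 * B * l ^ a) <= 2 `^ (- e).
Proof.
rewrite -mulnA [(_ ^+ _)]exprM.
apply: le_trans (_ : (2 ^ (l * a.+1))%:R * (2 `^ (-1)) ^+ (B * l ^ a) <= _).
  apply: ler_pM => //; rewrite ?ler_nat ?out_len_le_exp2 ?exprn_ge0 //.
  apply: lerXn2r; rewrite ?nnegrE ?exprn_ge0 ?powR_ge0 //.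
  by rewrite powRN powRr1 // !exprS expr0; lra.
rewrite natr_exp2 -powR_mulrn ?powR_ge0 // -powRrM -exp2D; apply: ler_exp2.
have : (l * a.+1)%:R <= (a.+1 * l ^ a)%:R :> R.
  by rewrite ler_nat mulnC leq_mul2l len_le_exp orbT.
by have := e_le; lra.
Qed.

Lemma table_error_le : m%:R * ((2 ^ (m * m))%:R * 2 `^ (- (k / 4))) <= 2 `^ (- e).
Proof.
apply: le_trans (_ : (2 ^ (l * a.+1))%:R * ((2 ^ (m * m))%:R * 2 `^ (- (k / 4))) <= _).
  by rewrite ler_wpM2r ?mulr_ge0 ?powR_ge0 ?ler0n // ler_nat out_len_le_exp2.
by rewrite !natr_exp2 -!exp2D; apply: ler_exp2; have := table_entropy_le; lra.
Qed.

Lemma local_ext_strong_params : strong_extractor k (1 / 2 `^ e) (@local_ext a c A B k0 n).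
Proof.
apply: (local_ext_strong close_radius_ge (eta := 2 `^ (- (k / 4)))).
- exact: powR_ge0.
- rewrite expr2 natr_exp2 -!exp2D; apply: ler_exp2.
  by have := close_entropy_le; lra.
- by rewrite div1r -powRN mulrDr; have := sampling_error_le; have := table_error_le; lra.
Qed.

End StrongParameters.

Section LargeInput.
Variables (R : realType) (n : nat).
Local Notation l := (bitlen n).
Local Notation t := (log2 (n%:R : R)).
Hypothesis l_ge6 : (6 <= l)%N.

Lemma large_gt0 : (0 < n)%N.
Proof. by case: n l_ge6 => //; rewrite /bitlen up_log1. Qed.

Lemma log2_large : 4 <= t.
Proof.
have /andP [_] := log2_bitlen R large_gt0.
have : 6%:R <= l%:R :> R by rewrite ler_nat.
lra.
Qed.

Lemma log2_ge0 : 0 <= t.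
Proof. exact: le_trans log2_large. Qed.

Lemma log2_exp_le N : t ^+ N <= (l ^ N)%:R.
Proof.
have /andP [t_le _] := log2_bitlen R large_gt0.
by rewrite natrX lerXn2r // ?nnegrE ?ler0n ?log2_ge0.
Qed.

Lemma log2_powR_le N : t `^ N%:R <= (l ^ N)%:R.
Proof. by rewrite powR_mulrn ?log2_ge0 // log2_exp_le. Qed.

Lemma bitlen_exp_le N : (l ^ N)%:R <= t `^ (2 * N)%:R.
Proof.
have t_ge4 := log2_large; have /andP [_ l_le] := log2_bitlen R large_gt0.
rewrite powR_mulrn ?log2_ge0 // natrX exprM lerXn2r // ?nnegrE ?ler0n ?exprn_ge0 ?log2_ge0 //.
by rewrite expr2; nra.
Qed.

Lemma log2_exp_ge4 N : (0 < N)%N -> 4 <= t ^+ N.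
Proof.
move=> N_gt0; apply: (le_trans log2_large); rewrite -{1}[t]expr1.
by apply: ler_weXn2l => //; have := log2_large; lra.
Qed.

Lemma out_len_ge a k0 : (0 < k0)%N ->
  n%:R `^ k0%:R^-1 * t ^+ a / 2 <= (out_len a k0 n)%:R :> R.
Proof.
move=> k0_gt0; rewrite /out_len natrM -mulrA [_ ^+ a / _]mulrC mulrA.
apply: ler_pM; rewrite ?exprn_ge0 ?log2_ge0 ?log2_exp_le ?mulr_ge0 ?powR_ge0 //.
by rewrite ler_pdivrMr // mulrC root_le_exp2_bitlen.
Qed.

Lemma out_len_polylog_ge a k0 : (0 < a)%N -> (0 < k0)%N ->
  n%:R `^ k0%:R^-1 * t `^ (2^-1 * a%:R) <= (out_len a k0 n)%:R :> R.
Proof.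
move=> a_gt0 k0_gt0; apply: le_trans (out_len_ge a k0_gt0).
rewrite -mulrA ler_wpM2l ?powR_ge0 //; set s := t `^ _.
have s_ge0 : 0 <= s by exact: powR_ge0.
have s_sqr : s * s = t ^+ a.
  rewrite -powR_mulrn ?log2_ge0 // /s -powRD; first by congr (_ `^ _); lra.
  by apply/implyP => _; have := log2_large; lra.
by have := log2_exp_ge4 a_gt0; rewrite -s_sqr ler_pdivlMr //; nra.
Qed.

Lemma out_len_polylog_le a k0 : (0 < a)%N -> (0 < k0)%N ->
  (out_len a k0 n)%:R <= n%:R `^ k0%:R^-1 * t `^ (3 * a%:R) :> R.
Proof.
move=> a_gt0 k0_gt0; rewrite /out_len natrM.
apply: le_trans (_ : 4 * n%:R `^ k0%:R^-1 * t `^ (2 * a)%:R <= _).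
  by apply: ler_pM; rewrite ?bitlen_exp_le // exp2_bitlen_le_root ?large_gt0.
rewrite [4 * _]mulrC -mulrA ler_wpM2l ?powR_ge0 // natrM.
have -> : 3 * a%:R = a%:R + 2 * a%:R :> R by ring.
rewrite powRD; last by apply/implyP => _; have := log2_large; lra.
by rewrite ler_wpM2r ?powR_ge0 // powR_mulrn ?log2_ge0 // log2_exp_ge4.
Qed.

Lemma entropy_root_le a c k0 (k c1 c2 : R) : (0 < a)%N -> (0 < k0)%N -> 0 < c1 -> 0 < c2 ->
  2 * (c2 + 1) <= t ->
  c1 * (n%:R / t ^+ c) <= k <= c2 * (n%:R / t ^+ c) ->
  k `^ k0%:R^-1 <= (out_len a k0 n)%:R.
Proof.
move=> a_gt0 k0_gt0 c1_gt0 c2_gt0 t_ge /andP [k_ge k_le].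
have t_ge4 := log2_large; apply: le_trans (out_len_ge a k0_gt0).
have tc_ge1 : 1 <= t ^+ c by rewrite exprn_ege1 //; lra.
have quot_ge0 : 0 <= n%:R / t ^+ c by rewrite divr_ge0 ?ler0n ?exprn_ge0 ?log2_ge0.
have k_ge0 : 0 <= k by apply: le_trans k_ge; rewrite mulr_ge0 // ltW.
have k_le_n : k <= (c2 + 1) * n%:R.
  apply: le_trans k_le _; apply: ler_pM; rewrite ?lerDl ?(ltW c2_gt0) //.
  by rewrite ler_pdivrMr ?ler_peMr //; lra.
apply: le_trans (_ : ((c2 + 1) * n%:R) `^ k0%:R^-1 <= _).
  by apply: ge0_ler_powR; rewrite ?nnegrE ?invr_ge0 ?mulr_ge0 //; lra.
rewrite powRM; [|by lra|exact: ler0n].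
rewrite mulrC -mulrA ler_wpM2l ?powR_ge0 //; apply: le_trans (powR_invn_le k0_gt0 _) _.
  by lra.
rewrite ler_pdivlMr // mulrC; apply: le_trans t_ge _.
by rewrite -{1}[t]expr1; apply: ler_weXn2l => //; lra.
Qed.

End LargeInput.

Section Family.
Variables (R : realType) (a c A B k0 : nat).
Hypothesis a_gt0 : (0 < a)%N.

Lemma local_ext_strong_near (k e : nat -> R) (c1 c2 : R) : 0 < c1 -> 0 < c2 ->
  (4 <= k0)%N -> 2 <= A%:R * c1 -> c2 + a.+1%:R <= B%:R ->
  (\forall n \near \oo, c1 * (n%:R / log2 n%:R ^+ c) <= k n) ->
  (\forall n \near \oo, e n <= c2 * log2 n%:R ^+ a) ->
  \forall n \near \oo, strong_extractor (k n) (1 / 2 `^ e n) (@local_ext a c A B k0 n).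
Proof.
move=> c1_gt0 c2_gt0 k0_ge4 A_ge B_ge k_ge e_le.
have A_gt0 : (0 < A)%N by rewrite lt0n; apply: contraTneq A_ge => ->; rewrite mul0r -ltNge.
have [N1 table_small] := poly_le_exp2_half (2 * a + c) (8 * A * (a + 2 + B)).
have [N2 window_small] := poly_le_exp2_half c.+1 A.+1.
near=> n; have l_ge6 : (6 <= bitlen n)%N by near: n; exact: bitlen_large.
have n_gt0 := large_gt0 l_ge6; have t_ge4 := log2_large R l_ge6.
apply: local_ext_strong_params => //.
- by apply: table_small; near: n; exact: bitlen_large.
- by apply: window_small; near: n; exact: bitlen_large.
- have tc_gt0 : 0 < log2 n%:R ^+ c :> R by rewrite exprn_gt0 //; lra.
  apply: le_trans (_ : c1 * (n%:R / log2 n%:R ^+ c) * (A%:R * log2 n%:R ^+ c) <= _).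
    rewrite (_ : _ * _ = A%:R * c1 * n%:R); last by field; rewrite gt_eqF.
    by rewrite ler_wpM2r.
  apply: ler_pM; rewrite ?mulr_ge0 ?invr_ge0 ?(ltW c1_gt0) ?(ltW tc_gt0) //.
    by near: n; exact: k_ge.
  by rewrite natrM ler_wpM2l // log2_exp_le.
- have e_le_l : e n <= c2 * (bitlen n ^ a)%:R.
    apply: le_trans (_ : c2 * log2 n%:R ^+ a <= _); first by near: n; exact: e_le.
    by rewrite ler_wpM2l ?(ltW c2_gt0) ?log2_exp_le.
  rewrite !natrM; apply: le_trans (_ : (c2 + a.+1%:R) * (bitlen n ^ a)%:R <= _).
    by rewrite mulrDl lerD2r.
  by rewrite ler_wpM2r.
Unshelve. all: by end_near. Qed.

Lemma local_ext_locality_near : \forall n \near \oo,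
  has_locality (bitlen n ^ (4 * (a + c))) (@local_ext a c A B k0 n).
Proof.
near=> n; apply/local_ext_locality/locality_le => //; near: n; exact: bitlen_large.
Unshelve. all: by end_near. Qed.

Lemma seed_len_polylog : (0 < B)%N ->
  polylog_Theta_with (1, 52) (a%:R : R) (fun=> 1) (fun n => (seed_len a B n)%:R).
Proof.
move=> B_gt0; near=> n; have l_ge6 : (6 <= bitlen n)%N by near: n; exact: bitlen_large.
have B_le : (8 * B <= bitlen n)%N by near: n; exact: bitlen_large.
rewrite !mul1r; apply/andP; split.
  by apply: le_trans (log2_powR_le R l_ge6 a) _; rewrite ler_nat; exact: seed_len_ge.
rewrite (_ : 52 * a%:R = (2 * (26 * a))%:R); last by rewrite mulnA natrM.
apply: le_trans (bitlen_exp_le R l_ge6 _); rewrite ler_nat.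
by apply: seed_len_le => //; exact: leq_trans l_ge6.
Unshelve. all: by end_near. Qed.

Lemma out_len_polylog : (0 < k0)%N -> polylog_Theta_with (2^-1, 3) (a%:R : R)
  (fun n => n%:R `^ k0%:R^-1) (fun n => (out_len a k0 n)%:R).
Proof.
move=> k0_gt0; near=> n.
have l_ge6 : (6 <= bitlen n)%N by near: n; exact: bitlen_large.
by rewrite out_len_polylog_ge // out_len_polylog_le.
Unshelve. all: by end_near. Qed.

Lemma entropy_root_near (k : nat -> R) : (0 < k0)%N ->
  is_Theta k (fun n => n%:R / log2 n%:R ^+ c) ->
  \forall n \near \oo, k n `^ k0%:R^-1 <= (out_len a k0 n)%:R.
Proof.
move=> k0_gt0 [c1 [c2 [c1_gt0 c2_gt0 k_Theta]]].
near=> n; have l_ge6 : (6 <= bitlen n)%N by near: n; exact: bitlen_large.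
apply: (entropy_root_le l_ge6 a_gt0 k0_gt0 c1_gt0 c2_gt0 (c := c)); last by near: n.
have bound_le : (Num.bound (2 * (c2 + 1)) + 2 <= bitlen n)%N by near: n; exact: bitlen_large.
have bound_gt : 2 * (c2 + 1) < (Num.bound (2 * (c2 + 1)))%:R by apply: archi_boundP; lra.
have /andP [_ l_le] := log2_bitlen R (large_gt0 l_ge6).
by move: bound_le; rewrite -(ler_nat R) natrD; lra.
Unshelve. all: by end_near. Qed.

Lemma locality_polylog : polylog_Theta_with (1, 8) ((a + c)%:R : R) (fun=> 1)
  (fun n => (bitlen n ^ (4 * (a + c)))%:R).
Proof.
near=> n; have l_ge6 : (6 <= bitlen n)%N by near: n; exact: bitlen_large.
rewrite !mul1r; apply/andP; split.
  apply: le_trans (log2_powR_le R l_ge6 _) _; rewrite ler_nat leq_pexp2l //; lia.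
rewrite (_ : 8 * (a + c)%:R = (2 * (4 * (a + c)))%:R); last by rewrite mulnA natrM.
exact: bitlen_exp_le.
Unshelve. all: by end_near. Qed.

End Family.

Theorem mainTheorem8 (R : realType) :
  exists (Cdepth Cd Cm Cl : R * R) (delta : R),
    [/\ Theta_consts Cdepth, Theta_consts Cd, Theta_consts Cm,
        Theta_consts Cl & 0 < delta] /\
    forall (a c : nat) (k eps e : nat -> R) (gamma : R),
      (0 < a)%N ->
      is_Theta k (fun n => n%:R / log2 n%:R ^+ c) ->
      is_Theta e (fun n => log2 n%:R ^+ a) ->
      (forall n, eps n = 1 / 2 `^ e n) ->
      0 < gamma < 1 ->
      exists (d m l : nat -> nat) (depth : nat) (Ext : ext_family d m),
        explicit Ext /\
        computable_in_AC0 depth Ext /\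
        Theta_with Cdepth depth%:R (a + c)%:R /\
        (\forall n \near \oo, strong_extractor (k n) (eps n) (Ext n)) /\
        (\forall n \near \oo, has_locality (l n) (Ext n)) /\
        polylog_Theta_with Cd a%:R (fun _ => 1) (fun n => (d n)%:R) /\
        polylog_Theta_with Cm a%:R (fun n => n%:R `^ (10800%:R^-1))
          (fun n => (m n)%:R) /\
        (\forall n \near \oo, k n `^ delta <= (m n)%:R) /\
        polylog_Theta_with Cl (a + c)%:R (fun _ => 1) (fun n => (l n)%:R).
Proof.
exists (1, 17), (1, 52), (2^-1, 3), (1, 8), 10800%:R^-1; split.
  by split; rewrite ?invr_gt0 ?ltr0n // /Theta_consts /=; split; lra.
move=> a c k eps e gamma a_gt0 k_Theta [e1 [e2 [e1_gt0 e2_gt0 e_bounds]]] /funext -> _.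
have [c1 [c2 [c1_gt0 _ k_bounds]]] := k_Theta.
pose A := Num.bound (2 / c1); pose B := Num.bound (e2 + a.+1%:R).
have A_ge : 2 <= A%:R * c1.
  by rewrite -ler_pdivrMr // ltW // archi_boundP // divr_ge0 // ltW.
have B_ge : e2 + a.+1%:R <= B%:R by rewrite ltW // archi_boundP // addr_ge0 // ltW.
have B_gt0 : (0 < B)%N by rewrite -(ltr0n R) (lt_le_trans _ B_ge) // ltr_wpDr.
exists (seed_len a B), (out_len a 10800), (fun n => bitlen n ^ (4 * (a + c)))%N,
  (3 * (a + c) + 14)%N, (@local_ext a c A B 10800).
split; first exact: local_ext_explicit.
split; first exact: local_ext_AC0.
split; first by rewrite /Theta_with !mul1r -natrM !ler_nat; apply/andP; split; lia.
split.
  apply: (local_ext_strong_near a_gt0 c1_gt0 e2_gt0 (isT : 4 <= 10800)%N A_ge B_ge).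
    by apply: filterS k_bounds => n /andP [].
  by apply: filterS e_bounds => n /andP [].
split; first exact: local_ext_locality_near.
split; first exact: seed_len_polylog.
split; first exact: (out_len_polylog R a_gt0 (isT : 0 < 10800)%N).
split; last exact: locality_polylog.
exact: (entropy_root_near a_gt0 (isT : 0 < 10800)%N k_Theta).
Qed.
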